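(* If there is a $\beta$-model of $\mathsf{GB}+\mathsf{ETR}$, then there is a minimum $\beta$-model of $\mathsf{GB}+\mathsf{ETR}$; that is, a $\beta$-model $(M,\mathcal X)\models\mathsf{GB}+\mathsf{ETR}$ such that every $\beta$-model $(N,\mathcal Y)\models\mathsf{GB}+\mathsf{ETR}$ satisfies $M\subseteq N$ and $\mathcal X\subseteq\mathcal Y$. Moreover this minimum $\beta$-model satisfies Global Choice.
   Context: Models of second-order set theory are pairs $(M,\mathcal X)$ with $M$ a model of set theory and $\mathcal X\subseteq\mathcal P(M)$ the classes. $\mathsf{GB}$ consists of $\mathsf{ZF}$ for sets, Extensionality for classes, Class Replacement, and Elementary Comprehension (comprehension for formulas without class quantifiers, with set and class parameters). Global Choice: there is a class bijection between $V$ and $\mathrm{Ord}$. $\mathsf{ETR}$ (Elementary Transfinite Recursion) is the schema: for every first-order formula $\varphi(x,Y,A)$ (with class parameter $A$) and every well-founded class relation $R$, there is a class $S\subseteq\mathrm{dom}R\times V$ with $S_r=\{x:\varphi(x,S\restriction r,A)\}$ for all $r\in\mathrm{dom}R$, where $S_r=\{x:(r,x)\in S\}$, $<_R$ is the transitive closure of $R$, and $S\restriction r=S\cap(\{r':r'<_R r\}\times V)$. A $\beta$-model is a model $(M,\mathcal X)$ with $M$ transitive (true $\in$) such that every $R\in\mathcal X$ which $(M,\mathcal X)$ thinks is a well-founded relation really is well-founded. *)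

(* Defs.v *)
(** * The ambient universe of sets

    Aczel's type of well-founded trees, with bisimilarity as equality of sets.
    With classical logic and choice it is a model of ZFC, and it plays the role
    of the background universe in which models are sets. *)

Inductive V : Type := sup : forall A : Type, (A -> V) -> V.

Fixpoint eqV (x y : V) : Prop :=
  match x, y with
  | sup A f, sup B g =>
      (forall a, exists b, eqV (f a) (g b)) /\
      (forall b, exists a, eqV (f a) (g b))
  end.

Definition inV (x y : V) : Prop :=
  match y with sup B g => exists b, eqV x (g b) end.

Declare Scope set_scope.
Delimit Scope set_scope with set.
Notation "x ≡ y" := (eqV x y) (at level 70, no associativity) : set_scope.
Notation "x ∈ y" := (inV x y) (at level 70, no associativity) : set_scope.
Open Scope set_scope.

Definition subV (x y : V) : Prop := forall z, z ∈ x -> z ∈ y.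
Notation "x ⊆ y" := (subV x y) (at level 70, no associativity) : set_scope.

Lemma eqV_refl x : x ≡ x.
Proof. induction x as [A f IH]; split; intros a; exists a; apply IH. Qed.

Lemma eqV_sym x y : x ≡ y -> y ≡ x.
Proof.
  revert y; induction x as [A f IH]; intros [B g] [H1 H2]; split.
  - intros b; destruct (H2 b) as [a Ha]; exists a; apply IH, Ha.
  - intros a; destruct (H1 a) as [b Hb]; exists b; apply IH, Hb.
Qed.

Lemma eqV_trans x y z : x ≡ y -> y ≡ z -> x ≡ z.
Proof.
  revert y z; induction x as [A f IH]; intros [B g] [C h] [H1 H2] [K1 K2]; split.
  - intros a; destruct (H1 a) as [b Hb]; destruct (K1 b) as [c Hc].
    exists c; exact (IH a _ _ Hb Hc).
  - intros c; destruct (K2 c) as [b Hb]; destruct (H2 b) as [a Ha].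
    exists a; exact (IH a _ _ Ha Hb).
Qed.

Lemma eqV_ext x y : x ≡ y <-> forall z, z ∈ x <-> z ∈ y.
Proof.
  destruct x as [A f], y as [B g]; split.
  - intros [H1 H2] z; split; intros [c Hc].
    + destruct (H1 c) as [b Hb]; exists b; exact (eqV_trans _ _ _ Hc Hb).
    + destruct (H2 c) as [a Ha]; exists a.
      exact (eqV_trans _ _ _ Hc (eqV_sym _ _ Ha)).
  - intros H; split.
    + intros a; destruct (proj1 (H (f a))) as [b Hb].
      * exists a; apply eqV_refl.
      * exists b; exact Hb.
    + intros b; destruct (proj2 (H (g b))) as [a Ha].
      * exists b; apply eqV_refl.
      * exists a; apply eqV_sym, Ha.
Qed.

Lemma inV_eqV_l x x' y : x ≡ x' -> x ∈ y -> x' ∈ y.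
Proof.
  destruct y as [B g]; intros Hx [b Hb]; exists b.
  exact (eqV_trans _ _ _ (eqV_sym _ _ Hx) Hb).
Qed.

(** * First-order formulas with class variables

    Set variables and class variables are two separate families indexed by
    [nat]; set variables are de Bruijn indices, bound by [fAll], and class
    variables are never bound. *)

Inductive form : Type :=
| fIn  (i j : nat)
| fEq  (i j : nat)
| fCls (i k : nat)  (* set variable [i] belongs to class variable [k] *)
| fNot (p : form)
| fAnd (p q : form)
| fAll (p : form).

Definition scons {T : Type} (x : T) (s : nat -> T) (n : nat) : T :=
  match n with O => x | S m => s m end.

Fixpoint uses_class (k : nat) (p : form) : Prop :=
  match p with
  | fIn _ _ | fEq _ _ => False
  | fCls _ l => l = k
  | fNot q | fAll q => uses_class k q
  | fAnd q r => uses_class k q \/ uses_class k r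
  end.

Definition class_free (p : form) : Prop := forall k, ~ uses_class k p.

Fixpoint sat (M : V -> Prop) (p : form) (s : nat -> V) (C : nat -> V -> Prop)
  : Prop :=
  match p with
  | fIn i j => s i ∈ s j
  | fEq i j => s i ≡ s j
  | fCls i k => C k (s i)
  | fNot q => ~ sat M q s C
  | fAnd q r => sat M q s C /\ sat M r s C
  | fAll q => forall x, M x -> sat M q (scons x s) C
  end.

Definition elements (a : V) : V -> Prop := fun x => x ∈ a.

(** * Notions relativized to a structure

    [M] is the domain of the set quantifiers and [X] the domain of the class
    quantifiers; membership is always the true one. *)

Definition is_upair (M : V -> Prop) (p a b : V) : Prop :=
  forall z, M z -> (z ∈ p <-> z ≡ a \/ z ≡ b).

Definition is_opair (M : V -> Prop) (p a b : V) : Prop :=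
  exists s t, M s /\ M t /\
    is_upair M s a a /\ is_upair M t a b /\ is_upair M p s t.

(* [rel M R x y]: the ordered pair (x, y) belongs to R; for a relation used as
   an order, x is below y. *)
Definition rel (M : V -> Prop) (R x y : V) : Prop :=
  exists p, M p /\ is_opair M p x y /\ p ∈ R.

Definition is_relation (M : V -> Prop) (R : V) : Prop :=
  forall p, M p -> p ∈ R -> exists x y, M x /\ M y /\ is_opair M p x y.

Definition is_function (M : V -> Prop) (F : V) : Prop :=
  is_relation M F /\
  forall x y y', M x -> M y -> M y' -> rel M F x y -> rel M F x y' -> y ≡ y'.

Definition wf_relation (M X : V -> Prop) (R : V) : Prop :=
  is_relation M R /\
  forall A, X A -> (exists x, M x /\ x ∈ A) ->
    exists m, M m /\ m ∈ A /\ forall y, M y -> y ∈ A -> ~ rel M R y m.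

(* A transitive set linearly ordered by membership; that the order is a
   well-order comes from Foundation. *)
Definition is_ordinal (M : V -> Prop) (o : V) : Prop :=
  (forall x y, M x -> M y -> x ∈ y -> y ∈ o -> x ∈ o) /\
  (forall x y, M x -> M y -> x ∈ o -> y ∈ o -> x ∈ y \/ x ≡ y \/ y ∈ x).

(** * ZF *)

Definition Extensionality (M : V -> Prop) : Prop :=
  forall x y, M x -> M y -> (forall z, M z -> (z ∈ x <-> z ∈ y)) -> x ≡ y.

Definition Foundation (M : V -> Prop) : Prop :=
  forall x, M x -> (exists y, M y /\ y ∈ x) ->
    exists y, M y /\ y ∈ x /\ forall z, M z -> z ∈ x -> ~ z ∈ y.

Definition Pairing (M : V -> Prop) : Prop :=
  forall a b, M a -> M b -> exists p, M p /\ is_upair M p a b.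

Definition Union (M : V -> Prop) : Prop :=
  forall a, M a -> exists u, M u /\
    forall z, M z -> (z ∈ u <-> exists y, M y /\ z ∈ y /\ y ∈ a).

Definition Powerset (M : V -> Prop) : Prop :=
  forall a, M a -> exists p, M p /\
    forall z, M z -> (z ∈ p <-> forall w, M w -> w ∈ z -> w ∈ a).

Definition Infinity (M : V -> Prop) : Prop :=
  exists w, M w /\
    (exists e, M e /\ e ∈ w /\ forall z, M z -> ~ z ∈ e) /\
    (forall x, M x -> x ∈ w -> exists y, M y /\ y ∈ w /\
       forall z, M z -> (z ∈ y <-> z ∈ x \/ z ≡ x)).

(* In the two set schemas [C] is arbitrary: the formulas have no class
   variables. *)
Definition Separation (M : V -> Prop) : Prop :=
  forall (p : form) (s : nat -> V) (C : nat -> V -> Prop),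
    class_free p -> (forall i, M (s i)) ->
    forall a, M a -> exists b, M b /\
      forall x, M x -> (x ∈ b <-> x ∈ a /\ sat M p (scons x s) C).

(* Variable 0 is the argument and variable 1 the value. *)
Definition Replacement (M : V -> Prop) : Prop :=
  forall (p : form) (s : nat -> V) (C : nat -> V -> Prop),
    class_free p -> (forall i, M (s i)) ->
    forall a, M a ->
    (forall x y y', M x -> M y -> M y' -> x ∈ a ->
       sat M p (scons x (scons y s)) C -> sat M p (scons x (scons y' s)) C ->
       y ≡ y') ->
    exists b, M b /\ forall y, M y ->
      (y ∈ b <-> exists x, M x /\ x ∈ a /\ sat M p (scons x (scons y s)) C).

Definition ZF (M : V -> Prop) : Prop :=
  Extensionality M /\ Foundation M /\ Pairing M /\ Union M /\ Powerset M /\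
  Infinity M /\ Separation M /\ Replacement M.

(** * Second-order axioms *)

Definition ClassExtensionality (M X : V -> Prop) : Prop :=
  forall A B, X A -> X B -> (forall x, M x -> (x ∈ A <-> x ∈ B)) -> A ≡ B.

Definition ClassReplacement (M X : V -> Prop) : Prop :=
  forall F, X F -> is_function M F ->
    forall a, M a -> exists b, M b /\
      forall y, M y -> (y ∈ b <-> exists x, M x /\ x ∈ a /\ rel M F x y).

(* Only the class variables occurring in the formula must denote classes, so
   that the instances without class parameters are not vacuous if X is empty. *)
Definition ElementaryComprehension (M X : V -> Prop) : Prop :=
  forall (p : form) (s : nat -> V) (P : nat -> V),
    (forall i, M (s i)) -> (forall k, uses_class k p -> X (P k)) ->
    exists A, X A /\
      forall x, M x ->
        (x ∈ A <-> sat M p (scons x s) (fun k => elements (P k))).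

Definition GB (M X : V -> Prop) : Prop :=
  ZF M /\ ClassExtensionality M X /\ ClassReplacement M X /\
  ElementaryComprehension M X.

Definition GlobalChoice (M X : V -> Prop) : Prop :=
  exists F, X F /\ is_function M F /\
    (forall x, M x -> exists o, M o /\ rel M F x o) /\
    (forall x o, M x -> M o -> rel M F x o -> is_ordinal M o) /\
    (forall x x' o, M x -> M x' -> M o ->
       rel M F x o -> rel M F x' o -> x ≡ x') /\
    (forall o, M o -> is_ordinal M o -> exists x, M x /\ rel M F x o).

(** * Elementary transfinite recursion *)

(* dom R is the field of R: the class on which R is a relation. *)
Definition in_dom (M : V -> Prop) (R r : V) : Prop :=
  exists y, M y /\ (rel M R r y \/ rel M R y r).

Definition is_transitive_rel (M : V -> Prop) (T : V) : Prop :=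
  is_relation M T /\
  forall x y z, M x -> M y -> M z -> rel M T x y -> rel M T y z -> rel M T x z.

(* Membership of (x, y) in the least transitive class containing R. *)
Definition trans_closure (M X : V -> Prop) (R x y : V) : Prop :=
  forall T, X T -> is_transitive_rel M T ->
    (forall u v, M u -> M v -> rel M R u v -> rel M T u v) -> rel M T x y.

Definition restrict_below (M X : V -> Prop) (S R r : V) : V -> Prop :=
  fun p => p ∈ S /\
    exists r' x, M r' /\ M x /\ is_opair M p r' x /\ trans_closure M X R r' r.

(* The formula phi(x, Y, A) is obtained by reading every free set variable as
   x, class variable 0 as Y, and every other class variable as A. *)
Definition holds_xYA (M : V -> Prop) (p : form) (x : V) (Y A : V -> Prop)
  : Prop :=
  sat M p (fun _ => x) (scons Y (fun _ => A)).

Definition ETR (M X : V -> Prop) : Prop :=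
  forall (p : form) (A R : V), X A -> X R -> wf_relation M X R ->
    exists S, X S /\
      (forall q, M q -> q ∈ S ->
         exists r x, M r /\ M x /\ in_dom M R r /\ is_opair M q r x) /\
      (forall r, M r -> in_dom M R r ->
         forall x, M x ->
           (rel M S r x <->
            holds_xYA M p x (restrict_below M X S R r) (elements A))).

(** * Beta-models *)

Definition transitive_set (M : V) : Prop := forall x y, x ∈ y -> y ∈ M -> x ∈ M.

Definition everything : V -> Prop := fun _ => True.

(* R is truly well-founded when it is so in the full universe. *)
Definition beta_model (M X : V) : Prop :=
  transitive_set M /\
  (forall A, A ∈ X -> A ⊆ M) /\
  (forall R, R ∈ X -> wf_relation (elements M) (elements X) R ->
     wf_relation everything everything R).

Definition beta_model_GB_ETR (M X : V) : Prop :=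
  beta_model M X /\
  GB (elements M) (elements X) /\ ETR (elements M) (elements X).

(* Main.v *)
(** Let (N, Y) be a beta-model of GB + ETR of least height.  Enumerate sets along the ordinals
    by closing under finitely many Goedel-style operations, one of which takes a set relation to
    its well-founded part; the values with index in N form a copy K of the constructible sets of
    N, which depends only on the height of N.  Let Clo be the least family of subsets of K that
    is closed under elementary comprehension over K and under solutions of recursions along
    relations that are well-founded in truth.  Such solutions are unique, so Clo is contained in
    every beta-model having K among its classes.

    What remains is that (K, Clo) is a beta-model of GB + ETR, and for this it suffices that
    each A in Clo is amenable: A ∩ a ∈ K for a ∈ K.  If A is elementary, reflection gives a level
    u ∈ K of the enumeration with A ∩ u definable over u.  If A solves a recursion along T,
    reflection makes A ∩ u the solution of the recursion along T ∩ u, and K solves the latter by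
    gluing partial solutions.  If T is ill-founded, amenability makes T ∩ u ∈ K ill-founded for
    some level u, and the well-founded part operation supplies a witness in K.  The inverse of
    the enumeration is a class of (K, Clo), and yields Global Choice. *)

From Stdlib Require Import Classical ClassicalEpsilon FunctionalExtensionality.
From Stdlib Require Import PropExtensionality Arith Lia Wellfounded Relations.
Require Import Defs.

(** Two obstacles shape the proof. Well-foundedness in truth is not first-order, yet the enumeration
    must be a class of every beta-model. The beta property resolves this: over such a model a point
    of a set relation is accessible exactly when no set of the model containing it lacks a minimal
    element. Further, K cannot be studied inside (K, Clo) from the start, because nothing is known
    of that pair. The definability lemmas are therefore stated for a weak structure, comprehension
    plus separation, which K with its amenable classes satisfies before the full axioms are
    available.

    A greedy enumeration replaces the hierarchy of definable power sets. It needs a single recursive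
    clause along the ordinals and carries its own well-order. Whenever the values listed so far are
    closed under the operations, their set is listed next, so closed levels are themselves members
    of K. *)

(** * Sets up to bisimilarity, with Leibniz equality *)

Definition V0 : V := sup False (fun f => match f with end).
Definition canon (x : V) : V := epsilon (inhabits V0) (fun y => y ≡ x).

Lemma canon_eqV x : canon x ≡ x.
Proof. unfold canon. apply epsilon_spec. exists x. apply eqV_refl. Qed.

(** Bisimilar trees satisfy the same predicate [fun y => y ≡ x], so extensionality makes [epsilon]
    return the same tree. *)
Lemma canon_eq x y : x ≡ y -> canon x = canon y.
Proof.
  intros H. unfold canon. f_equal.
  apply functional_extensionality; intros z. apply propositional_extensionality.
  split; intros Hz; eapply eqV_trans; eauto using eqV_sym.
Qed.

(* Sets with Leibniz equality: a chosen representative of each bisimilarity class. *)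
Definition W : Type := {x : V | canon x = x}.
Definition val (w : W) : V := proj1_sig w.
Definition cls (x : V) : W :=
  exist _ (canon x) (canon_eq _ _ (canon_eqV x)).

Lemma val_inj a b : val a ≡ val b -> a = b.
Proof.
  destruct a as [a Ha], b as [b Hb]; simpl; intros H.
  assert (a = b) by (rewrite <- Ha, <- Hb; now apply canon_eq). subst b.
  f_equal. apply proof_irrelevance.
Qed.

Lemma val_cls x : val (cls x) ≡ x.
Proof. apply canon_eqV. Qed.

Lemma cls_val w : cls (val w) = w.
Proof. apply val_inj, val_cls. Qed.

Lemma cls_eq x y : cls x = cls y <-> x ≡ y.
Proof.
  split; intros H.
  - eapply eqV_trans; [apply eqV_sym, val_cls|]. rewrite H. apply val_cls.
  - apply val_inj. eapply eqV_trans; [apply val_cls|].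
    eapply eqV_trans; [apply H|]. apply eqV_sym, val_cls.
Qed.

Definition inW (x y : W) : Prop := val x ∈ val y.
Notation "x ∊ y" := (inW x y) (at level 70, no associativity).
Definition subW (x y : W) : Prop := forall z, z ∊ x -> z ∊ y.

Lemma inV_eqV_r x y y' : y ≡ y' -> x ∈ y -> x ∈ y'.
Proof. intros H Hx. exact (proj1 (proj1 (eqV_ext y y') H x) Hx). Qed.

Lemma inV_congr x x' y y' : x ≡ x' -> y ≡ y' -> x ∈ y -> x' ∈ y'.
Proof. intros Hx Hy H. eapply inV_eqV_r; eauto. eapply inV_eqV_l; eauto. Qed.

Lemma cls_in x y : cls x ∊ cls y <-> x ∈ y.
Proof.
  unfold inW; split; apply inV_congr; try apply val_cls; apply eqV_sym, val_cls.
Qed.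

Lemma val_in_cls w y : w ∊ cls y <-> val w ∈ y.
Proof. rewrite <- (cls_val w) at 1. apply cls_in. Qed.

Lemma ext x y : (forall z, z ∊ x <-> z ∊ y) -> x = y.
Proof.
  intros H. apply val_inj, eqV_ext. intros z.
  specialize (H (cls z)). unfold inW in H.
  split; intros Hz; eapply inV_eqV_l; try apply val_cls; apply H;
    (eapply inV_eqV_l; [apply eqV_sym, val_cls|exact Hz]).
Qed.

(** The induction must cover all y bisimilar to x, because a member of a tree is only bisimilar to
    one of its branches. *)
Lemma inV_Acc (x : V) : forall y, y ≡ x -> Acc inV y.
Proof.
  induction x as [A f IH]. intros y Hy. constructor. intros z Hz.
  apply (inV_eqV_r _ _ _ Hy) in Hz. destruct Hz as [a Ha]. eauto.
Qed.

Lemma in_wf : well_founded inW.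
Proof.
  intros x. apply (Acc_inverse_image _ _ inV val x).
  apply inV_Acc with (val x), eqV_refl.
Qed.

Lemma in_irrefl x : ~ x ∊ x.
Proof.
  induction x as [x IH] using (well_founded_induction in_wf). intros H. exact (IH x H H).
Qed.

Lemma in_minimal (P : W -> Prop) x : P x -> exists y, P y /\ forall z, z ∊ y -> ~ P z.
Proof.
  induction x as [x IH] using (well_founded_induction in_wf). intros Hx.
  destruct (classic (exists z, z ∊ x /\ P z)) as [[z [Hz Pz]]|H]; [eauto|].
  exists x; split; auto. intros z Hz Pz. apply H; eauto.
Qed.

(** * Set operations *)

(** The branches of the chosen tree index the elements of w, so separation, union, product and power
    set become families over a subtype, a sigma type, a product and a type of predicates. *)
Definition El (w : W) : Type := match val w with sup A _ => A end.
Definition el (w : W) : El w -> W :=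
  match val w as v return (match v with sup A _ => A end) -> W with
  | sup A f => fun a => cls (f a) end.
Lemma in_el w x : x ∊ w <-> exists i, x = el w i.
Proof.
  unfold inW, El, el. destruct (val w) as [A f]; simpl. split; intros [i Hi]; exists i.
  - rewrite <- (cls_val x). now apply cls_eq.
  - subst x. apply val_cls.
Qed.

Definition famW (A : Type) (f : A -> W) : W := cls (sup A (fun a => val (f a))).
Lemma in_famW A f x : x ∊ famW A f <-> exists a, x = f a.
Proof.
  unfold famW. rewrite val_in_cls. simpl. split; intros [a Ha]; exists a.
  - now apply val_inj.
  - subst; apply eqV_refl.
Qed.

Definition sep (a : W) (P : W -> Prop) : W :=
  famW {i : El a | P (el a i)} (fun i => el a (proj1_sig i)).
Lemma in_sep a P x : x ∊ sep a P <-> x ∊ a /\ P x.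
Proof.
  unfold sep. rewrite in_famW. split.
  - intros [[i Hi] ->]; simpl. split; auto. apply in_el; eauto.
  - intros [H HP]. apply in_el in H as [i ->]. now exists (exist _ i HP).
Qed.

Definition empty : W := famW False (fun f => match f with end).
Lemma in_empty x : ~ x ∊ empty.
Proof. unfold empty; rewrite in_famW. intros [[] _]. Qed.

Definition upair (a b : W) : W := famW bool (fun c => if c then a else b).
Lemma in_upair a b x : x ∊ upair a b <-> x = a \/ x = b.
Proof.
  unfold upair; rewrite in_famW. split.
  - intros [[] ->]; auto.
  - intros [->| ->]; [now exists true|now exists false].
Qed.

Definition bigU (a : W) : W :=
  famW {i : El a & El (el a i)} (fun p => el _ (projT2 p)).
Lemma in_bigU a x : x ∊ bigU a <-> exists y, x ∊ y /\ y ∊ a.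
Proof.
  unfold bigU; rewrite in_famW. split.
  - intros [[i j] ->]; simpl. exists (el a i). split; apply in_el; eauto.
  - intros [y [Hx Hy]]. apply in_el in Hy as [i ->]. apply in_el in Hx as [j ->].
    now exists (existT _ i j).
Qed.

Definition powW (a : W) : W := famW (El a -> Prop) (fun Q => famW {i | Q i} (fun i => el a (proj1_sig i))).
Lemma in_powW a x : x ∊ powW a <-> subW x a.
Proof.
  unfold powW; rewrite in_famW. split.
  - intros [Q ->] z. rewrite in_famW. intros [[i Hi] ->]. apply in_el. eauto.
  - intros H. exists (fun i => el a i ∊ x). apply ext; intros z. rewrite in_famW. split.
    + intros Hz. pose proof (H _ Hz) as Hi. apply in_el in Hi as [i ->].
      now exists (exist _ i Hz).
    + now intros [[i Hi] ->].
Qed.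

Definition image (f : W -> W) (a : W) : W := famW (El a) (fun i => f (el a i)).
Lemma in_image f a x : x ∊ image f a <-> exists y, y ∊ a /\ x = f y.
Proof.
  unfold image; rewrite in_famW. split.
  - intros [i ->]. exists (el a i). split; auto. apply in_el; eauto.
  - intros [y [Hy ->]]. apply in_el in Hy as [i ->]. now exists i.
Qed.

Definition opair (a b : W) : W := upair (upair a a) (upair a b).
Lemma upair_inj a b c d : upair a b = upair c d -> (a = c /\ b = d) \/ (a = d /\ b = c).
Proof.
  intros H.
  assert (Ha : a = c \/ a = d) by (apply in_upair; rewrite <- H; apply in_upair; auto).
  assert (Hb : b = c \/ b = d) by (apply in_upair; rewrite <- H; apply in_upair; auto).
  assert (Hc : c = a \/ c = b) by (apply in_upair; rewrite H; apply in_upair; auto).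
  assert (Hd : d = a \/ d = b) by (apply in_upair; rewrite H; apply in_upair; auto).
  intuition congruence.
Qed.

Lemma opair_inj a b c d : opair a b = opair c d -> a = c /\ b = d.
Proof.
  unfold opair; intros H. apply upair_inj in H.
  destruct H as [[H1 H2]|[H1 H2]]; apply upair_inj in H1; apply upair_inj in H2;
  intuition congruence.
Qed.

Definition prodW (a b : W) : W :=
  famW (El a * El b) (fun p => opair (el a (fst p)) (el b (snd p))).
Lemma in_prodW a b q : q ∊ prodW a b <-> exists x y, q = opair x y /\ x ∊ a /\ y ∊ b.
Proof.
  unfold prodW; rewrite in_famW. split.
  - intros [[i j] ->]; simpl. do 2 eexists; split; [reflexivity|]. split; apply in_el; eauto.
  - intros (x & y & -> & Hx & Hy). apply in_el in Hx as [i ->]. apply in_el in Hy as [j ->].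
    now exists (i, j).
Qed.

Definition cup (a b : W) : W := bigU (upair a b).
Lemma in_cup a b x : x ∊ cup a b <-> x ∊ a \/ x ∊ b.
Proof.
  unfold cup; rewrite in_bigU. split.
  - intros [y [Hx Hy]]. apply in_upair in Hy as [->| ->]; auto.
  - intros [H|H]; [exists a|exists b]; split; auto; apply in_upair; auto.
Qed.

Definition suc (x : W) : W := cup x (upair x x).
Lemma in_suc x z : z ∊ suc x <-> z ∊ x \/ z = x.
Proof. unfold suc; rewrite in_cup, in_upair. tauto. Qed.

(** * Ordinals *)
Definition ord (o : W) : Prop :=
  (forall x y, x ∊ y -> y ∊ o -> x ∊ o) /\
  (forall x y, x ∊ o -> y ∊ o -> x ∊ y \/ x = y \/ y ∊ x).

Lemma in_asym x y : x ∊ y -> ~ y ∊ x.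
Proof.
  revert y; induction x as [x IH] using (well_founded_induction in_wf).
  intros y H1 H2. exact (IH y H2 x H2 H1).
Qed.

Lemma in_3cycle x y z : x ∊ y -> y ∊ z -> ~ z ∊ x.
Proof.
  revert y z; induction x as [x IH] using (well_founded_induction in_wf).
  intros y z H1 H2 H3. exact (IH z H3 x y H3 H1 H2).
Qed.

Lemma ord_in o x : ord o -> x ∊ o -> ord x.
Proof.
  intros [H1 H2] Hx. split.
  - intros a b Hab Hb. assert (Hbo : b ∊ o) by eauto. assert (Hao : a ∊ o) by eauto.
    destruct (H2 a x) as [H|[H|H]]; auto.
    + subst. destruct (in_asym _ _ Hab Hb).
    + destruct (in_3cycle _ _ _ Hab Hb H).
  - intros a b Ha Hb. apply H2; eauto.
Qed.

(** Nested ∈-induction. An element of x outside y must equal or contain y, which places y in x;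
    symmetrically with x and y exchanged. If neither kind of element exists, x and y have the same
    elements. *)
Lemma ord_cmp x : forall y, ord x -> ord y -> x ∊ y \/ x = y \/ y ∊ x.
Proof.
  induction x as [x IHx] using (well_founded_induction in_wf).
  induction y as [y IHy] using (well_founded_induction in_wf). intros Ox Oy.
  destruct (classic (exists x', x' ∊ x /\ ~ x' ∊ y)) as [[x' [H1 H2]]|H].
  - destruct (IHx x' H1 y (ord_in _ _ Ox H1) Oy) as [H|[H|H]]; [tauto|subst; auto|].
    right; right. eapply (proj1 Ox); eauto.
  - destruct (classic (exists y', y' ∊ y /\ ~ y' ∊ x)) as [[y' [H1 H2]]|H'].
    + destruct (IHy y' H1 Ox (ord_in _ _ Oy H1)) as [H3|[H3|H3]]; [|subst; auto|tauto].
      left. eapply (proj1 Oy); eauto.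
    + right; left. apply ext; intros z; split; intros Hz; apply NNPP; intros Hn; eauto.
Qed.

Lemma ord_sub_le x y : ord x -> ord y -> subW x y -> x ∊ y \/ x = y.
Proof.
  intros Ox Oy H. destruct (ord_cmp x y Ox Oy) as [?|[?|h]]; auto.
  exfalso. exact (in_irrefl _ (H _ h)).
Qed.

Lemma ord_set a : (forall x y, x ∊ y -> y ∊ a -> x ∊ a) -> (forall x, x ∊ a -> ord x) -> ord a.
Proof. intros H1 H2; split; auto. intros; apply ord_cmp; auto. Qed.

Lemma ord_suc x : ord x -> ord (suc x).
Proof.
  intros O; apply ord_set.
  - intros a b Ha Hb. apply in_suc in Hb. apply in_suc; left.
    destruct Hb as [Hb| ->]; auto. eapply (proj1 O); eauto.
  - intros a Ha. apply in_suc in Ha as [Ha| ->]; auto. eapply ord_in; eauto.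
Qed.

Lemma ord_bigU a : (forall x, x ∊ a -> ord x) -> ord (bigU a).
Proof.
  intros H; apply ord_set.
  - intros x y Hx Hy. apply in_bigU in Hy as [z [Hy Hz]]. apply in_bigU. exists z; split; auto.
    eapply (proj1 (H z Hz)); eauto.
  - intros x Hx. apply in_bigU in Hx as [z [Hy Hz]]. eapply ord_in; eauto.
Qed.

Lemma ord_empty : ord empty.
Proof. split; intros x y; intros; exfalso; eapply in_empty; eauto. Qed.

Lemma ord_le_trans x y z : ord z -> x ∊ y \/ x = y -> y ∊ z -> x ∊ z.
Proof. intros O [H| ->] Hz; auto. eapply (proj1 O); eauto. Qed.

(** * First-order satisfaction *)

Fixpoint satW (M : W -> Prop) (p : form) (s : nat -> W) (C : nat -> W -> Prop) : Prop :=
  match p with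
  | fIn i j => s i ∊ s j
  | fEq i j => s i = s j
  | fCls i k => C k (s i)
  | fNot q => ~ satW M q s C
  | fAnd q r => satW M q s C /\ satW M r s C
  | fAll q => forall x, M x -> satW M q (scons x s) C
  end.

Lemma pred_ext (P Q : W -> Prop) : (forall x, P x <-> Q x) -> P = Q.
Proof.
  intros H. apply functional_extensionality; intros x. now apply propositional_extensionality.
Qed.

Fixpoint bnd (n : nat) (p : form) : Prop :=
  match p with
  | fIn i j | fEq i j => i < n /\ j < n
  | fCls i k => i < n
  | fNot q => bnd n q
  | fAnd q r => bnd n q /\ bnd n r
  | fAll q => bnd (S n) q
  end.
Fixpoint cbnd (n : nat) (p : form) : Prop :=
  match p with
  | fIn i j | fEq i j => True
  | fCls i k => k < n
  | fNot q | fAll q => cbnd n q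
  | fAnd q r => cbnd n q /\ cbnd n r
  end.
Lemma bnd_mono p : forall n m, n <= m -> bnd n p -> bnd m p.
Proof.
  induction p; simpl; intros n m Hl H; try lia; eauto.
  - destruct H; eauto.
  - apply (IHp (S n)); auto. lia.
Qed.

Lemma cbnd_mono p : forall n m, n <= m -> cbnd n p -> cbnd m p.
Proof.
  induction p; simpl; intros n m Hl H; try lia; eauto. destruct H; eauto.
Qed.

Lemma bnd_ex p : exists n, bnd n p.
Proof.
  induction p as [i j|i j|i k|q [n IH]|q [n IH] r [m IH']|q [n IH]]; simpl.
  - exists (S (i + j)); lia.
  - exists (S (i + j)); lia.
  - exists (S i); lia.
  - eauto.
  - exists (n + m); split; [apply (bnd_mono q n)|apply (bnd_mono r m)]; auto; lia.
  - exists n. apply (bnd_mono q n); auto.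
Qed.

Lemma cbnd_ex p : exists n, cbnd n p.
Proof.
  induction p as [i j|i j|i k|q [n IH]|q [n IH] r [m IH']|q [n IH]]; simpl; eauto.
  exists (n + m); split; [apply (cbnd_mono q n)|apply (cbnd_mono r m)]; auto; lia.
  Unshelve. all: exact 0.
Qed.

(** Class variables need to agree only at points that a variable can name. This is what lets
    [recPhi_ext] confine a recursion to a set u. *)
Lemma satW_ext p : forall n M s s' C C', bnd n p ->
  (forall i, i < n -> s i = s' i) ->
  (forall k x, uses_class k p -> (M x \/ exists i, i < n /\ x = s i) -> (C k x <-> C' k x)) ->
  (satW M p s C <-> satW M p s' C').
Proof.
  induction p; simpl; intros n M s s' C C' Hb Hs HC.
  - destruct Hb. rewrite !Hs by auto. tauto.
  - destruct Hb. rewrite !Hs by auto. tauto.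
  - rewrite <- Hs by auto. apply HC; eauto.
  - rewrite (IHp n M s s' C C'); auto. tauto.
  - rewrite (IHp1 n M s s' C C'), (IHp2 n M s s' C C'); try tauto; firstorder.
  - assert (H : forall x, M x -> (satW M p (scons x s) C <-> satW M p (scons x s') C')).
    { intros x Hx. apply (IHp (S n)); auto.
      - intros [|i] Hi; simpl; auto. apply Hs; lia.
      - intros k y Hk [Hy|[[|i] [Hi ->]]]; apply HC; simpl; auto.
        right; exists i; split; auto; lia. }
    firstorder.
Qed.

Lemma satW_ext_cls p M s C C' :
  (forall k x, uses_class k p -> (C k x <-> C' k x)) ->
  (satW M p s C <-> satW M p s C').
Proof.
  intros H. destruct (bnd_ex p) as [n Hn]. apply satW_ext with n; auto.
Qed.

Definition up (f : nat -> nat) (n : nat) : nat := match n with 0 => 0 | S m => S (f m) end.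
Fixpoint ren (f : nat -> nat) (p : form) : form :=
  match p with
  | fIn i j => fIn (f i) (f j)
  | fEq i j => fEq (f i) (f j)
  | fCls i k => fCls (f i) k
  | fNot q => fNot (ren f q)
  | fAnd q r => fAnd (ren f q) (ren f r)
  | fAll q => fAll (ren (up f) q)
  end.
Fixpoint cren (g : nat -> nat) (p : form) : form :=
  match p with
  | fCls i k => fCls i (g k)
  | fNot q => fNot (cren g q)
  | fAnd q r => fAnd (cren g q) (cren g r)
  | fAll q => fAll (cren g q)
  | _ => p
  end.
Lemma scons_up x (s : nat -> W) f :
  (fun i => scons x s (up f i)) = scons x (fun i => s (f i)).
Proof. apply functional_extensionality; intros [|i]; reflexivity. Qed.

Lemma satW_ren M p : forall f s C, satW M (ren f p) s C <-> satW M p (fun i => s (f i)) C.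
Proof.
  induction p; simpl; intros f s C; try tauto.
  - rewrite IHp; tauto.
  - rewrite IHp1, IHp2; tauto.
  - split; intros H x Hx; specialize (H x Hx); rewrite IHp, scons_up in *; exact H.
Qed.

Lemma satW_cren M p : forall g s C, satW M (cren g p) s C <-> satW M p s (fun k => C (g k)).
Proof.
  induction p; simpl; intros g s C; try tauto.
  - rewrite IHp; tauto.
  - rewrite IHp1, IHp2; tauto.
  - split; intros H x Hx; specialize (H x Hx); rewrite IHp in *; exact H.
Qed.

Lemma scons_eta {T} (s : nat -> T) : scons (s 0) (fun i => s (S i)) = s.
Proof. apply functional_extensionality; intros [|i]; reflexivity. Qed.

Lemma scons_all {T} (P : T -> Prop) x s : P x -> (forall i, P (s i)) -> forall i, P (scons x s i).
Proof. intros Hx Hs [|i]; simpl; auto. Qed.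

(** * Definability *)

(** The minimum for manipulating definitions. [Finh] fills the parameter slots that a formula leaves
    idle, since [udef] asks all of them to lie in Y. *)
Class Frame (N : W -> Prop) (Y : (W -> Prop) -> Prop) : Prop := {
  Ftr : forall x y, x ∊ y -> N y -> N x;
  Fpair : forall a b, N a -> N b -> N (upair a b);
  Finh : exists A, Y A }.

(* Class variable 0 stays free and is read as [Z]; the others denote parameters from [Y]. *)
Definition udef (N : W -> Prop) (Y : (W -> Prop) -> Prop)
    (P : (nat -> W) -> (W -> Prop) -> Prop) : Prop :=
  exists p C, (forall k, Y (C k)) /\
    forall s Z, (forall i, N (s i)) -> (satW N p s (scons Z C) <-> P s Z).

Section Definability.
Context {N : W -> Prop} {Y : (W -> Prop) -> Prop} {F : Frame N Y}.
Notation ud := (udef N Y).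
Implicit Types P Q : (nat -> W) -> (W -> Prop) -> Prop.

Lemma Fopair a b : N a -> N b -> N (opair a b).
Proof. intros; apply Fpair; apply Fpair; auto. Qed.

Lemma Fopair_l a b : N (opair a b) -> N a.
Proof.
  intros H. eapply Ftr; [|eapply Ftr; [|exact H]]; apply in_upair; left; reflexivity.
Qed.

Lemma Fopair_r a b : N (opair a b) -> N b.
Proof.
  intros H. eapply Ftr; [|eapply Ftr; [|exact H]]; apply in_upair; right; reflexivity.
Qed.

Lemma ud_ext P Q : (forall s Z, (forall i, N (s i)) -> (Q s Z <-> P s Z)) -> ud P -> ud Q.
Proof.
  intros H (p & C & HC & Hp). exists p, C; split; auto. intros s Z Hs.
  rewrite H by auto. auto.
Qed.

Lemma ud_ren P f : ud P -> ud (fun s Z => P (fun i => s (f i)) Z).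
Proof.
  intros (p & C & HC & Hp). exists (ren f p), C; split; auto. intros s Z Hs.
  rewrite satW_ren. apply Hp. auto.
Qed.

Lemma ud_plain p : ud (fun s Z => satW N p s (fun _ => Z)).
Proof.
  destruct (Finh (N:=N) (Y:=Y)) as [A HA]. exists (cren (fun _ => 0) p), (fun _ => A); split; auto.
  intros s Z _. rewrite satW_cren. tauto.
Qed.

Lemma ud_in i j : ud (fun s Z => s i ∊ s j).
Proof. exact (ud_plain (fIn i j)). Qed.

Lemma ud_eq i j : ud (fun s Z => s i = s j).
Proof. exact (ud_plain (fEq i j)). Qed.

Lemma ud_Z i : ud (fun s Z => Z (s i)).
Proof. exact (ud_plain (fCls i 0)). Qed.

Lemma ud_cls A i : Y A -> ud (fun s Z => A (s i)).
Proof. intros HA. exists (fCls i 1), (fun _ => A); split; auto. simpl; tauto. Qed.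

Lemma ud_not P : ud P -> ud (fun s Z => ~ P s Z).
Proof.
  intros (p & C & HC & Hp). exists (fNot p), C; split; auto. intros s Z Hs; simpl.
  rewrite Hp by auto. tauto.
Qed.

(** For merging the parameters of two formulas: slot 0, which stands for Z, stays shared, and the
    other slots go to the even and odd positions of a common list. *)
Definition evenc (k : nat) : nat := match k with 0 => 0 | S k => S (2 * k) end.
Definition oddc (k : nat) : nat := match k with 0 => 0 | S k => S (S (2 * k)) end.
Lemma ud_and P Q : ud P -> ud Q -> ud (fun s Z => P s Z /\ Q s Z).
Proof.
  intros (p & C & HC & Hp) (q & D & HD & Hq).
  exists (fAnd (cren evenc p) (cren oddc q)),
    (fun k => if Nat.even k then C (Nat.div2 k) else D (Nat.div2 k)).
  split. { intros k; destruct (Nat.even k); auto. }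
  intros s Z Hs; simpl. rewrite !satW_cren, <- Hp, <- Hq by auto.
  rewrite (satW_ext_cls p N s (fun k => _) (scons Z C)).
  rewrite (satW_ext_cls q N s (fun k => _) (scons Z D)). tauto.
  - intros [|k] x _; [tauto|]. unfold oddc, scons.
    rewrite Nat.even_succ, <- Nat.negb_even, Nat.even_even, Nat.div2_succ_double. tauto.
  - intros [|k] x _; [tauto|]. unfold evenc, scons.
    rewrite Nat.even_even, Nat.div2_double. tauto.
Qed.

Lemma ud_all (P : W -> (nat -> W) -> (W -> Prop) -> Prop) :
  ud (fun s Z => P (s 0) (fun i => s (S i)) Z) -> ud (fun s Z => forall x, N x -> P x s Z).
Proof.
  intros (p & C & HC & Hp). exists (fAll p), C; split; auto. intros s Z Hs; simpl.
  split; intros H x Hx; specialize (H x Hx).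
  - exact (proj1 (Hp _ Z (scons_all N x s Hx Hs)) H).
  - exact (proj2 (Hp _ Z (scons_all N x s Hx Hs)) H).
Qed.

Lemma ud_or P Q : ud P -> ud Q -> ud (fun s Z => P s Z \/ Q s Z).
Proof.
  intros HP HQ. apply ud_ext with (fun s Z => ~ (~ P s Z /\ ~ Q s Z)).
  - intros; tauto.
  - now apply ud_not, ud_and; apply ud_not.
Qed.

Lemma ud_imp P Q : ud P -> ud Q -> ud (fun s Z => P s Z -> Q s Z).
Proof.
  intros HP HQ. apply ud_ext with (fun s Z => ~ P s Z \/ Q s Z).
  - intros; tauto.
  - apply ud_or; auto; now apply ud_not.
Qed.

Lemma ud_iff P Q : ud P -> ud Q -> ud (fun s Z => P s Z <-> Q s Z).
Proof. intros HP HQ. apply ud_and; now apply ud_imp. Qed.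

Lemma ud_ex (P : W -> (nat -> W) -> (W -> Prop) -> Prop) :
  ud (fun s Z => P (s 0) (fun i => s (S i)) Z) -> ud (fun s Z => exists x, N x /\ P x s Z).
Proof.
  intros H. apply ud_ext with (fun s Z => ~ forall x, N x -> ~ P x s Z).
  - intros s Z Hs; split.
    + intros [x [Hx HP]] HN. exact (HN x Hx HP).
    + intros HN. apply not_all_ex_not in HN as [x HN]. exists x. tauto.
  - apply ud_not, (ud_all (fun x s Z => ~ P x s Z)), ud_not, H.
Qed.

Lemma ud_const (P : Prop) : ud (fun s Z => P).
Proof.
  destruct (classic P) as [H|H].
  - apply ud_ext with (fun s Z => s 0 = s 0); [tauto|apply ud_eq].
  - apply ud_ext with (fun s Z => s 0 <> s 0); [tauto|apply ud_not, ud_eq].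
Qed.

Lemma ud_ball (P : W -> (nat -> W) -> (W -> Prop) -> Prop) i :
  ud (fun s Z => P (s 0) (fun i => s (S i)) Z) -> ud (fun s Z => forall x, x ∊ s i -> P x s Z).
Proof.
  intros H. apply ud_ext with (fun s Z => forall x, N x -> x ∊ s i -> P x s Z).
  - intros s Z Hs; split; intros HH x Hx; [auto|]. apply HH; auto. eapply Ftr; eauto.
  - apply (ud_all (fun x s Z => x ∊ s i -> P x s Z)). apply ud_imp; auto. apply (ud_in 0 (S i)).
Qed.

Lemma ud_bex (P : W -> (nat -> W) -> (W -> Prop) -> Prop) i :
  ud (fun s Z => P (s 0) (fun i => s (S i)) Z) -> ud (fun s Z => exists x, x ∊ s i /\ P x s Z).
Proof.
  intros H. apply ud_ext with (fun s Z => exists x, N x /\ x ∊ s i /\ P x s Z).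
  - intros s Z Hs; split; intros [x [Hx HH]]; [|exists x; tauto].
    exists x; split; auto. eapply Ftr; eauto.
  - apply (ud_ex (fun x s Z => x ∊ s i /\ P x s Z)). apply ud_and; auto. apply (ud_in 0 (S i)).
Qed.

(** [udef] has no set parameters, so c enters as the class {c} and is recovered by a quantifier. *)
Lemma ud_param c (P : W -> (nat -> W) -> (W -> Prop) -> Prop) :
  N c -> Y (fun x => x = c) ->
  ud (fun s Z => P (s 0) (fun i => s (S i)) Z) -> ud (P c).
Proof.
  intros Hc HY H. apply ud_ext with (fun s Z => exists x, N x /\ x = c /\ P x s Z).
  - intros s Z _; split; [intros HP; exists c; auto|]. intros (x & _ & -> & HP); auto.
  - apply (ud_ex (fun x s Z => x = c /\ P x s Z)), ud_and; auto. now apply (ud_cls (fun x => x = c) 0).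
Qed.

(** The index is a number of the metatheory, so the existential is a finite disjunction. It serves
    for quantifying over the operations. *)
Lemma ud_finex (m : nat) (P : nat -> (nat -> W) -> (W -> Prop) -> Prop) :
  (forall i, i < m -> ud (P i)) -> ud (fun s Z => exists i, i < m /\ P i s Z).
Proof.
  induction m as [|m IH]; intros H.
  - apply ud_ext with (fun s Z => False); [|apply ud_const].
    intros; split; [intros [i [Hi _]]; lia|tauto].
  - apply ud_ext with (fun s Z => P m s Z \/ exists i, i < m /\ P i s Z).
    + intros; split.
      * intros [i [Hi HP]]. assert (i = m \/ i < m) as [->|?] by lia; eauto.
      * intros [HP|[i [Hi HP]]]; [exists m|exists i]; split; auto.
    + apply ud_or; auto.
Qed.

Lemma ud_upair i j k : ud (fun s Z => s i = upair (s j) (s k)).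
Proof.
  apply ud_ext with (fun s Z => forall z, N z -> (z ∊ s i <-> z = s j \/ z = s k)).
  - intros s Z Hs; split.
    + intros -> z _. apply in_upair.
    + intros H. apply ext; intros z. rewrite in_upair. split; intros Hz.
      * apply H; auto. eapply Ftr; eauto.
      * apply H; auto. destruct Hz; subst; auto.
  - apply ud_all, ud_iff; [apply ud_in|apply ud_or; [apply ud_eq|apply ud_eq]].
Qed.

Lemma ud_opair i j k : ud (fun s Z => s i = opair (s j) (s k)).
Proof.
  apply ud_ext with (fun s Z => exists a, N a /\ exists b, N b /\ a = upair (s j) (s j) /\
     b = upair (s j) (s k) /\ s i = upair a b).
  - intros s Z Hs; split.
    + intros H. exists (upair (s j) (s j)); split; [now apply Fpair|].
      exists (upair (s j) (s k)); split; [now apply Fpair|auto].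
    + intros (a & _ & b & _ & -> & -> & ->); reflexivity.
  - apply ud_ex, ud_ex, ud_and; [apply ud_upair|apply ud_and; apply ud_upair].
Qed.

Lemma ud_pairarg (P : W -> (nat -> W) -> (W -> Prop) -> Prop) i j :
  ud (fun s Z => P (s 0) (fun i => s (S i)) Z) -> ud (fun s Z => P (opair (s i) (s j)) s Z).
Proof.
  intros H. apply ud_ext with (fun s Z => exists q, N q /\ q = opair (s i) (s j) /\ P q s Z).
  - intros s Z Hs; split.
    + intros HP; eexists; split; [now apply (Fopair (s i) (s j))|auto].
    + intros (q & _ & -> & HP); auto.
  - apply (ud_ex (fun q s Z => q = opair (s i) (s j) /\ P q s Z)), ud_and; auto.
    apply (ud_opair 0 (S i) (S j)).
Qed.

Lemma ud_clsp A i j : Y A -> ud (fun s Z => A (opair (s i) (s j))).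
Proof. intros HA. now apply (ud_pairarg (fun q s Z => A q)), ud_cls. Qed.

Lemma ud_Zp i j : ud (fun s Z => Z (opair (s i) (s j))).
Proof. apply (ud_pairarg (fun q s Z => Z q)), ud_Z. Qed.

Lemma ud_inp i j k : ud (fun s Z => opair (s i) (s j) ∊ s k).
Proof. apply (ud_pairarg (fun q s Z => q ∊ s k)), (ud_in 0 (S k)). Qed.

Lemma ud_expair (P : W -> W -> (nat -> W) -> (W -> Prop) -> Prop) i :
  ud (fun s Z => P (s 1) (s 0) (fun i => s (S (S i))) Z) ->
  ud (fun s Z => exists x y, s i = opair x y /\ P x y s Z).
Proof.
  intros H. apply ud_ext with
    (fun s Z => exists x, N x /\ exists y, N y /\ s i = opair x y /\ P x y s Z).
  - intros s Z Hs; split.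
    + intros (x & y & E & HP). specialize (Hs i). rewrite E in Hs.
      exists x; split; [eapply Fopair_l; eauto|]. exists y; split; [eapply Fopair_r; eauto|auto].
    + intros (x & _ & y & _ & HP); eauto.
  - apply (ud_ex (fun x s Z => exists y, N y /\ s i = opair x y /\ P x y s Z)).
    apply (ud_ex (fun y s Z => s (S i) = opair (s 0) y /\ P (s 0) y (fun i => s (S i)) Z)).
    apply ud_and; auto. apply (ud_opair (S (S i)) 1 0).
Qed.

Lemma ud_sub i j : ud (fun s Z => subW (s i) (s j)).
Proof. apply (ud_ball (fun z s Z => z ∊ s j)), (ud_in 0 (S j)). Qed.

Lemma ud_ord i : ud (fun s Z => ord (s i)).
Proof.
  apply ud_ext with (fun s Z => (forall y, y ∊ s i -> subW y (s i)) /\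
    (forall x, x ∊ s i -> forall y, y ∊ s i -> x ∊ y \/ x = y \/ y ∊ x)).
  - intros s Z _. unfold ord, subW. split; intros [H1 H2]; split; eauto.
  - apply ud_and.
    + apply ud_ball, ud_sub.
    + apply ud_ball, (ud_ball _ (S i)), ud_or; [apply ud_in|apply ud_or; [apply ud_eq|apply ud_in]].
Qed.

(** Relativization to a definable domain. [D] and [C] may depend on the environment, because a
    quantifier shifts it and the induction hypothesis is then needed for the shifted versions; [f]
    records where the variables of p have moved. *)
Lemma ud_sat p : forall (D : (nat -> W) -> W -> Prop)
    (C : (nat -> W) -> (W -> Prop) -> nat -> W -> Prop) (f : nat -> nat),
  (forall s x, (forall i, N (s i)) -> D s x -> N x) ->
  ud (fun s Z => D (fun i => s (S i)) (s 0)) ->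
  (forall k, uses_class k p -> ud (fun s Z => C (fun i => s (S i)) Z k (s 0))) ->
  ud (fun s Z => satW (D s) p (fun i => s (f i)) (C s Z)).
Proof.
  induction p; simpl; intros D C f HDN HD HC.
  - apply ud_in.
  - apply ud_eq.
  - specialize (HC k eq_refl).
    exact (ud_ren _ (fun n => match n with 0 => f i | S m => m end) HC).
  - apply ud_not, IHp; auto.
  - apply ud_and; [apply IHp1|apply IHp2]; auto.
  - apply ud_ext with (fun s Z => forall x, N x -> D s x ->
      satW (D s) p (scons x (fun i => s (f i))) (C s Z)).
    + intros s Z Hs; split; intros H x Hx; eauto.
    + apply (ud_all (fun x s Z => D s x -> satW (D s) p (scons x (fun i => s (f i))) (C s Z))).
      apply ud_imp; auto.
      pose (f' := fun n => match n with 0 => 0 | S m => S (f m) end).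
      apply ud_ext with (fun s Z => satW (D (fun i => s (S i))) p (fun i => s (f' i))
        (C (fun i => s (S i)) Z)).
      * intros s Z Hs.
        replace (scons (s 0) (fun i => s (S (f i)))) with (fun i => s (f' i)); [tauto|].
        apply functional_extensionality; intros [|i]; reflexivity.
      * apply (IHp (fun s => D (fun i => s (S i))) (fun s Z => C (fun i => s (S i)) Z) f').
        -- intros s x Hs. apply HDN. auto.
        -- exact (ud_ren _ (fun n => match n with 0 => 0 | S m => S (S m) end) HD).
        -- intros k Hk. exact (ud_ren _ (fun n => match n with 0 => 0 | S m => S (S m) end) (HC k Hk)).
Qed.
End Definability.

Ltac ud_step :=
  first
  [ apply ud_in | apply ud_eq | apply ud_Z | apply ud_opair | apply ud_upair | apply ud_inp | apply ud_Zp
  | apply ud_sub | apply ud_ord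
  | (apply ud_cls; solve [auto]) | (apply ud_clsp; solve [auto])
  | apply ud_const
  | apply ud_and | apply ud_or | apply ud_not | apply ud_iff
  | apply ud_expair | apply ud_ex | apply ud_bex | apply ud_all | apply ud_ball | apply ud_imp ].
Ltac ud_auto := repeat (cbv beta; ud_step); cbv beta.

(** * Recursion and semantic models *)

Definition below (S T : W -> Prop) (r : W) : W -> Prop :=
  fun q => S q /\ exists r' x, q = opair r' x /\ T (opair r' r).
Definition fld (T : W -> Prop) (r : W) : Prop :=
  exists y, T (opair r y) \/ T (opair y r).
Definition solves (N : W -> Prop) (Phi : W -> (W -> Prop) -> Prop) (T S : W -> Prop) : Prop :=
  (forall q, S q -> exists r x, q = opair r x /\ fld T r /\ N x) /\
  (forall r x, fld T r -> N x -> (S (opair r x) <-> Phi x (below S T r))).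
Definition relcls (T : W -> Prop) : Prop := forall q, T q -> exists x y, q = opair x y.
Definition wfcls (T : W -> Prop) : Prop := well_founded (fun x y => T (opair x y)).
Definition trcls (T : W -> Prop) : Prop :=
  forall x y z, T (opair x y) -> T (opair y z) -> T (opair x z).

Lemma below_pair S T r r' x : below S T r (opair r' x) <-> S (opair r' x) /\ T (opair r' r).
Proof.
  unfold below; split.
  - intros [H (r'' & x' & E & HT)]. apply opair_inj in E as [-> ->]. auto.
  - intros [H HT]; split; eauto.
Qed.

(** Induction along T: if two solutions agree below r, the same instance of Phi decides both
    sections at r. *)
Lemma solves_unique N Phi T S S' : wfcls T ->
  solves N Phi T S -> solves N Phi T S' -> S = S'.
Proof.
  intros HT [H1 H2] [H1' H2'].
  assert (H : forall r x, S (opair r x) <-> S' (opair r x)).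
  { intros r; induction r as [r IH] using (well_founded_induction HT); intros x.
    assert (E : below S T r = below S' T r).
    { apply pred_ext; intros q. unfold below.
      split; (intros [Hq (r' & x' & -> & HT')]; split; [apply (IH r' HT'); auto|eauto]). }
    split; intros Hx.
    - destruct (H1 _ Hx) as (r0 & x0 & E0 & Hf & HN). apply opair_inj in E0 as [<- <-].
      rewrite H2' by auto. rewrite <- E. now apply H2.
    - destruct (H1' _ Hx) as (r0 & x0 & E0 & Hf & HN). apply opair_inj in E0 as [<- <-].
      rewrite H2 by auto. rewrite E. now apply H2'. }
  apply pred_ext; intros q; split; intros Hq.
  - destruct (H1 _ Hq) as (r & x & -> & _). now apply H.
  - destruct (H1' _ Hq) as (r & x & -> & _). now apply H.
Qed.

(** What a model has in common with K and its amenable classes. Neither Replacement nor recursion is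
    included, so it can be applied to K before either is known there. *)
Class Univ (N : W -> Prop) (Y : (W -> Prop) -> Prop) : Prop := {
  Utr : forall x y, x ∊ y -> N y -> N x;
  Upair : forall a b, N a -> N b -> N (upair a b);
  Uempty : N empty;
  Usub : forall A x, Y A -> A x -> N x;
  Ucomp : forall p s C, (forall i, N (s i)) -> (forall k, Y (C k)) ->
    Y (fun x => N x /\ satW N p (scons x s) C);
  Uinh : exists A, Y A;
  Usep : forall A a, Y A -> N a -> N (sep a A) }.

#[global] Instance Univ_Frame N Y {U : Univ N Y} : Frame N Y.
Proof. constructor; [exact Utr|exact Upair|exact Uinh]. Qed.

Section Universe.
Context {N : W -> Prop} {Y : (W -> Prop) -> Prop} {U : Univ N Y}.
Notation ud := (udef N Y).

Lemma ucomp P s Z : ud P -> (forall i, N (s i)) -> Y Z -> Y (fun x => N x /\ P (scons x s) Z).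
Proof.
  intros (p & C & HC & Hp) Hs HZ.
  replace (fun x => N x /\ P (scons x s) Z) with (fun x => N x /\ satW N p (scons x s) (scons Z C)).
  - apply Ucomp; auto. intros [|k]; simpl; auto.
  - apply pred_ext; intros x. split; intros [Hx H]; split; auto; apply Hp; auto; intros [|i]; simpl; auto.
Qed.

Lemma ucomp1 (P : W -> Prop) : ud (fun s Z => P (s 0)) -> Y (fun x => N x /\ P x).
Proof.
  intros H. destruct Uinh as [A HA].
  apply (ucomp _ (fun _ => empty) A H); auto. intros _; apply Uempty.
Qed.

Lemma ucompN (P : W -> Prop) : (forall x, P x -> N x) -> ud (fun s Z => P (s 0)) -> Y P.
Proof.
  intros H1 H2. replace P with (fun x => N x /\ P x); [now apply ucomp1|].
  apply pred_ext; split; [tauto|auto].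
Qed.

Lemma Ysing c : N c -> Y (fun x => x = c).
Proof.
  intros Hc. destruct Uinh as [A HA].
  replace (fun x => x = c) with (fun x => N x /\ (fun s (Z : W -> Prop) => s 0 = s 1) (scons x (fun _ => c)) A).
  - apply (ucomp (fun s Z => s 0 = s 1) (fun _ => c) A); auto. apply ud_eq.
  - apply pred_ext; intros x; simpl; split; [tauto|intros ->; auto].
Qed.

Lemma ud_const_param c (P : W -> (nat -> W) -> (W -> Prop) -> Prop) :
  N c -> ud (fun s Z => P (s 0) (fun i => s (S i)) Z) -> ud (P c).
Proof. intros Hc; apply ud_param; auto. now apply Ysing. Qed.

Lemma Yset a : N a -> Y (fun x => x ∊ a).
Proof.
  intros Ha. apply ucompN.
  - intros x Hx; eapply Utr; eauto.
  - apply (ud_const_param a (fun a s Z => s 0 ∊ a)); auto. apply ud_in.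
Qed.

Lemma usep a P : N a -> ud (fun s Z => P (s 0)) -> N (sep a P).
Proof.
  intros Ha H. replace (sep a P) with (sep a (fun x => N x /\ P x)).
  - apply Usep; auto. now apply ucomp1.
  - apply ext; intros x. rewrite !in_sep. split; [tauto|intros [? ?]; split; auto].
    split; auto. eapply Utr; eauto.
Qed.

Lemma Ysep A (P : W -> Prop) : Y A -> ud (fun s Z => P (s 0)) -> Y (fun x => A x /\ P x).
Proof.
  intros HA HP. apply ucompN.
  - intros x [Hx _]; eapply Usub; eauto.
  - apply ud_and; auto. now apply ud_cls.
Qed.
End Universe.
Ltac ud_par c :=
  lazymatch goal with |- udef ?N ?Y ?P =>
    let P' := eval pattern c in P in
    lazymatch P' with ?F _ => apply (ud_const_param c F) end end; cbv beta.

(** Extensionality and Foundation come with transitivity of N. [Metr] is confined to transitive T,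
    where T is its own transitive closure; other relations are reduced to this case by passing to
    the closure. *)
Record Model (N : W -> Prop) (Y : (W -> Prop) -> Prop) : Prop := {
  Mtr : forall x y, x ∊ y -> N y -> N x;
  Mpair : forall a b, N a -> N b -> N (upair a b);
  Mun : forall a, N a -> N (bigU a);
  Mpow : forall a, N a -> exists p, N p /\ forall z, N z -> (z ∊ p <-> subW z a);
  Minf : exists w, N w /\ empty ∊ w /\ forall x, x ∊ w -> suc x ∊ w;
  Msub : forall A x, Y A -> A x -> N x;
  Mcomp : forall p s C, (forall i, N (s i)) -> (forall k, Y (C k)) ->
    Y (fun x => N x /\ satW N p (scons x s) C);
  Minh : exists A, Y A;
  Mrep : forall F, Y F -> relcls F -> (forall x y y', F (opair x y) -> F (opair x y') -> y = y') ->
    forall a, N a -> exists b, N b /\ forall y, y ∊ b <-> exists x, x ∊ a /\ F (opair x y);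
  Mbeta : forall R, Y R -> relcls R ->
    (forall A, Y A -> (exists x, A x) -> exists m, A m /\ forall y, A y -> ~ R (opair y m)) ->
    wfcls R;
  Metr : forall p A T, Y A -> Y T -> relcls T -> trcls T -> wfcls T ->
    exists S, Y S /\
      solves N (fun x Z => satW N p (fun _ => x) (scons Z (fun _ => A))) T S }.
Existing Class Model.

#[global] Instance Model_Univ N Y {M : Model N Y} : Univ N Y.
Proof.
  assert (He : N empty).
  { destruct (Minf N Y M) as (w & Hw & He & _). eapply Mtr; eauto. }
  assert (HF : Frame N Y) by (constructor; [apply (Mtr _ _ M)|apply (Mpair _ _ M)|apply (Minh _ _ M)]).
  constructor; try apply M; auto.
  intros A a HA Ha.
  (* Separation is Replacement along the identity function of A. [ucomp] needs the instance under
     construction, so this class is built from [Mcomp] directly. *)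
  assert (HD : Y (fun q => N q /\ exists x y, q = opair x y /\ A x /\ x = y)).
  { assert (H : udef N Y (fun s Z => exists x y, s 0 = opair x y /\ A x /\ x = y)) by ud_auto.
    destruct H as (p & C & HC & Hp).
    replace (fun q => N q /\ exists x y, q = opair x y /\ A x /\ x = y)
      with (fun q => N q /\ satW N p (scons q (fun _ => empty)) (scons A C)).
    - apply (Mcomp _ _ M); auto. intros [|k]; simpl; auto.
    - apply pred_ext; intros q. assert (Hs : N q -> forall i, N (scons q (fun _ => empty) i)) by (intros ? [|i]; simpl; auto).
      split; intros [Hq H]; (split; [assumption|]).
      + exact (proj1 (Hp _ A (Hs Hq)) H).
      + exact (proj2 (Hp _ A (Hs Hq)) H). }
  destruct (Mrep _ _ M _ HD) with a as (b & Hb & H); auto.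
  - intros q (_ & x & y & -> & _); eauto.
  - intros x y y' (_ & x1 & y1 & E & _ & E1) (_ & x2 & y2 & E' & _ & E2).
    apply opair_inj in E as [? ?], E' as [? ?]. congruence.
  - replace (sep a A) with b; auto. apply ext; intros z. rewrite H, in_sep. split.
    + intros (x & Hx & _ & x1 & y1 & E & HA1 & E1). apply opair_inj in E as [? ?]; subst; auto.
    + intros [Hz HAz]. exists z; split; auto. assert (N z) by (eapply Mtr; eauto).
      split; [apply (Fopair (Y:=Y)); auto|eauto].
Qed.

(** Zermelo numerals, used as tags for packing several class parameters into one. *)
Fixpoint num (k : nat) : W := match k with 0 => empty | S k => upair (num k) (num k) end.
Lemma num_inj k : forall l, num k = num l -> k = l.
Proof.
  induction k as [|k IH]; intros [|l] H; simpl in *; auto.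
  - exfalso. apply (in_empty (num l)). rewrite H. apply in_upair; auto.
  - exfalso. apply (in_empty (num k)). rewrite <- H. apply in_upair; auto.
  - f_equal. apply IH. apply upair_inj in H. tauto.
Qed.

Lemma ud_num {N Y} {F : Frame N Y} k : forall i, udef N Y (fun s Z => s i = num k).
Proof.
  induction k as [|k IH]; intros i.
  - apply ud_ext with (fun s Z => forall z, z ∊ s i -> False); [|ud_auto].
    intros s Z Hs; split.
    + intros -> z; apply in_empty.
    + intros H; apply ext; intros z; split; intros Hz; exfalso; [eauto|eapply in_empty; eauto].
  - apply ud_ext with (fun s Z => exists c, c ∊ s i /\ c = num k /\ s i = upair c c).
    + intros s Z Hs; simpl; split.
      * intros E. exists (num k); split; auto. rewrite E; apply in_upair; auto.
      * intros (c & _ & -> & E); auto.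
    + apply ud_bex, ud_and; [apply IH|apply ud_upair].
Qed.

Section ModelTheory.
Context {N : W -> Prop} {Y : (W -> Prop) -> Prop} {M : Model N Y}.
Notation ud := (udef N Y).

Lemma Nnum k : N (num k).
Proof. induction k; simpl; [apply Uempty|now apply Upair]. Qed.

(* The single class parameter allowed in the recursion scheme codes finitely many. *)
Lemma etr_udef (Phi : W -> (W -> Prop) -> Prop) T :
  ud (fun s Z => Phi (s 0) Z) -> Y T -> relcls T -> trcls T -> wfcls T ->
  exists S, Y S /\ solves N Phi T S.
Proof.
  intros (p & C & HC & Hp) HT H1 H2 H3.
  destruct (cbnd_ex p) as [n Hn].
  (* The disjoint union of the first n parameters, the k-th one tagged by [num k]. *)
  set (A := fun x => N x /\ exists k, k < n /\ exists a b, x = opair a b /\ a = num k /\ C k b).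
  assert (HA : Y A).
  { apply ucomp1. apply ud_finex. intros k Hk. apply ud_expair. apply ud_and; [apply ud_num|now apply ud_cls]. }
  (* Over the family [eq A], definability means that A is the only class parameter, which is the
     form [Metr] accepts. *)
  assert (Hq : udef N (eq A) (fun s Z => satW N p s (scons Z C))).
  { assert (HFr : Frame N (eq A)).
    { constructor; [exact Utr|exact Upair|exists A; auto]. }
    clear Hp. induction p; simpl in *.
    - ud_auto.
    - ud_auto.
    - destruct k as [|k]; simpl; [apply ud_Z|].
      apply ud_ext with (fun s Z => exists c, N c /\ c = num k /\ A (opair c (s i))).
      + intros s Z Hs. split.
        * intros HCk. exists (num k); split; [apply Nnum|split; auto]. split.
          -- apply (Fopair (Y:=Y)); auto. apply Nnum.
          -- exists k; split; [lia|eauto].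
        * intros (c & _ & -> & _ & k' & _ & a & b & E & E1 & HC').
          apply opair_inj in E as [<- <-]. apply num_inj in E1 as ->. auto.
      + apply ud_ex; apply ud_and; [apply ud_num|]. now apply ud_clsp.
    - apply ud_not; auto.
    - apply ud_and; tauto.
    - apply ud_all. eapply ud_ext; [|exact (IHp Hn)].
      intros s Z Hs; cbv beta. now rewrite scons_eta. }
  destruct Hq as (p' & C' & HC' & Hp').
  destruct (Metr _ _ M p' A T) as (S & HS & Hs1 & Hs2); auto.
  exists S; split; auto. split; auto. intros r x Hr Hx. rewrite Hs2 by auto.
  replace (fun _ : nat => A) with C' by (apply functional_extensionality; intros k; symmetry; apply HC').
  rewrite Hp', Hp by auto. tauto.
Qed.

Lemma rep_udef (F : W -> W -> Prop) a :
  N a -> (forall x y, x ∊ a -> F x y -> N y) ->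
  (forall x y y', x ∊ a -> F x y -> F x y' -> y = y') ->
  ud (fun s Z => F (s 0) (s 1)) ->
  exists b, N b /\ forall y, y ∊ b <-> exists x, x ∊ a /\ F x y.
Proof.
  intros Ha HN HF HD.
  assert (HG : Y (fun q => N q /\ exists x y, q = opair x y /\ x ∊ a /\ F x y)).
  { apply ucomp1. ud_par a; auto. apply ud_expair; apply ud_and; [ud_auto|].
    exact (ud_ren _ (fun n => match n with 0 => 1 | _ => 0 end) HD). }
  destruct (Mrep _ _ M _ HG) with a as (b & Hb & H); auto.
  - intros q (_ & x & y & -> & _); eauto.
  - intros x y y' (_ & x1 & y1 & E & Hx & E1) (_ & x2 & y2 & E' & Hx' & E2).
    apply opair_inj in E as [? ?], E' as [? ?]. subst. eauto.
  - exists b; split; auto. intros y. rewrite H. split.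
    + intros (x & Hx & _ & x1 & y1 & E & _ & E1). apply opair_inj in E as [? ?]; subst. eauto.
    + intros (x & Hx & HFx). exists x; split; auto. split; [|eauto 6].
      apply (Fopair (Y:=Y)); eauto. eapply Utr; eauto.
Qed.

Lemma Ncup a b : N a -> N b -> N (cup a b).
Proof. intros; apply (Mun _ _ M), Upair; auto. Qed.

Lemma Nsuc a : N a -> N (suc a).
Proof. intros; apply Ncup; auto. now apply Upair. Qed.

Lemma Nprod a b : N a -> N b -> N (prodW a b).
Proof.
  intros Ha Hb. destruct (Mpow _ _ M (cup a b)) as (p & Hp & HP); [now apply Ncup|].
  destruct (Mpow _ _ M p) as (p2 & Hp2 & HP2); auto.
  replace (prodW a b) with (sep p2 (fun q => exists x y, q = opair x y /\ x ∊ a /\ y ∊ b)).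
  - apply usep; auto. ud_par a; auto. ud_par b; auto. ud_auto.
  - apply ext; intros q. rewrite in_sep, in_prodW. split; [tauto|].
    intros (x & y & -> & Hx & Hy). split; [|eauto].
    assert (N x) by (eapply Utr; eauto). assert (N y) by (eapply Utr; eauto).
    apply HP2; [now apply (Fopair (Y:=Y))|].
    intros z Hz. apply HP.
    + apply in_upair in Hz as [->| ->]; now apply Upair.
    + intros w Hw. apply in_cup.
      apply in_upair in Hz as [->| ->]; apply in_upair in Hw as [->| ->]; auto.
Qed.
End ModelTheory.

(** * The operations *)

(** Tuples will be coded as right-nested pairs, so this filters tuples by a relation between their
    first two entries. *)
Definition selW (rho : W -> W -> Prop) (a : W) : W :=
  sep a (fun q => exists x t, q = opair x t /\ exists y e, t = opair y e /\ rho x y).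
Definition setrel (a : W) : W -> W -> Prop := fun x y => opair x y ∊ a.
Definition UU (a : W) : W := bigU (bigU a).

(** On sets of coded tuples, [ranW] drops the first entry and so acts as an existential quantifier,
    [insW] admits an arbitrary second entry into the tuples of b, and [secW] fixes all entries after
    the first. *)
Definition ranW (a : W) : W := sep (UU a) (fun e => exists x, x ∊ UU a /\ opair x e ∊ a).
Definition insW (a b : W) : W :=
  sep a (fun q => exists x t, q = opair x t /\ exists y e, t = opair y e /\ opair x e ∊ b).
Definition secW (a b : W) : W := sep (UU a) (fun x => opair x b ∊ a).
(* [accW] is absolute between beta-models although it is not first-order. *)
Definition accW (a : W) : W := sep (UU a) (Acc (setrel a)).

(** Cases 2 to 8, with the singleton of the empty tuple, evaluate formulas on coded tuples; case 9
    then extracts a subset by fixing parameters. Cases 0 and 1 also serve the set axioms, and the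
    last case serves the beta property. *)
Definition op0 (i : nat) (a b : W) : W :=
  match i with
  | 0 => upair a b
  | 1 => bigU a
  | 2 => sep a (fun x => ~ x ∊ b)
  | 3 => prodW a b
  | 4 => ranW a
  | 5 => selW inW a
  | 6 => selW (fun x y => y ∊ x) a
  | 7 => selW eq a
  | 8 => insW a b
  | 9 => secW a b
  | _ => accW a
  end.
(** Indices 11 to 21 repeat the eleven operations with the arguments exchanged, hence [nops] is
    22. *)
Definition op (i : nat) (a b : W) : W :=
  if Nat.ltb i 11 then op0 i a b else op0 (i - 11) b a.
Definition nops : nat := 22.

Lemma in_UU a x : x ∊ UU a <-> exists y, y ∊ a /\ exists z, z ∊ y /\ x ∊ z.
Proof.
  unfold UU. rewrite in_bigU. split.
  - intros (z & Hx & Hz). apply in_bigU in Hz as (y & Hz & Hy). eauto.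
  - intros (y & Hy & z & Hz & Hx). exists z; split; auto. apply in_bigU; eauto.
Qed.

Lemma UU_l a x y : opair x y ∊ a -> x ∊ UU a.
Proof.
  intros H. apply in_UU. exists (opair x y); split; auto. exists (upair x x).
  split; apply in_upair; auto.
Qed.

Lemma UU_r a x y : opair x y ∊ a -> y ∊ UU a.
Proof.
  intros H. apply in_UU. exists (opair x y); split; auto. exists (upair x y).
  split; apply in_upair; auto.
Qed.

(** * The operations inside a model *)

Section Ops.
Context {N : W -> Prop} {Y : (W -> Prop) -> Prop} {M : Model N Y}.
Notation ud := (udef N Y).

Lemma Acc_no_ill (a x : W) : Acc (setrel a) x ->
  forall b, x ∊ b -> ~ forall y, y ∊ b -> exists z, z ∊ b /\ opair z y ∊ a.
Proof.
  induction 1 as [x _ IH]. intros b Hx H. destruct (H x Hx) as (z & Hz & Hzx).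
  exact (IH z Hzx b Hz H).
Qed.

Lemma NUU a : N a -> N (UU a).
Proof. intros; apply (Mun _ _ M), (Mun _ _ M); auto. Qed.

Definition ill (a x : W) : Prop :=
  exists b, N b /\ x ∊ b /\ forall y, y ∊ b -> exists z, z ∊ b /\ opair z y ∊ a.
Lemma ud_ill i j : ud (fun s Z => ill (s i) (s j)).
Proof. unfold ill. ud_auto. Qed.

(** This makes [accW] first-order over the model. Restrict a to the pairs whose upper end is not
    ill. A class without minimal element for this relation would, cut down to a set, make one of
    those upper ends ill; so the relation is well-founded in the model and, by [Mbeta], in truth. *)
Lemma Acc_iff a x : N a -> N x -> (Acc (setrel a) x <-> ~ ill a x).
Proof.
  intros Ha Hx. split.
  { intros H (b & _ & Hb & HH). exact (Acc_no_ill a x H b Hb HH). }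
  set (R := fun q => q ∊ a /\ exists y z, q = opair y z /\ ~ ill a z).
  assert (HR : Y R).
  { apply (Ysep (fun q => q ∊ a)); [now apply Yset|].
    ud_par a; auto. apply ud_expair. apply ud_not. apply ud_ill. }
  assert (HW : wfcls R).
  { apply (Mbeta _ _ M); auto.
    - intros q [_ (y & z & -> & _)]; eauto.
    - intros A HA [x0 Hx0]. apply NNPP; intros Hno.
      assert (H : forall m, A m -> exists y, A y /\ R (opair y m)).
      { intros m Hm. apply NNPP; intros Hn. apply Hno. exists m; split; auto.
        intros y Hy HRy. apply Hn; eauto. }
      destruct (H x0 Hx0) as (y & Hy & HRy & y' & z' & E & Hill).
      apply opair_inj in E as [<- <-]. apply Hill.
      exists (sep (UU a) A). split; [apply Usep; auto; now apply NUU|]. split.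
      + apply in_sep; split; auto. eapply UU_r; eauto.
      + intros w Hw. apply in_sep in Hw as [Hw HAw].
        destruct (H w HAw) as (v & HAv & HRv & _). exists v; split; auto.
        apply in_sep; split; auto. eapply UU_l; eauto. }
  revert Hx. induction x as [x IH] using (well_founded_induction HW). intros Hx Hg.
  constructor. intros y Hyx. unfold setrel in Hyx.
  assert (Hy : N y) by (eapply Fopair_l, Utr; eauto).
  apply IH; auto.
  - split; auto. exists y, x; auto.
  (* If b shows that a predecessor y of x is ill, then b with x adjoined shows that x is ill. *)
  - intros (b & Hb & Hyb & HH). apply Hg. exists (cup b (upair x x)).
    split; [apply Ncup; auto; now apply Upair|]. split; [apply in_cup; right; apply in_upair; auto|].
    intros z Hz. apply in_cup in Hz as [Hz|Hz].
    + destruct (HH z Hz) as (w & Hw & ?). exists w; split; auto. apply in_cup; auto.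
    + apply in_upair in Hz. assert (z = x) by tauto; subst z. exists y; split; auto. apply in_cup; auto.
Qed.

Lemma ud_inUU i j : ud (fun s Z => s i ∊ UU (s j)).
Proof.
  eapply ud_ext; [intros s Z _; apply in_UU|]. ud_auto.
Qed.

Lemma ud_insel rho i j : ud (fun s Z => rho (s 0) (s 1)) -> ud (fun s Z => s i ∊ selW rho (s j)).
Proof.
  intros H. eapply ud_ext; [intros s Z _; apply in_sep|].
  apply ud_and; [ud_auto|]. apply ud_expair. apply ud_expair.
  exact (ud_ren _ (fun n => match n with 0 => 3 | _ => 1 end) H).
Qed.

Lemma ud_inop0 i j k l : ud (fun s Z => s j ∊ op0 i (s k) (s l)).
Proof.
  destruct i as [|[|[|[|[|[|[|[|[|[|i]]]]]]]]]]; cbn [op0].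
  - eapply ud_ext; [intros s Z _; apply in_upair|]. ud_auto.
  - apply ud_ext with (fun s Z => exists y, y ∊ s k /\ s j ∊ y); [|ud_auto].
    intros s Z _. rewrite in_bigU. split; intros (y & H1 & H2); exists y; auto.
  - eapply ud_ext; [intros s Z _; apply in_sep|]. ud_auto.
  - eapply ud_ext; [intros s Z _; apply in_prodW|]. ud_auto.
  - eapply ud_ext; [intros s Z _; apply in_sep|]. apply ud_and; [apply ud_inUU|].
    apply ud_ext with (fun s Z => exists x, N x /\ opair x (s j) ∊ s k); [|ud_auto].
    intros s Z Hs; split.
    + intros (x & _ & Hx). exists x; split; auto. eapply Fopair_l, Utr; eauto.
    + intros (x & _ & Hx). exists x; split; auto. eapply UU_l; eauto.
  - apply ud_insel. ud_auto.
  - apply ud_insel. ud_auto.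
  - apply ud_insel. ud_auto.
  - eapply ud_ext; [intros s Z _; apply in_sep|]. ud_auto.
  - eapply ud_ext; [intros s Z _; apply in_sep|]. apply ud_and; [apply ud_inUU|]. ud_auto.
  - apply ud_ext with (fun s Z => s j ∊ UU (s k) /\ ~ ill (s k) (s j)).
    + intros s Z Hs. unfold op0, accW. rewrite in_sep, Acc_iff by auto. tauto.
    + apply ud_and; [apply ud_inUU|]. apply ud_not, ud_ill.
Qed.

Lemma ud_inop i j k l : ud (fun s Z => s j ∊ op i (s k) (s l)).
Proof. unfold op. destruct (Nat.ltb i 11); apply ud_inop0. Qed.

Lemma Nop0 i a b : N a -> N b -> N (op0 i a b).
Proof.
  intros Ha Hb.
  assert (HU : N (UU a)) by now apply NUU.
  assert (H : forall c, N c -> (forall z, z ∊ op0 i a b -> z ∊ c) -> N (op0 i a b)).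
  { intros c Hc Hs. replace (op0 i a b) with (sep c (fun z => z ∊ op0 i a b)).
    - apply usep; auto. ud_par b; auto. ud_par a; auto. apply ud_inop0.
    - apply ext; intros z; rewrite in_sep; split; [tauto|auto]. }
  destruct i as [|[|[|[|[|[|[|[|[|[|i]]]]]]]]]]; cbn [op0] in *.
  - now apply Upair.
  - now apply (Mun _ _ M).
  - apply (H a Ha). intros z Hz. apply in_sep in Hz; tauto.
  - now apply Nprod.
  - apply (H _ HU). intros z Hz. apply in_sep in Hz; tauto.
  - apply (H a Ha). intros z Hz. apply in_sep in Hz; tauto.
  - apply (H a Ha). intros z Hz. apply in_sep in Hz; tauto.
  - apply (H a Ha). intros z Hz. apply in_sep in Hz; tauto.
  - apply (H a Ha). intros z Hz. apply in_sep in Hz; tauto.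
  - apply (H _ HU). intros z Hz. apply in_sep in Hz; tauto.
  - apply (H _ HU). intros z Hz. apply in_sep in Hz; tauto.
Qed.

Lemma Nop i a b : N a -> N b -> N (op i a b).
Proof. unfold op. destruct (Nat.ltb i 11); intros; now apply Nop0. Qed.

Lemma ud_op i j k l : ud (fun s Z => s j = op i (s k) (s l)).
Proof.
  apply ud_ext with (fun s Z => forall z, N z -> (z ∊ s j <-> z ∊ op i (s k) (s l))).
  - intros s Z Hs; split; [intros ->; tauto|]. intros H. apply ext; intros z.
    split; intros Hz; apply H; auto; eapply Utr; eauto. now apply Nop.
  - apply ud_all. apply ud_iff; [apply ud_in|apply ud_inop].
Qed.
End Ops.

(** * The enumeration *)

Section Enumeration.
(* The larger index comes first, so that only a set of triples precedes a given one; nothing is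
   lost by [c <= b] because [op] lists every operation with both orders of its arguments. *)
Definition keylt (b c : W) (i : nat) (b' c' : W) (i' : nat) : Prop :=
  b ∊ b' \/ b = b' /\ (c ∊ c' \/ c = c' /\ i < i').
Definition newt (f : W -> W) (d b c : W) (i : nat) : Prop :=
  b ∊ d /\ (c ∊ b \/ c = b) /\ i < nops /\ ~ exists e, e ∊ d /\ f e = op i (f b) (f c).
Definition nxt (f : W -> W) (d x : W) : Prop :=
  (exists b c i, newt f d b c i /\
     (forall b' c' i', newt f d b' c' i' -> ~ keylt b' c' i' b c i) /\ x = op i (f b) (f c))
  \/ ((~ exists b c i, newt f d b c i) /\ x = image f d).

Definition restr (d : W) (g : forall e, e ∊ d -> W) : W -> W :=
  fun e => match excluded_middle_informative (e ∊ d) with left h => g e h | right _ => empty end.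
(* Greedy enumeration: the next value is the first new value of an operation on values listed
   so far or, if there is none, the set of all values listed so far. *)
Definition B : W -> W :=
  Fix in_wf (fun _ => W) (fun d g => epsilon (inhabits empty) (nxt (restr d g) d)).
Lemma B_eq d : B d = epsilon (inhabits empty) (nxt (restr d (fun e _ => B e)) d).
Proof.
  unfold B at 1. rewrite Fix_eq; [reflexivity|].
  intros x f g H. do 2 f_equal. unfold restr. apply functional_extensionality; intros e.
  destruct excluded_middle_informative; auto.
Qed.

Lemma newt_ext f g d b c i : ord d -> (forall e, e ∊ d -> f e = g e) -> newt f d b c i -> newt g d b c i.
Proof.
  intros O H (Hb & Hc & Hi & Hn).
  assert (Hcd : c ∊ d) by (eapply ord_le_trans; eauto).
  split; auto; split; auto; split; auto.
  intros (e & He & E). apply Hn. exists e; split; auto. rewrite !H; auto.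
Qed.

Lemma nxt_ext f g d x : ord d -> (forall e, e ∊ d -> f e = g e) -> nxt f d x -> nxt g d x.
Proof.
  intros O H. assert (H' : forall e, e ∊ d -> g e = f e) by (intros; symmetry; auto).
  intros [(b & c & i & Hn & Hm & ->)|[Hn ->]].
  - left; exists b, c, i. split; [now apply newt_ext with f|]. split.
    + intros b' c' i' Hn'. apply Hm. now apply newt_ext with g.
    + destruct Hn as (Hb & Hc & _). rewrite !H; auto. eapply ord_le_trans; eauto.
  - right; split.
    + intros (b & c & i & Hb). apply Hn. exists b, c, i. now apply newt_ext with g.
    + apply ext; intros z. rewrite !in_image. split; intros (y & Hy & ->); exists y; split; auto.
Qed.

(** The least new triple is reached by minimizing b, then c, then i. *)
Lemma nxt_ex f d : exists x, nxt f d x.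
Proof.
  destruct (classic (exists b c i, newt f d b c i)) as [(b0 & c0 & i0 & H0)|H].
  2:{ exists (image f d). right; auto. }
  destruct (in_minimal (fun b => exists c i, newt f d b c i) b0) as (b & (c1 & i1 & H1) & Hb); [eauto|].
  destruct (in_minimal (fun c => exists i, newt f d b c i) c1) as (c & (i2 & H2) & Hc); [eauto|].
  assert (H3 : exists i, newt f d b c i /\ forall j, j < i -> ~ newt f d b c j).
  { revert H2. induction i2 as [i IH] using (well_founded_induction lt_wf). intros H2.
    destruct (classic (exists j, j < i /\ newt f d b c j)) as [(j & Hj & Hn)|Hn]; [eauto|].
    exists i; split; auto. intros j Hj Hn'. apply Hn; eauto. }
  destruct H3 as (i & Hi & Hm). exists (op i (f b) (f c)). left. exists b, c, i.
  split; auto. split; auto. intros b' c' i' Hn' [K|[-> [K|[-> K]]]].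
  - apply (Hb b' K); eauto.
  - apply (Hc c' K); eauto.
  - exact (Hm i' K Hn').
Qed.

(** On triples with indices in the ordinal d the order [keylt] is linear, so two least new triples
    coincide. *)
Lemma nxt_unique f d x y : ord d -> nxt f d x -> nxt f d y -> x = y.
Proof.
  intros O [(b & c & i & Hn & Hm & ->)|[Hn ->]] [(b' & c' & i' & Hn' & Hm' & ->)|[Hn' ->]]; auto.
  - assert (Hb : b ∊ d) by apply Hn. assert (Hb' : b' ∊ d) by apply Hn'.
    assert (Hc : c ∊ d) by (apply (ord_le_trans _ b); auto; apply Hn).
    assert (Hc' : c' ∊ d) by (apply (ord_le_trans _ b'); auto; apply Hn').
    specialize (Hm _ _ _ Hn'). specialize (Hm' _ _ _ Hn). unfold keylt in *.
    destruct (proj2 O b b' Hb Hb') as [?|[?|?]]; try tauto. subst b'.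
    destruct (proj2 O c c' Hc Hc') as [?|[?|?]]; try tauto. subst c'.
    assert (i = i') by (destruct (Nat.lt_trichotomy i i') as [?|[?|?]]; tauto). now subst.
  - exfalso; eauto 6.
  - exfalso; eauto 6.
Qed.

Lemma B_nxt d : ord d -> nxt B d (B d).
Proof.
  intros O. rewrite B_eq.
  apply nxt_ext with (restr d (fun e _ => B e)); auto.
  - intros e He. unfold restr. destruct excluded_middle_informative; tauto.
  - apply epsilon_spec, nxt_ex.
Qed.

(** When a new triple is chosen, newness is part of the choice; otherwise equality would make B d an
    element of itself. *)
Lemma B_new d e : ord d -> e ∊ d -> B e <> B d.
Proof.
  intros O He E. destruct (B_nxt d O) as [(b & c & i & Hn & _ & E')|[_ E']].
  - apply Hn. exists e; split; congruence.
  - apply (in_irrefl (B d)). rewrite E' at 2. apply in_image. eauto.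
Qed.

Lemma B_inj d e : ord d -> ord e -> B d = B e -> d = e.
Proof.
  intros Od Oe E. destruct (ord_cmp d e Od Oe) as [H|[H|H]]; auto.
  - destruct (B_new e d Oe H E).
  - destruct (B_new d e Od H (eq_sym E)).
Qed.
End Enumeration.

Lemma flip_op i : i < nops -> exists i', i' < nops /\ forall a b, op i a b = op i' b a.
Proof.
  unfold nops, op; intros Hi. destruct (Nat.ltb_spec i 11).
  - exists (i + 11); split; [lia|]. intros a b. destruct (Nat.ltb_spec (i + 11) 11); [lia|].
    now replace (i + 11 - 11) with i by lia.
  - exists (i - 11); split; [lia|]. intros a b. destruct (Nat.ltb_spec (i - 11) 11); [auto|lia].
Qed.

(** * The enumeration inside a model *)

Section Levels.
Context {N : W -> Prop} {Y : (W -> Prop) -> Prop} {M : Model N Y}.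
Notation ud := (udef N Y).
Definition oN (d : W) : Prop := ord d /\ N d.

Lemma ud_N i : ud (fun s Z => N (s i)).
Proof. apply ud_ext with (fun s Z => True); [|apply ud_const]. intros s Z Hs; split; auto. Qed.

Lemma oN_in d e : oN d -> e ∊ d -> oN e.
Proof. intros [O Hd] He; split; [eapply ord_in; eauto|eapply Utr; eauto]. Qed.
Ltac oin := match goal with
  | H : ?e ∊ ?d, K : oN ?d |- oN ?e => exact (oN_in d e K H)
  | H : ?e ∊ ?d, K : oN ?d |- N ?e => exact (proj2 (oN_in d e K H))
  | H : ?e ∊ ?d, K : oN ?d |- ord ?e => exact (proj1 (oN_in d e K H))
  end.
Lemma oN_suc d : oN d -> oN (suc d).
Proof. intros [O H]; split; [now apply ord_suc|now apply (Nsuc (Y:=Y))]. Qed.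

Lemma oN_max a b : oN a -> oN b -> exists c, oN c /\ subW a c /\ subW b c.
Proof.
  intros Ha Hb. destruct (ord_cmp a b) as [H|[->|H]]; try apply Ha; try apply Hb.
  - exists b; repeat split; try apply Hb; intros z Hz; auto. eapply (proj1 (proj1 Hb)); eauto.
  - exists b; repeat split; try apply Hb; intros z; auto.
  - exists a; repeat split; try apply Ha; intros z Hz; auto. eapply (proj1 (proj1 Ha)); eauto.
Qed.

(** Membership among the ordinals of N as a class relation. It is transitive and its field is all
    ordinals of N, so [Metr] along it is recursion on the ordinals. *)
Definition ordT : W -> Prop := fun q => N q /\ exists c d, q = opair c d /\ ord d /\ c ∊ d.
Lemma ordT_pair c d : ordT (opair c d) <-> oN d /\ c ∊ d.
Proof.
  unfold ordT; split.
  - intros (HN & c' & d' & E & O & H). apply opair_inj in E as [<- <-].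
    split; auto. split; auto. eapply Fopair_r; eauto.
  - intros [[O HN] H]. split; [|eauto]. apply (Fopair (Y:=Y)); auto. eapply Utr; eauto.
Qed.

Lemma ordT_Y : Y ordT.
Proof. apply ucomp1. ud_auto. Qed.

Lemma ordT_rel : relcls ordT.
Proof. intros q (_ & c & d & -> & _); eauto. Qed.

Lemma ordT_tr : trcls ordT.
Proof.
  intros x y z Hxy Hyz. apply ordT_pair in Hxy as [H1 H2]. apply ordT_pair in Hyz as [H3 H4].
  apply ordT_pair. split; auto. eapply (proj1 (proj1 H3)); eauto.
Qed.

Lemma ordT_wf : wfcls ordT.
Proof.
  intros x. induction x as [x IH] using (well_founded_induction in_wf).
  constructor. intros y Hy. apply ordT_pair in Hy as [_ Hy]. auto.
Qed.

Lemma ordT_fld r : fld ordT r <-> oN r.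
Proof.
  unfold fld; split.
  - intros [y [H|H]]; apply ordT_pair in H as [H1 H2]; auto. oin.
  - intros H. exists (suc r). left. apply ordT_pair. split; [now apply oN_suc|apply in_suc; auto].
Qed.

(* [nxt] read off from the graph [Z] of the enumeration so far. *)
Definition newZ (i : nat) (Z : W -> Prop) (b c : W) : Prop :=
  exists x, N x /\ exists y, N y /\ Z (opair b x) /\ Z (opair c y) /\ (c ∊ b \/ c = b) /\
    ~ exists e, N e /\ exists z, N z /\ z = op i x y /\ Z (opair e z).
Definition nxtZ (x : W) (Z : W -> Prop) : Prop :=
  (exists i, i < nops /\ exists b, N b /\ exists c, N c /\ newZ i Z b c /\
    (~ exists j, j < nops /\ exists b', N b' /\ exists c', N c' /\ newZ j Z b' c' /\
       keylt b' c' j b c i) /\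
    exists y, N y /\ exists z, N z /\ Z (opair b y) /\ Z (opair c z) /\ x = op i y z)
  \/ ((~ exists i, i < nops /\ exists b, N b /\ exists c, N c /\ newZ i Z b c) /\
      forall z, N z -> (z ∊ x <-> exists e, N e /\ Z (opair e z))).
Lemma ud_newZ i j k : ud (fun s Z => newZ i Z (s j) (s k)).
Proof. unfold newZ. ud_auto; try apply ud_op. Qed.

Lemma ud_nxtZ : ud (fun s Z => nxtZ (s 0) Z).
Proof.
  unfold nxtZ. apply ud_or.
  - apply ud_finex; intros i _. apply ud_ex. apply ud_ex. apply ud_and; [apply ud_newZ|].
    apply ud_and.
    + apply ud_not. apply ud_finex; intros j _. apply ud_ex. apply ud_ex.
      apply ud_and; [apply ud_newZ|]. unfold keylt. ud_auto.
    + ud_auto; try apply ud_op.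
  - apply ud_and.
    + apply ud_not. apply ud_finex; intros i _. apply ud_ex. apply ud_ex. apply ud_newZ.
    + ud_auto.
Qed.

Lemma newZ_iff d Z b c i : oN d -> (forall e, e ∊ d -> N (B e)) ->
  (forall e z, Z (opair e z) <-> e ∊ d /\ z = B e) -> i < nops ->
  (newZ i Z b c <-> newt B d b c i).
Proof.
  intros Hd HB HZ Hi. unfold newZ, newt. split.
  - intros (x & Hx & y & Hy & H1 & H2 & Hc & Hn). apply HZ in H1 as [Hb ->], H2 as [Hc' ->].
    repeat split; auto. intros (e & He & E). apply Hn. exists e; split; [apply (oN_in _ _ Hd He)|].
    exists (B e); split; auto. split; auto. apply HZ; auto.
  - intros (Hb & Hc & _ & Hn). assert (Hcd : c ∊ d) by (eapply ord_le_trans; eauto; apply Hd).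
    exists (B b); split; auto. exists (B c); split; auto.
    split; [apply HZ; auto|]. split; [apply HZ; auto|]. split; auto.
    intros (e & He & z & Hz & E & HZe). apply HZ in HZe as [Hed ->]. apply Hn; eauto.
Qed.

Lemma nxtZ_iff d Z x : oN d -> (forall e, e ∊ d -> N (B e)) ->
  (forall e z, Z (opair e z) <-> e ∊ d /\ z = B e) -> N x ->
  (nxtZ x Z <-> nxt B d x).
Proof.
  intros Hd HB HZ Hx.
  assert (HNd : forall b c i, newt B d b c i -> b ∊ d /\ c ∊ d /\ N b /\ N c /\ i < nops).
  { intros b c i (Hb & Hc & Hi & _). assert (Hcd : c ∊ d) by (eapply ord_le_trans; eauto; apply Hd).
    repeat split; auto; oin. }
  assert (HnZ : forall b c i, i < nops -> (newZ i Z b c <-> newt B d b c i))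
    by (intros; now apply newZ_iff).
  assert (Hno : (~ exists i, i < nops /\ exists b, N b /\ exists c, N c /\ newZ i Z b c) <->
                ~ exists b c i, newt B d b c i).
  { split; intros H K; apply H.
    - destruct K as (b & c & i & K). destruct (HNd _ _ _ K) as (_ & _ & ? & ? & ?).
      exists i; split; auto. exists b; split; auto. exists c; split; auto. now apply HnZ.
    - destruct K as (i & Hi & b & _ & c & _ & K). exists b, c, i. now apply HnZ. }
  unfold nxtZ, nxt. rewrite Hno. split.
  - intros [(i & Hi & b & Hb & c & Hc & Hn & Hm & y & _ & z & _ & Hy & Hz & ->)|[Hn He]].
    + left. apply HZ in Hy as [_ ->], Hz as [_ ->]. apply HnZ in Hn; auto.
      exists b, c, i. split; auto. split; auto. intros b' c' j Hn' K. apply Hm.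
      destruct (HNd _ _ _ Hn') as (_ & _ & ? & ? & ?).
      exists j; split; auto. exists b'; split; auto. exists c'; split; auto. split; auto. now apply HnZ.
    + right; split; auto. apply ext; intros z. rewrite in_image. split.
      * intros Hz. apply He in Hz; [|eapply Utr; eauto]. destruct Hz as (e & _ & Hz). exists e. now apply HZ.
      * intros (e & Hed & ->). apply He; auto. exists e; split; [oin|]. apply HZ; auto.
  - intros [(b & c & i & Hn & Hm & ->)|[Hn ->]].
    + left. destruct (HNd _ _ _ Hn) as (? & ? & ? & ? & ?).
      exists i; split; auto. exists b; split; auto. exists c; split; auto. split; [now apply HnZ|]. split.
      * intros (j & Hj & b' & _ & c' & _ & Hn' & K). apply (Hm b' c' j); auto. now apply HnZ.
      * exists (B b); split; auto. exists (B c); split; auto. split; [apply HZ; auto|]. split; auto. apply HZ; auto.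
    + right; split; auto. intros z Hz. rewrite in_image. split.
      * intros (e & Hed & ->). exists e; split; [oin|]. apply HZ; auto.
      * intros (e & _ & Hz'). exists e. now apply HZ.
Qed.

Definition graphB : W -> Prop := fun q => exists d, oN d /\ q = opair d (B d).
Lemma graphB_pair d x : graphB (opair d x) <-> oN d /\ x = B d.
Proof.
  unfold graphB; split.
  - intros (e & He & E). apply opair_inj in E as [-> ->]; auto.
  - intros [Hd ->]; eauto.
Qed.

(** Recursion yields a class S, and ∈-induction identifies its section at d as {B d}. That B d lies
    in N belongs to the same induction, because a solution has values in N only. *)
Lemma B_class : (forall d, oN d -> N (B d)) /\ Y graphB.
Proof.
  destruct (etr_udef nxtZ ordT ud_nxtZ ordT_Y ordT_rel ordT_tr ordT_wf) as (S & HS & H1 & H2).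
  assert (H : forall d, oN d -> N (B d) /\ forall x, S (opair d x) <-> x = B d).
  { intros d; induction d as [d IH] using (well_founded_induction in_wf); intros Hd.
    assert (IH' : forall e, e ∊ d -> N (B e) /\ forall x, S (opair e x) <-> x = B e).
    { intros e He. apply IH; auto. oin. }
    assert (HZ : forall e z, below S ordT d (opair e z) <-> e ∊ d /\ z = B e).
    { intros e z. rewrite below_pair, ordT_pair. split.
      - intros [Hs [_ He]]. split; auto. now apply IH'.
      - intros [He ->]. split; auto. now apply IH'. }
    assert (HN : N (B d)).
    { destruct (B_nxt d (proj1 Hd)) as [(b & c & i & (Hb & Hc & _) & _ & ->)|[_ ->]].
      - apply (Nop (Y:=Y)); apply IH'; auto. eapply ord_le_trans; eauto. apply Hd.
      (* The set of all earlier values exists by Replacement along S, already known to agree with B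
         below d. *)
      - destruct (rep_udef (fun e x => S (opair e x)) d) as (b & Hb & HE); try apply Hd.
        + intros x y Hx Hs. apply IH' in Hs; auto. subst; now apply IH'.
        + intros x y y' Hx Hs Hs'. apply IH' in Hs, Hs'; auto. congruence.
        + ud_auto.
        + replace (image B d) with b; auto. apply ext; intros z. rewrite HE, in_image.
          split; intros (e & He & K); exists e; split; auto; now apply IH'. }
    split; auto. intros x.
    assert (Hf : fld ordT d) by now apply ordT_fld.
    assert (Hiff : N x -> (S (opair d x) <-> nxt B d x)).
    { intros Hx. rewrite H2 by auto. apply nxtZ_iff; auto. intros e He; now apply IH'. }
    split.
    - intros Hs. destruct (H1 _ Hs) as (r & x' & E & _ & Hx). apply opair_inj in E as [<- <-].
      apply Hiff in Hs; auto. eapply nxt_unique; eauto; [apply Hd|]. apply B_nxt, Hd.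
    - intros ->. apply Hiff; auto. apply B_nxt, Hd. }
  split; [intros d Hd; now apply H|].
  replace graphB with S; auto. apply pred_ext; intros q. unfold graphB. split.
  - intros Hs. destruct (H1 _ Hs) as (r & x & -> & Hf & _). apply ordT_fld in Hf.
    exists r; split; auto. f_equal. now apply H.
  - intros (d & Hd & ->). now apply H.
Qed.

Lemma NB d : oN d -> N (B d).
Proof. apply B_class. Qed.

Lemma Y_graphB : Y graphB.
Proof. apply B_class. Qed.

Definition constructible : W -> Prop := fun x => exists d, oN d /\ x = B d.
Lemma constructible_N x : constructible x -> N x.
Proof. intros (d & Hd & ->). now apply NB. Qed.

Lemma Y_constructible : Y constructible.
Proof.
  apply ucompN; [exact constructible_N|].
  apply ud_ext with (fun s Z => exists d, N d /\ graphB (opair d (s 0))).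
  - intros s Z _. unfold constructible. split; intros (d & H).
    + exists d. split; [apply H|]. now apply graphB_pair.
    + exists d. now apply graphB_pair.
  - pose proof Y_graphB. ud_auto.
Qed.

(** Replacement applied to the least bound of each x, followed by a supremum; monotonicity lets the
    supremum serve every x. *)
Lemma collect (P : W -> W -> Prop) c : N c ->
  ud (fun s Z => P (s 0) (s 1)) ->
  (forall x d d', x ∊ c -> oN d -> oN d' -> subW d d' -> P x d -> P x d') ->
  (forall x, x ∊ c -> exists d, oN d /\ P x d) ->
  exists d, oN d /\ forall x, x ∊ c -> P x d.
Proof.
  intros Hc HD Hm Ht.
  destruct (rep_udef (fun x d => oN d /\ P x d /\ forall e, e ∊ d -> ~ P x e) c) as (b & Hb & HE); auto.
  - intros x d _ [[_ H] _]; auto.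
  - intros x d d' Hx (Hd & HP & Hl) (Hd' & HP' & Hl').
    destruct (ord_cmp d d') as [H|[H|H]]; auto; try apply Hd; try apply Hd'.
    + destruct (Hl' _ H HP).
    + destruct (Hl _ H HP').
  - unfold oN. apply ud_and; [apply ud_and; [apply ud_ord|apply ud_N]|]. apply ud_and.
    + exact (ud_ren _ (fun n => n) HD).
    + apply ud_ball. apply ud_not.
      exact (ud_ren _ (fun n => match n with 0 => 1 | _ => 0 end) HD).
  - exists (bigU b).
    assert (Hbo : forall d, d ∊ b -> oN d) by (intros d Hd; apply HE in Hd as (x & _ & H & _); auto).
    assert (HO : oN (bigU b)).
    { split; [apply ord_bigU; intros d Hd; now apply Hbo|now apply (Mun _ _ M)]. }
    split; auto. intros x Hx. destruct (Ht x Hx) as (d0 & Hd0 & HP0).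
    destruct (in_minimal (fun d => oN d /\ P x d) d0) as (d & [Hd HP] & Hl); auto.
    assert (Hdb : d ∊ b).
    { apply HE. exists x; split; auto. split; auto. split; auto. intros e He HPe.
      apply (Hl e He). split; auto. oin. }
    apply (Hm x d); auto. intros z Hz. apply in_bigU; eauto.
Qed.

(** * Closure under the operations *)

Lemma fin_max (Q : nat -> W -> Prop) n :
  (forall i d d', i < n -> oN d -> oN d' -> subW d d' -> Q i d -> Q i d') ->
  (forall i, i < n -> exists d, oN d /\ Q i d) -> exists d, oN d /\ forall i, i < n -> Q i d.
Proof.
  induction n as [|n IH]; intros Hm H.
  - exists empty; split; [split; [apply ord_empty|apply Uempty]|]. lia.
  - destruct IH as (d & Hd & HQ); [eauto|intros; apply H; lia|].
    destruct (H n) as (d' & Hd' & HQ'); [lia|].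
    destruct (oN_max d d') as (e & He & H1 & H2); auto.
    exists e; split; auto. intros i Hi. assert (i = n \/ i < n) as [->|?] by lia.
    + eapply Hm; [lia|exact Hd'|..]; auto.
    + eapply Hm; [lia|exact Hd|..]; auto.
Qed.

(** If the value were never listed, the triple (b, c, i) would stay new at all stages above b, and
    each such stage would have to list the value of a triple with first index at most b. By
    Collection the constructible values of those triples are all listed before some stage s, so a
    stage past s has none left to list. *)
Lemma constructible_op_le i b c : i < nops -> oN b -> c ∊ b \/ c = b -> constructible (op i (B b) (B c)).
Proof.
  intros Hi Hb Hc. apply NNPP; intros HK.
  (* If the value of operation i at indices x and y is constructible, it has an index in s. The
     graph of B is used to make this definable. *)
  set (Q := fun i (x y s : W) => forall a, N a -> forall b, N b -> graphB (opair x a) -> graphB (opair y b) ->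
     forall z, N z -> z = op i a b -> constructible z -> exists e, e ∊ s /\ graphB (opair e z)).
  assert (HQ : forall i j k l, ud (fun s Z => Q i (s j) (s k) (s l))).
  { intros. pose proof Y_graphB. pose proof Y_constructible. unfold Q. ud_auto. apply ud_op. }
  assert (HQm : forall i x y d d', subW d d' -> Q i x y d -> Q i x y d').
  { intros i0 x y d d' Hs H u Hu v Hv H1 H2 z Hz E HKz.
    destruct (H u Hu v Hv H1 H2 z Hz E HKz) as (e & He & HG). eauto. }
  assert (Hsb : oN (suc b)) by now apply oN_suc.
  assert (H : exists d, oN d /\ forall i, i < nops -> forall x, x ∊ suc b -> forall y, y ∊ suc b -> Q i x y d).
  { apply fin_max.
    - intros j d d' _ _ _ Hs H x Hx y Hy. eauto.
    - intros j Hj. apply (collect (fun x s => forall y, y ∊ suc b -> Q j x y s)); try apply Hsb.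
      + ud_par (suc b); [apply Hsb|]. apply ud_ball. apply HQ.
      + intros x d d' _ _ _ Hs H y Hy. eauto.
      + intros x Hx. apply (collect (fun y s => Q j x y s)); try apply Hsb.
        * ud_par x; [apply (oN_in _ _ Hsb Hx)|]. apply HQ.
        * intros y d d' _ _ _ Hs H. eauto.
        * intros y Hy. pose proof (oN_in _ _ Hsb Hx) as Hox. pose proof (oN_in _ _ Hsb Hy) as Hoy.
          destruct (classic (constructible (op j (B x) (B y)))) as [(d & Hd & E)|Hn].
          -- exists (suc d); split; [now apply oN_suc|]. intros u _ v _ H1 H2 z _ Ez _.
             apply graphB_pair in H1 as [_ ->], H2 as [_ ->]. exists d; split; [apply in_suc; auto|].
             apply graphB_pair. split; auto. congruence.
          -- exists empty; split; [split; [apply ord_empty|apply Uempty]|].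
             intros u _ v _ H1 H2 z _ Ez Hz. apply graphB_pair in H1 as [_ ->], H2 as [_ ->].
             subst z. tauto. }
  destruct H as (s & Hs & HB).
  destruct (oN_max s (suc b)) as (d & Hd & Hsd & Hbd); auto.
  assert (Hbd' : b ∊ d) by (apply Hbd, in_suc; auto).
  assert (Hnew : newt B d b c i).
  { repeat split; auto. intros (e & He & E). apply HK. exists e. split; [|auto]. oin. }
  destruct (B_nxt d (proj1 Hd)) as [(b' & c' & j & Hn & Hmin & E)|[Hn _]]; [|apply Hn; eauto].
  destruct Hn as (Hb' & Hc' & Hj & Hn).
  (* The step at d takes the least new triple, and (b, c, i) is new there. *)
  assert (Hb's : b' ∊ suc b).
  { apply in_suc. destruct (ord_cmp b' b) as [?|[?|K]]; auto; [oin|apply Hb|].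
    exfalso. apply (Hmin _ _ _ Hnew). left; auto. }
  assert (Hc's : c' ∊ suc b) by (eapply ord_le_trans; eauto; apply Hsb).
  assert (Hob' : oN b') by (oin). assert (Hoc' : oN c') by (eapply oN_in; [exact Hsb|auto]).
  destruct (HB j Hj b' Hb's c' Hc's (B b') (NB _ Hob') (B c') (NB _ Hoc')) with (B d) as (e & He & HG).
  - apply graphB_pair; auto.
  - apply graphB_pair; auto.
  - now apply NB.
  - auto.
  - exists d; auto.
  - apply graphB_pair in HG as [_ HG]. apply Hn. exists e; split; auto. congruence.
Qed.

Lemma constructible_op i x y : i < nops -> constructible x -> constructible y -> constructible (op i x y).
Proof.
  intros Hi (b & Hb & ->) (c & Hc & ->).
  destruct (ord_cmp b c) as [H|[->|H]]; try apply Hb; try apply Hc.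
  - destruct (flip_op i Hi) as (j & Hj & E). rewrite E. apply constructible_op_le; auto.
  - apply constructible_op_le; auto.
  - apply constructible_op_le; auto.
Qed.

Lemma constructible_op0 i x y : i < 11 -> constructible x -> constructible y -> constructible (op0 i x y).
Proof.
  intros Hi Hx Hy. replace (op0 i x y) with (op i x y); [apply constructible_op; auto; unfold nops; lia|].
  unfold op. destruct (Nat.ltb_spec i 11); [auto|lia].
Qed.

(** An element of B b may have an index above the current stage, beyond the reach of an induction on
    indices. The induction in [constructible_hered] therefore carries the property to elements of
    elements as well. *)
Inductive hered (P : W -> Prop) (x : W) : Prop :=
  hered_intro : P x -> (forall y, y ∊ x -> hered P y) -> hered P x.
Lemma hered_upair x y : hered constructible x -> hered constructible y -> hered constructible (upair x y).
Proof.
  intros Hx Hy. constructor.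
  - apply (constructible_op0 0); [lia|apply Hx|apply Hy].
  - intros z Hz. apply in_upair in Hz as [->| ->]; auto.
Qed.

Lemma hered_UU a x : hered constructible a -> x ∊ UU a -> hered constructible x.
Proof.
  intros Ha Hx. apply in_UU in Hx as (y & Hy & z & Hz & Hx).
  destruct Ha as [_ Ha]. destruct (Ha y Hy) as [_ H1]. destruct (H1 z Hz) as [_ H2]. auto.
Qed.

Lemma hered_op0 i a b z : hered constructible a -> hered constructible b -> z ∊ op0 i a b -> hered constructible z.
Proof.
  intros Ha Hb.
  assert (Hsa : forall P, z ∊ sep a P -> hered constructible z).
  { intros P Hz. apply in_sep in Hz as [Hz _]. destruct Ha; auto. }
  assert (HsU : forall P, z ∊ sep (UU a) P -> hered constructible z).
  { intros P Hz. apply in_sep in Hz as [Hz _]. exact (hered_UU _ _ Ha Hz). }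
  destruct i as [|[|[|[|[|[|[|[|[|[|i]]]]]]]]]]; cbn [op0]; try apply Hsa; try apply HsU.
  - intros Hz. apply in_upair in Hz as [->| ->]; auto.
  - intros Hz. apply in_bigU in Hz as (y & Hz & Hy). destruct Ha as [_ Ha]. destruct (Ha y Hy); auto.
  - intros Hz. apply in_prodW in Hz as (x & y & -> & Hx & Hy).
    destruct Ha as [_ Ha], Hb as [_ Hb]. apply hered_upair; apply hered_upair; auto.
Qed.

Lemma constructible_hered d : oN d -> hered constructible (B d).
Proof.
  induction d as [d IH] using (well_founded_induction in_wf); intros Hd.
  constructor; [exists d; auto|]. intros z Hz.
  destruct (B_nxt d (proj1 Hd)) as [(b & c & i & (Hb & Hc & _) & _ & E)|[_ E]]; rewrite E in Hz.
  - assert (Hcd : c ∊ d) by (eapply ord_le_trans; eauto; apply Hd).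
    assert (Hb' : hered constructible (B b)) by (apply IH; auto; oin).
    assert (Hc' : hered constructible (B c)) by (apply IH; auto; oin).
    unfold op in Hz. destruct (Nat.ltb i 11); eapply hered_op0; try exact Hz; auto.
  - apply in_image in Hz as (e & He & ->). apply IH; auto. oin.
Qed.

Lemma constructible_tr x y : x ∊ y -> constructible y -> constructible x.
Proof.
  intros Hx (d & Hd & ->). destruct (constructible_hered d Hd) as [_ H]. destruct (H x Hx); auto.
Qed.

Definition lev (d : W) : W := image B d.
Lemma in_lev d x : oN d -> (x ∊ lev d <-> exists e, e ∊ d /\ graphB (opair e x)).
Proof.
  intros Hd. unfold lev; rewrite in_image. split; intros (e & He & H); exists e; split; auto.
  - apply graphB_pair; split; auto. oin.
  - now apply graphB_pair in H.
Qed.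

Lemma lev_mono d d' : subW d d' -> subW (lev d) (lev d').
Proof.
  intros H x. unfold lev; rewrite !in_image. intros (e & He & ->); eauto.
Qed.

Lemma lev_constructible d x : oN d -> x ∊ lev d -> constructible x.
Proof.
  intros Hd Hx. apply in_lev in Hx as (e & He & H); auto. apply graphB_pair in H as [? ->]. exists e; auto.
Qed.

Lemma constructible_lev x : constructible x -> exists d, oN d /\ x ∊ lev d.
Proof.
  intros (d & Hd & ->). exists (suc d); split; [now apply oN_suc|].
  apply in_image. exists d; split; auto. apply in_suc; auto.
Qed.

Lemma N_lev d : oN d -> N (lev d).
Proof.
  intros Hd. destruct (rep_udef (fun e x => graphB (opair e x)) d) as (b & Hb & HE); try apply Hd.
  - intros x y _ H. apply graphB_pair in H as [H ->]. now apply NB.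
  - intros x y y' _ H H'. apply graphB_pair in H as [_ ->], H' as [_ ->]; auto.
  - pose proof Y_graphB. ud_auto.
  - replace (lev d) with b; auto. apply ext; intros z. rewrite HE, in_lev by auto. tauto.
Qed.

(** * Closed levels *)

Lemma limit_ex : exists l, oN l /\ empty ∊ l /\ forall n, n ∊ l -> suc n ∊ l.
Proof.
  destruct (Minf _ _ M) as (w & Hw & H0 & Hs).
  assert (HN : N (sep w ord)).
  { apply usep; auto. apply ud_ord. }
  exists (bigU (sep w ord)).
  assert (H : forall o, o ∊ sep w ord -> suc o ∊ sep w ord).
  { intros o Ho. apply in_sep in Ho as [? ?]. apply in_sep; split; auto. now apply ord_suc. }
  repeat split.
  - intros x y Hx Hy. apply in_bigU in Hy as (o & Hy & Ho). apply in_bigU. exists o; split; auto.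
    apply in_sep in Ho as [_ Ho]. eapply (proj1 Ho); eauto.
  - apply ord_bigU. intros x Hx. apply in_sep in Hx; tauto.
  - now apply (Mun _ _ M).
  - apply in_bigU. exists (suc empty). split; [apply in_suc; auto|]. apply H, in_sep. split; auto. apply ord_empty.
  - intros n Hn. apply in_bigU in Hn as (o & Hn & Ho). apply in_bigU. exists (suc o). split; auto.
    apply in_sep in Ho as [_ Ho]. apply in_suc.
    apply ord_sub_le; auto; [eapply ord_suc, ord_in; eauto|].
    intros z Hz. apply in_suc in Hz as [Hz| ->]; auto. eapply (proj1 Ho); eauto.
Qed.

(** The closing-off argument: choose bounds for earlier bounds repeatedly and take the supremum
    along a limit w. Monotonicity in the second argument and its opposite in the first carry P from
    consecutive values to every d below the supremum. *)
Lemma iter_close (P : W -> W -> Prop) d0 : oN d0 ->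
  ud (fun s Z => P (s 0) (s 1)) ->
  (forall x d d', oN x -> oN d -> oN d' -> subW d d' -> P x d -> P x d') ->
  (forall x x' d, oN x -> oN x' -> oN d -> subW x x' -> P x' d -> P x d) ->
  (forall x, oN x -> exists d, oN d /\ P x d) ->
  exists l, oN l /\ d0 ∊ l /\ (forall d, d ∊ l -> suc d ∊ l) /\ forall d, d ∊ l -> P d l.
Proof.
  intros H0 HD Hm Ha Ht.
  (* The next value of the sequence Z is the least x that contains d0 and every earlier value y,
     with P y x. *)
  set (ok := fun (x : W) (Z : W -> Prop) => d0 ∊ x /\
     forall m, N m -> forall y, N y -> Z (opair m y) -> y ∊ x /\ P y x).
  set (Phi := fun x Z => ord x /\ ok x Z /\ forall x', x' ∊ x -> ~ ok x' Z).
  assert (Hok : forall i, ud (fun s Z => ok (s i) Z)).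
  { intros i. unfold ok. ud_par d0; [apply H0|]. apply ud_and; [ud_auto|].
    apply ud_all. apply ud_all. apply ud_imp; [ud_auto|]. apply ud_and; [ud_auto|].
    exact (ud_ren _ (fun n => match n with 0 => 0 | _ => S (S (S i)) end) HD). }
  assert (HPhi : ud (fun s Z => Phi (s 0) Z)).
  { unfold Phi. apply ud_and; [ud_auto|]. apply ud_and; [apply Hok|]. apply ud_ball. apply ud_not. apply Hok. }
  destruct (etr_udef Phi ordT HPhi ordT_Y ordT_rel ordT_tr ordT_wf) as (S & HS & H1 & H2).
  assert (HSN : forall n x, S (opair n x) -> N x).
  { intros n x Hs. destruct (H1 _ Hs) as (r & x' & E & _ & Hx). apply opair_inj in E as [<- <-]; auto. }
  assert (HSo : forall n x, oN n -> S (opair n x) -> oN x).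
  { intros n x Hn Hs. assert (Hx : N x) by eauto. apply H2 in Hs; auto; [|now apply ordT_fld].
    split; auto. apply Hs. }
  assert (Huni : forall n x x', oN n -> S (opair n x) -> S (opair n x') -> x = x').
  { intros n x x' Hn Hs Hs'. assert (Hx : oN x) by eauto. assert (Hx' : oN x') by eauto.
    apply H2 in Hs as (_ & Hs & Hl); [|now apply ordT_fld|apply Hx].
    apply H2 in Hs' as (_ & Hs' & Hl'); [|now apply ordT_fld|apply Hx'].
    destruct (ord_cmp x x') as [K|[K|K]]; auto; try apply Hx; try apply Hx'.
    - destruct (Hl' _ K Hs).
    - destruct (Hl _ K Hs'). }
  assert (Hex : forall n, oN n -> exists x, S (opair n x)).
  { intros n Hn.
    destruct (rep_udef (fun m y => S (opair m y)) n) as (b & Hb & HE); try apply Hn.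
    - intros x y _; eauto.
    - intros x y y' Hx; eapply Huni. oin.
    - ud_auto.
    - assert (Hbo : forall y, y ∊ b -> oN y).
      { intros y Hy. apply HE in Hy as (m & Hmn & Hs). eapply HSo; [|eauto]. oin. }
      destruct (collect (fun y s => y ∊ s /\ P y s) b) as (s & Hs & HPs); auto.
      + apply ud_and; [ud_auto|]. exact HD.
      + intros x d d' Hx Hd Hd' Hsub [Hxd HPx]. split; auto. eapply Hm; [..|exact HPx]; auto.
      + intros y Hy. destruct (Ht y) as (d & Hd & HP); auto.
        destruct (oN_max d (suc y)) as (e & He & K1 & K2); [auto|apply oN_suc; auto|].
        exists e; split; auto. split; [apply K2, in_suc; auto|]. eapply Hm; [..|exact HP]; auto.
      + destruct (oN_max s (suc d0)) as (t & Hto & K1 & K2); [auto|now apply oN_suc|].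
        assert (Hokt : ok t (below S ordT n)).
        { split; [apply K2, in_suc; auto|]. intros m _ y _ Hz. apply below_pair in Hz as [Hz Hz'].
          apply ordT_pair in Hz' as [_ Hz'].
          assert (Hyb : y ∊ b) by (apply HE; eauto). destruct (HPs y Hyb). split; auto.
          eapply Hm; [..|eassumption]; auto. }
        destruct (in_minimal (fun x => oN x /\ ok x (below S ordT n)) t) as (x & [Hx Hokx] & Hl); auto.
        exists x. apply H2; [now apply ordT_fld|apply Hx|]. split; [apply Hx|]. split; auto.
        intros x' Hx' Hn'. apply (Hl x' Hx'). split; auto. oin. }
  destruct limit_ex as (w & Hw & Hw0 & Hws).
  destruct (rep_udef (fun m y => S (opair m y)) w) as (b & Hb & HE); try apply Hw.
  { intros x y _; eauto. }
  { intros x y y' Hx; eapply Huni. oin. }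
  { ud_auto. }
  assert (Hbo : forall y, y ∊ b -> oN y).
  { intros y Hy. apply HE in Hy as (m & Hmn & Hs). eapply HSo; [|eauto]. oin. }
  assert (HO : oN (bigU b)).
  { split; [apply ord_bigU; intros d Hd; now apply Hbo|now apply (Mun _ _ M)]. }
  (* Here y and y' are the values at n and its successor; both indices lie in the limit w, so both
     values count towards the supremum. *)
  assert (Hb0 : forall n, n ∊ w -> exists y y', S (opair n y) /\ y ∊ b /\ y' ∊ b /\ d0 ∊ y /\ y ∊ y' /\ P y y').
  { intros n Hn. assert (Hno : oN n) by (oin).
    assert (Hsno : oN (suc n)) by now apply oN_suc.
    destruct (Hex n Hno) as (y & Hy). destruct (Hex (suc n) Hsno) as (y' & Hy').
    exists y, y'. split; auto. split; [apply HE; eauto|]. split; [apply HE; eauto|].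
    assert (Hyo : oN y) by eauto. assert (Hyo' : oN y') by eauto.
    pose proof Hy as Hy2. apply H2 in Hy2 as (_ & [K1 _] & _); [|now apply ordT_fld|apply Hyo].
    apply H2 in Hy' as (_ & [_ K2] & _); [|now apply ordT_fld|apply Hyo'].
    split; auto. apply (K2 n); [apply Hno|apply Hyo|].
    apply below_pair. split; auto. apply ordT_pair; split; auto. apply in_suc; auto. }
  exists (bigU b). split; auto. split.
  { destruct (Hb0 empty Hw0) as (y & y' & _ & Hy & _ & Hd & _). apply in_bigU; eauto. }
  assert (HK : forall d, d ∊ bigU b -> exists y y', y ∊ b /\ y' ∊ b /\ d ∊ y /\ y ∊ y' /\ P y y').
  { intros d Hd. apply in_bigU in Hd as (y & Hd & Hy). pose proof Hy as Hyb. apply HE in Hy as (n & Hn & Hs).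
    destruct (Hb0 n Hn) as (z & z' & Hz & ? & ? & ? & ? & ?).
    assert (y = z) by (eapply Huni; [|eauto|eauto]; oin). subst. exists z, z'; auto. }
  split.
  - intros d Hd. destruct (HK d Hd) as (y & y' & Hy & Hy' & Hdy & Hyy & _).
    assert (Hyo : oN y) by auto. assert (Hyo' : oN y') by auto.
    apply in_bigU. exists y'; split; auto.
    apply (ord_le_trans _ y); [apply Hyo'| |auto].
    apply ord_sub_le; [apply ord_suc; eapply ord_in; [apply Hyo|auto]|apply Hyo|].
    intros z Hz. apply in_suc in Hz as [Hz| ->]; auto. eapply (proj1 (proj1 Hyo)); eauto.
  - intros d Hd. destruct (HK d Hd) as (y & y' & Hy & Hy' & Hdy & Hyy & HP).
    assert (Hyo : oN y) by auto. assert (Hyo' : oN y') by auto.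
    assert (Hdo : oN d) by (oin).
    apply (Hm d y'); auto. { intros z Hz; apply in_bigU; eauto. }
    apply (Ha d y); auto. intros z Hz. eapply (proj1 (proj1 Hyo)); eauto.
Qed.
End Levels.

Ltac oin := match goal with
  | H : ?e ∊ ?d, K : oN ?d |- oN ?e => exact (oN_in d e K H)
  | H : ?e ∊ ?d, K : oN ?d |- _ ?e => first [exact (proj2 (oN_in d e K H))|exact (proj1 (oN_in d e K H))]
  end.

(** * Finitely many variables *)

Section Tail.
Context {N : W -> Prop} {Y : (W -> Prop) -> Prop} {U : Univ N Y}.
Notation ud := (udef N Y).
(* Possible because a formula has only finitely many variables. *)
Lemma ud_tail k s0 P : ud P -> (forall i, N (s0 i)) ->
  ud (fun s Z => P (fun i => if Nat.ltb i k then s i else s0 (i - k)) Z).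
Proof.
  intros (p & C & HC & Hp) Hs0. destruct (bnd_ex p) as [n Hn].
  (* The slots from k on become constants one at a time; after n of them, no free variable of p
     reads what remains of s. *)
  assert (H : forall j, ud (fun s Z => satW N p
    (fun i => if Nat.ltb i k then s i else if Nat.ltb i (k + j) then s0 (i - k) else s i) (scons Z C))).
  { induction j as [|j IH].
    - exists p, C; split; auto. intros s Z Hs.
      replace (fun i => if Nat.ltb i k then s i else if Nat.ltb i (k + 0) then s0 (i - k) else s i)
        with s; [tauto|]. apply functional_extensionality; intros i.
      replace (k + 0) with k by lia. now destruct (Nat.ltb i k).
    - pose (F := fun y s (Z : W -> Prop) => satW N p
        (fun i => if Nat.ltb i k then s i else if Nat.ltb i (k + j) then s0 (i - k) else
           if Nat.eqb i (k + j) then y else s i) (scons Z C)).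
      apply ud_ext with (F (s0 j)).
      + intros s Z _. unfold F.
        match goal with |- satW _ _ ?a _ <-> satW _ _ ?b _ => replace a with b; [tauto|] end.
        apply functional_extensionality; intros i.
        destruct (Nat.ltb_spec i k), (Nat.ltb_spec i (k + j)), (Nat.ltb_spec i (k + S j)),
          (Nat.eqb_spec i (k + j)); try lia; auto. f_equal; lia.
      + apply ud_const_param; auto. unfold F.
        pose (f := fun i => if Nat.eqb i (k + j) then 0 else S i).
        eapply ud_ext; [|exact (ud_ren _ f IH)]. intros s Z _. cbv beta.
        match goal with |- satW _ _ ?a _ <-> satW _ _ ?b _ => replace a with b; [tauto|] end.
        apply functional_extensionality; intros i. unfold f.
        destruct (Nat.ltb_spec i k), (Nat.ltb_spec i (k + j)), (Nat.eqb_spec i (k + j)); try lia; auto. }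
  eapply ud_ext; [|exact (H n)]. intros s Z Hs. cbv beta.
  rewrite <- Hp by (intros i; destruct (Nat.ltb i k); auto).
  apply satW_ext with n; auto.
  - intros i Hi. destruct (Nat.ltb_spec i k), (Nat.ltb_spec i (k + n)); auto; lia.
  - tauto.
Qed.
End Tail.

(** Unlike in [bnd], the bound is not raised under a quantifier. The induction in [reflect] works
    with a level chosen for one n, so the bound has to be the same for all subformulas. *)
Fixpoint abnd (n : nat) (p : form) : Prop :=
  match p with
  | fIn i j | fEq i j => i < n /\ j < n
  | fCls i k => i < n
  | fNot q | fAll q => abnd n q
  | fAnd q r => abnd n q /\ abnd n r
  end.
Lemma abnd_bnd p : forall n, abnd n p -> bnd n p.
Proof.
  induction p; simpl; intros n H; auto.
  - destruct H; auto.
  - apply (bnd_mono _ n); auto.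
Qed.

Lemma abnd_mono p : forall n m, n <= m -> abnd n p -> abnd m p.
Proof.
  induction p; simpl; intros n m Hl H; try lia; eauto. destruct H; eauto.
Qed.

Lemma abnd_ex p : exists n, abnd n p.
Proof.
  induction p as [i j|i j|i k|q [n IH]|q [n IH] r [m IH']|q [n IH]]; simpl; eauto.
  - exists (S (i + j)); lia.
  - exists (S (i + j)); lia.
  - exists (n + m); split; [apply (abnd_mono q n)|apply (abnd_mono r m)]; auto; lia.
Qed.

(** * Levels closed under definable bounds *)

Section Closing.
Context {N : W -> Prop} {Y : (W -> Prop) -> Prop} {M : Model N Y}.
Notation ud := (udef N Y).
Notation K := (@constructible N).
Notation on := (@oN N).
Notation G := (@graphB N).

(** Membership in [lev d], phrased through the graph class so that it is definable with d as a
    variable. *)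
Definition inL (d x : W) : Prop := exists e, e ∊ d /\ G (opair e x).
Lemma inL_lev d x : on d -> (inL d x <-> x ∊ lev d).
Proof. intros Hd. rewrite in_lev by auto. unfold inL; tauto. Qed.

Lemma inL_K d x : inL d x -> K x.
Proof. intros (e & _ & H). apply graphB_pair in H as [? ->]. exists e; auto. Qed.

Lemma inL_mono d d' x : subW d d' -> inL d x -> inL d' x.
Proof. intros Hs (e & He & H). exists e; auto. Qed.

Lemma ud_inL i j : ud (fun s Z => inL (s i) (s j)).
Proof. unfold inL. pose proof (Y_graphB (Y:=Y)). ud_auto. Qed.

Lemma on_empty : on empty.
Proof. split; [apply ord_empty|apply Uempty]. Qed.

Lemma K_empty : K empty.
Proof.
  assert (H : K (B empty)) by (exists empty; split; auto; apply on_empty).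
  replace empty with (op0 2 (B empty) (B empty)); [now apply (constructible_op0 (Y:=Y)); [lia|..]|].
  apply ext; intros z. cbn [op0]. rewrite in_sep. split; [tauto|]. intros Hz. destruct (in_empty _ Hz).
Qed.

(** A quantifier over n-tuples from level d, split into n nested ones so that [collect] can bound
    them one after another. *)
Fixpoint lball (n : nat) (d : W) (Q : (nat -> W) -> Prop) (s : nat -> W) : Prop :=
  match n with
  | 0 => Q s
  | S m => forall x, inL d x -> lball m d Q (scons x s)
  end.
Lemma lball_elim n d Q : forall s0 s, lball n d Q s0 ->
  (forall i, i < n -> inL d (s i)) -> (forall i, s (n + i) = s0 i) -> Q s.
Proof.
  induction n as [|m IH]; simpl; intros s0 s H H1 H2.
  - replace s with s0; auto. apply functional_extensionality; intros i; symmetry; apply H2.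
  (* The outermost quantifier binds slot m, the deepest of the entries pushed. *)
  - apply (IH (scons (s m) s0)); auto.
    intros [|i]; simpl; [f_equal; lia|]. rewrite <- H2. f_equal; lia.
Qed.

Lemma lball_anti n d d' Q : forall s, subW d d' -> lball n d' Q s -> lball n d Q s.
Proof.
  induction n as [|m IH]; simpl; intros s Hs H; auto.
  intros x Hx. apply IH; auto. apply H. eapply inL_mono; eauto.
Qed.

Lemma lball_imp n d (Q Q' : (nat -> W) -> Prop) : forall s, (forall i, K (s i)) ->
  (forall s, (forall i, K (s i)) -> Q s -> Q' s) -> lball n d Q s -> lball n d Q' s.
Proof.
  induction n as [|m IH]; simpl; intros s Hs HQ H; auto.
  intros x Hx. apply IH; auto. apply scons_all; auto. eapply inL_K; eauto.
Qed.

Section Close.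
Variables (Q : (nat -> W) -> W -> Prop).
Hypothesis HD : ud (fun s Z => Q (fun i => s (S i)) (s 0)).
Hypothesis Hm : forall s d d', (forall i, K (s i)) -> on d -> on d' -> subW d d' -> Q s d -> Q s d'.
Hypothesis Ht : forall s, (forall i, K (s i)) -> exists d, on d /\ Q s d.

Lemma ud_lball n : ud (fun s Z => lball n (s 1) (fun e => Q e (s 0)) (fun i => s (S (S i)))).
Proof.
  induction n as [|m IH]; simpl.
  - exact (ud_ren _ (fun n => match n with 0 => 0 | S i => S (S i) end) HD).
  - apply ud_ext with (fun s Z => forall x, N x -> inL (s 1) x ->
      lball m (s 1) (fun e => Q e (s 0)) (scons x (fun i => s (S (S i))))).
    + intros s Z _; split; intros H x Hx; auto. apply H; auto. eapply (constructible_N (Y:=Y)), inL_K; eauto.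
    + apply ud_all. apply ud_imp; [apply ud_inL|].
      pose (f := fun n => match n with 0 => 1 | 1 => 2 | 2 => 0 | S i => S i end).
      eapply ud_ext; [|exact (ud_ren _ f IH)]. intros s Z _. cbv beta. unfold f at 1 2.
      replace (fun i => s (f (S (S i)))) with (scons (s 0) (fun i => s (S (S (S i))))); [tauto|].
      apply functional_extensionality; intros [|i]; reflexivity.
Qed.

Lemma lball_total n d : on d -> forall s, (forall i, K (s i)) ->
  exists t, on t /\ lball n d (fun e => Q e t) s.
Proof.
  intros Hd. induction n as [|m IH]; simpl; intros s Hs; auto.
  destruct (collect (fun x t => lball m d (fun e => Q e t) (scons x s)) (lev d)) as (t & Hto & H).
  - now apply (N_lev (Y:=Y)).
  - ud_par d; [apply Hd|].
    assert (H : ud (fun s' Z => lball m (s' 0) (fun e => Q e (s' 2)) (scons (s' 1) (fun i => s' (S (S (S i))))))).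
    { pose (f := fun n => match n with 0 => 2 | 1 => 0 | 2 => 1 | S i => S i end).
      eapply ud_ext; [|exact (ud_ren _ f (ud_lball m))]. intros s1 Z _. cbv beta. unfold f at 1 2.
      match goal with |- lball _ _ _ ?a <-> lball _ _ _ ?b => replace a with b; [tauto|] end.
      apply functional_extensionality; intros [|i]; reflexivity. }
    eapply ud_ext; [|apply (ud_tail 3 s _ H)].
    + intros s' Z _. cbv beta. simpl Nat.ltb. cbv iota.
      match goal with |- lball _ _ _ ?a <-> lball _ _ _ ?b => replace a with b; [tauto|] end.
      apply functional_extensionality; intros [|i]; simpl; auto. now rewrite Nat.sub_0_r.
    + intros i. apply (constructible_N (Y:=Y)), Hs.
  - intros x d1 d2 Hx H1 H2 Hsub H. eapply lball_imp; [..|exact H].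
    + apply scons_all; auto. exact (lev_constructible (Y:=Y) _ _ Hd Hx).
    + intros s' Hs' HQ. eapply Hm; [..|exact HQ]; auto.
  - intros x Hx. apply IH. apply scons_all; auto. exact (lev_constructible (Y:=Y) _ _ Hd Hx).
  - exists t; split; auto. intros x Hx. apply H. now apply inL_lev.
Qed.

Lemma fin_lev l n (s : nat -> W) : on l -> (forall d, d ∊ l -> suc d ∊ l) -> empty ∊ l ->
  (forall i, i < n -> s i ∊ lev l) -> exists d, d ∊ l /\ forall i, i < n -> inL d (s i).
Proof.
  intros Hl Hlim He. induction n as [|n IH]; intros Hs.
  - exists empty; split; auto. lia.
  - destruct IH as (d & Hd & H); [auto|].
    assert (Hn := Hs n (Nat.lt_succ_diag_r n)). apply inL_lev in Hn as (e & Hel & HG); auto.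
    assert (Hde : exists c, c ∊ l /\ subW d c /\ subW (suc e) c).
    { assert (Hse : suc e ∊ l) by auto. assert (H0 : on d) by oin. assert (H3 : on (suc e)) by oin.
      destruct (ord_cmp d (suc e)) as [K1|[K1|K1]]; try apply H0; try apply H3.
      - exists (suc e); repeat split; auto; intros z Hz; auto. eapply (proj1 (proj1 H3)); eauto.
      - exists (suc e); subst; repeat split; auto; intros z Hz; auto.
      - exists d; repeat split; auto; intros z Hz; auto. eapply (proj1 (proj1 H0)); eauto. }
    destruct Hde as (c & Hc & H1 & H2). exists c; split; auto. intros i Hi.
    assert (i = n \/ i < n) as [->|?] by lia.
    + exists e; split; auto. apply H2, in_suc; auto.
    + apply (inL_mono d c); auto.
Qed.

(** [iter_close] is applied to the relation that t bounds Q on all n-tuples from level d. As l is a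
    limit, finitely many elements of its level already lie in the level of some d below l. The slots
    from n on are padded with the empty set. *)
Lemma close n d0 : on d0 -> exists l, on l /\ d0 ∊ l /\
  forall s, (forall i, i < n -> s i ∊ lev l) -> (forall i, n <= i -> s i = empty) -> Q s l.
Proof.
  intros H0.
  destruct (iter_close (fun d t => lball n d (fun e => Q e t) (fun _ => empty)) d0) as (l & Hl & Hdl & Hlim & HP); auto.
  - assert (H : ud (fun s' Z => lball n (s' 0) (fun e => Q e (s' 1)) (fun i => s' (S (S i))))).
    { exact (ud_ren _ (fun n => match n with 0 => 1 | 1 => 0 | i => i end) (ud_lball n)). }
    eapply ud_ext; [|apply (ud_tail 2 (fun _ => empty) _ H)].
    + intros s Z _. cbv beta. simpl Nat.ltb. cbv iota. tauto.
    + intros _. apply Uempty.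
  - intros x d d' _ Hd Hd' Hs. apply lball_imp.
    + intros _; apply K_empty.
    + intros s Hks HQ. eapply Hm; [..|exact HQ]; auto.
  - intros x x' d _ _ _. apply lball_anti.
  - intros x Hx. apply lball_total; auto. intros _; apply K_empty.
  - exists l; split; auto. split; auto. intros s Hs1 Hs2.
    destruct (fin_lev l n s) as (d & Hd & Hin); auto.
    { destruct (ord_cmp empty l) as [K1|[K1|K1]]; auto; [apply ord_empty|apply Hl|subst|];
      exfalso; eapply in_empty; eauto. }
    apply (lball_elim n d (fun e => Q e l) (fun _ => empty)); auto.
    intros i. apply Hs2. lia.
Qed.
End Close.

(** The universal quantifier over operations is a negated finite disjunction, the shape that
    [ud_finex] makes definable. *)
Definition opc (a b t : W) : Prop := ~ exists i, i < nops /\ ~ exists z, N z /\ z = op i a b /\ inL t z.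
Definition trc (a t : W) : Prop := forall z, z ∊ a -> inL t z.

Record goodlev (l : W) : Prop := {
  gl_on : on l;
  gl_K : K (lev l);
  gl_op : forall i a b, i < nops -> a ∊ lev l -> b ∊ lev l -> op i a b ∊ lev l;
  gl_tr : forall x y, x ∊ y -> y ∊ lev l -> x ∊ lev l }.

Lemma good_level (Q : (nat -> W) -> W -> Prop) n d0 :
  ud (fun s Z => Q (fun i => s (S i)) (s 0)) ->
  (forall s d d', (forall i, K (s i)) -> on d -> on d' -> subW d d' -> Q s d -> Q s d') ->
  (forall s, (forall i, K (s i)) -> exists d, on d /\ Q s d) ->
  on d0 -> exists l, d0 ∊ l /\ goodlev l /\
  forall s, (forall i, i < n -> s i ∊ lev l) -> (forall i, n <= i -> s i = empty) -> Q s l.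
Proof.
  intros HD Hm Ht H0.
  (* Two slots in front of those of Q close the level under the operations and under elements. *)
  set (Q' := fun (s : nat -> W) t => (opc (s 0) (s 1) t /\ trc (s 0) t) /\ Q (fun i => s (S (S i))) t).
  destruct (close Q') with (n := S (S n)) (d0 := d0) as (l & Hl & Hdl & HQ); auto.
  - unfold Q'. apply ud_and.
    + unfold opc, trc. apply ud_and.
      * apply ud_not. apply ud_finex; intros i _. apply ud_not. apply ud_ex. apply ud_and; [apply ud_op|apply ud_inL].
      * apply ud_ball. apply ud_inL.
    + exact (ud_ren _ (fun n => match n with 0 => 0 | S i => S (S (S i)) end) HD).
  - intros s d d' Hs Hd Hd' Hsub [[H1 H2] H3]. repeat split.
    + intros (i & Hi & H). apply H1. exists i; split; auto. intros (z & Hz & E & HL). apply H.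
      exists z; split; auto; split; auto. eapply inL_mono; eauto.
    + intros z Hz. eapply inL_mono; eauto.
    + eapply Hm; [..|exact H3]; auto.
  - intros s Hs.
    destruct (fin_max (fun i t => inL t (op i (s 0) (s 1))) nops) as (d1 & Hd1 & K1).
    { intros i d d' _ _ _ Hsub. now apply inL_mono. }
    { intros i Hi. destruct (constructible_lev (op i (s 0) (s 1))) as (d & Hd & Hin); [now apply (constructible_op (Y:=Y))|].
      exists d; split; auto. now apply inL_lev. }
    destruct (collect (fun z t => inL t z) (s 0)) as (d2 & Hd2 & K2).
    { apply (constructible_N (Y:=Y)), Hs. }
    { apply ud_inL. }
    { intros x d d' _ _ _. apply inL_mono. }
    { intros x Hx. destruct (constructible_lev x) as (d & Hd & Hin); [eapply (constructible_tr (Y:=Y)); eauto|].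
      exists d; split; auto. now apply inL_lev. }
    destruct (Ht (fun i => s (S (S i)))) as (d3 & Hd3 & K3); auto.
    destruct (oN_max (N:=N) d1 d2) as (d4 & Hd4 & L1 & L2); auto.
    destruct (oN_max (N:=N) d4 d3) as (d5 & Hd5 & L3 & L4); auto.
    exists d5; split; auto. repeat split.
    + intros (i & Hi & H). apply H. exists (op i (s 0) (s 1)); split; [apply (Nop (Y:=Y)); apply (constructible_N (Y:=Y)); auto|].
      split; auto. apply (inL_mono d1); auto. intros z Hz; auto.
    + intros z Hz. apply (inL_mono d2); auto. intros w Hw; auto.
    + apply (Hm _ d3); auto.
  - assert (Hb : B d0 ∊ lev l) by (apply in_image; eauto).
    assert (Hop : forall i a b, i < nops -> a ∊ lev l -> b ∊ lev l -> op i a b ∊ lev l).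
    { intros i a b Hi Ha Hb'.
      destruct (HQ (fun i => if Nat.ltb i (S (S n)) then (if Nat.eqb i 1 then b else a) else empty)) as [[H _] _].
      - intros j Hj. destruct (Nat.ltb_spec j (S (S n))); [|lia]. destruct (Nat.eqb j 1); auto.
      - intros j Hj. destruct (Nat.ltb_spec j (S (S n))); [lia|auto].
      - simpl in H. apply NNPP; intros Hn. apply H. exists i; split; auto.
        intros (z & _ & -> & HL). apply Hn. now apply inL_lev. }
    exists l; split; auto. split.
    + split; auto.
      (* The level is closed under the operations, so no triple is new at l; the enumeration takes
         its second alternative and B l is the level itself. *)
      * exists l; split; auto. destruct (B_nxt l (proj1 Hl)) as [(b & c & i & (H1 & H2 & H3 & H4) & _)|[_ E]]; [|auto].
        exfalso. assert (Hc : c ∊ l) by (eapply ord_le_trans; eauto; apply Hl).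
        assert (Hin : op i (B b) (B c) ∊ lev l) by (apply Hop; auto; apply in_image; eauto).
        apply in_image in Hin as (e & He & E). apply H4; eauto.
      * intros x y Hx Hy.
        destruct (HQ (fun i => if Nat.ltb i (S (S n)) then y else empty)) as [[_ H] _].
        -- intros j Hj. destruct (Nat.ltb_spec j (S (S n))); [auto|lia].
        -- intros j Hj. destruct (Nat.ltb_spec j (S (S n))); [lia|auto].
        -- apply inL_lev; auto.
    + intros s Hs1 Hs2. apply (HQ (scons (B d0) (scons (B d0) s))).
      * intros [|[|i]] Hi; simpl; auto. apply Hs1; lia.
      * intros [|[|i]] Hi; simpl; try lia. apply Hs2; lia.
Qed.

Lemma fin_on (n : nat) (s : nat -> W) : (forall i, K (s i)) ->
  exists d, on d /\ forall i, i < n -> s i ∊ lev d.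
Proof.
  intros Hs. destruct (fin_max (fun i d => s i ∊ lev d) n) as (d & Hd & H); eauto.
  - intros i d d' _ _ _ Hsub. apply lev_mono; auto.
  - intros i _. apply constructible_lev; auto.
Qed.

(** * Reflection *)

(** The Tarski-Vaught criterion: level t holds a counterexample to each universal subformula failing
    at s over K. Subformulas are read at the same s; this suffices because [reflect] asks for the
    criterion at all environments from the level, including those extended by quantifiers. *)
Fixpoint wit (p : form) (s : nat -> W) (C : nat -> W -> Prop) (t : W) : Prop :=
  match p with
  | fIn _ _ | fEq _ _ | fCls _ _ => True
  | fNot q => wit q s C t
  | fAnd q r => wit q s C t /\ wit r s C t
  | fAll q => wit q s C t /\
      (~ satW K (fAll q) s C -> exists x, N x /\ inL t x /\ ~ satW K q (scons x s) C)
  end.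
Lemma wit_mono p s C d d' : subW d d' -> wit p s C d -> wit p s C d'.
Proof.
  intros Hs. induction p; simpl; try tauto. intros [H1 H2]; split; auto.
  intros Hn. destruct (H2 Hn) as (x & Hx & HL & Hx'). exists x; split; auto. split; auto. eapply inL_mono; eauto.
Qed.

Lemma wit_total p s C : exists d, on d /\ wit p s C d.
Proof.
  induction p as [i j|i j|i k|q IH|q (d & Hd & IH) r (d' & Hd' & IH')|q (d & Hd & IH)]; simpl;
    try (exists empty; split; [apply on_empty|exact I]); auto.
  - destruct (oN_max (N:=N) d d') as (e & He & H1 & H2); auto. exists e; split; auto.
    split; [apply (wit_mono _ _ _ d)|apply (wit_mono _ _ _ d')]; auto.
  - destruct (classic (forall x, K x -> satW K q (scons x s) C)) as [Ha|Ha].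
    + exists d; split; auto. split; auto. tauto.
    + assert (Hx : exists x, K x /\ ~ satW K q (scons x s) C).
      { apply NNPP; intros Hn. apply Ha. intros x Hx. apply NNPP; intros Hq. apply Hn; eauto. }
      destruct Hx as (x & Hx & Hq). destruct (constructible_lev x Hx) as (d' & Hd' & HL).
      destruct (oN_max (N:=N) d d') as (e & He & H1 & H2); auto. exists e; split; auto. split.
      * apply (wit_mono _ _ _ d); auto.
      * intros _. exists x; split; [now apply (constructible_N (Y:=Y))|]. split; auto. apply (inL_mono d'); auto. now apply inL_lev.
Qed.

Lemma ud_satK p (C : W -> nat -> W -> Prop) f g :
  (forall k, ud (fun s Z => C (s 0) k (s 1))) ->
  ud (fun s Z => satW K p (fun i => s (f i)) (C (s g))).
Proof.
  intros HC. apply (ud_sat p (fun _ => K) (fun s Z => C (s g)) f).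
  - intros s x _. apply (constructible_N (Y:=Y)).
  - apply ud_cls, (Y_constructible (Y:=Y)).
  - intros k _. exact (ud_ren _ (fun n => match n with 0 => S g | _ => 0 end) (HC k)).
Qed.

Lemma ud_wit p (C : W -> nat -> W -> Prop) :
  (forall k, ud (fun s Z => C (s 0) k (s 1))) ->
  ud (fun s Z => wit p (fun i => s (S (S i))) (C (s 1)) (s 0)).
Proof.
  intros HC. induction p; cbn [wit]; try apply ud_const; auto.
  - apply ud_and; auto.
  - apply ud_and; auto. apply ud_imp; [apply ud_not, (ud_satK (fAll p)); auto|].
    apply ud_ex. apply ud_and; [apply ud_inL|]. apply ud_not.
    eapply ud_ext; [|exact (ud_satK p C (fun i => match i with 0 => 0 | S i => S (S (S i)) end) 2 HC)].
    intros s Z _. cbv beta.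
    match goal with |- satW _ _ ?a _ <-> satW _ _ ?b _ => replace a with b; [tauto|] end.
    apply functional_extensionality; intros [|i]; reflexivity.
Qed.

(** A level meeting the criterion [wit] is found by [good_level]. The interpretation [C r] of the
    class variables moves with a point r of the level, as recursion clauses need, where a class
    variable stands for the solution below r. *)
Lemma reflect p (C : W -> nat -> W -> Prop) n d0 : abnd n p ->
  (forall k, ud (fun s Z => C (s 0) k (s 1))) -> on d0 ->
  exists l, d0 ∊ l /\ goodlev l /\
    forall r s, r ∊ lev l -> (forall i, i < n -> s i ∊ lev l) ->
      (satW (fun x => x ∊ lev l) p s (C r) <-> satW K p s (C r)).
Proof.
  intros Hn HC H0.
  destruct (good_level (fun s t => wit p (fun i => s (S i)) (C (s 0)) t) (S n) d0) as (l & Hdl & Hgl & HQ); auto.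
  - now apply ud_wit.
  - intros s d d' _ _ _. apply wit_mono.
  - intros s _. apply wit_total.
  - exists l; split; auto. split; auto. intros r s Hr Hs.
    assert (Hw : forall s, (forall i, i < n -> s i ∊ lev l) -> (forall i, n <= i -> s i = empty) -> wit p s (C r) l).
    { intros s' H1 H2. apply (HQ (scons r s')).
      - intros [|i] Hi; simpl; auto. apply H1; lia.
      - intros [|i] Hi; simpl; [lia|]. apply H2; lia. }
    clear HQ HC. pose proof (gl_on _ Hgl) as Hl.
    revert s Hs; induction p as [i j|i j|i k|q IH|q IH r' IH'|q IH]; simpl; intros s Hs.
    + tauto.
    + tauto.
    + tauto.
    + rewrite IH; auto. tauto.
    + simpl in Hn. destruct Hn as [Hn1 Hn2]. rewrite IH, IH'; auto; try tauto; intros s' ? ?; now apply (Hw s').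
    + assert (IHs : forall x, x ∊ lev l -> (satW (fun x => x ∊ lev l) q (scons x s) (C r) <-> satW K q (scons x s) (C r))).
      { intros x Hx. apply IH; auto.
        - intros s' H1 H2; now apply (Hw s').
        - intros [|i] Hi; simpl; auto. apply Hs; lia. }
      split; intros H.
      * apply NNPP; intros Hc.
        (* The criterion is known only for environments padded with the empty set; the formula reads
           no slot that this changes. *)
        set (s' := fun i => if Nat.ltb i n then s i else empty).
        assert (Hss : forall x, satW K q (scons x s) (C r) <-> satW K q (scons x s') (C r)).
        { intros x. apply satW_ext with (S n); [apply abnd_bnd, (abnd_mono _ n); auto| |tauto].
          intros [|i] Hi; simpl; auto. unfold s'. destruct (Nat.ltb_spec i n); [auto|lia]. }
        destruct (Hw s') as [_ Hw'].
        -- intros i Hi. unfold s'. destruct (Nat.ltb_spec i n); [auto|lia].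
        -- intros i Hi. unfold s'. destruct (Nat.ltb_spec i n); [lia|auto].
        -- destruct Hw' as (x & _ & HL & Hx).
           ++ intros Ha. apply Hc. intros x Hx. apply Hss. now apply Ha.
           ++ apply inL_lev in HL; auto. apply Hx, Hss, IHs; auto.
      * intros x Hx. apply IHs; auto. apply H. eapply (lev_constructible (Y:=Y)); eauto.
Qed.
End Closing.

Fixpoint enc (n : nat) (s : nat -> W) : W :=
  match n with 0 => empty | S m => opair (s 0) (enc m (fun i => s (S i))) end.
Lemma enc_inj n : forall s s', enc n s = enc n s' -> forall i, i < n -> s i = s' i.
Proof.
  induction n as [|n IH]; simpl; intros s s' E i Hi; [lia|].
  apply opair_inj in E as [E0 E]. destruct i as [|i]; auto.
  apply (IH _ _ E i). lia.
Qed.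

(** * Definable subsets of a set are obtained by the operations *)

Section Goedel.
Variable K : W -> Prop.
Hypothesis Kop : forall i a b, i < 11 -> K a -> K b -> K (op0 i a b).
Hypothesis Kempty : K empty.
Variable u : W.
Hypothesis Ku : K u.
Variable C : nat -> W -> Prop.
Hypothesis KC : forall k, K (sep u (C k)).

(** Truth sets in n free variables over u. Each logical step below amounts to finitely many
    operations, so the truth sets remain in K. *)
Definition codes (X : W) (n : nat) (R : (nat -> W) -> Prop) : Prop :=
  K X /\ forall e, e ∊ X <-> exists s, (forall i, i < n -> s i ∊ u) /\ e = enc n s /\ R s.
Definition inv (n : nat) (R : (nat -> W) -> Prop) : Prop :=
  forall s s', (forall i, i < n -> s i = s' i) -> R s -> R s'.
Lemma codes_enc X n R s : codes X n R -> inv n R -> (forall i, i < n -> s i ∊ u) -> (enc n s ∊ X <-> R s).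
Proof.
  intros [_ H] HI Hs. rewrite H. split.
  - intros (s' & _ & E & HR). apply (HI s'); auto. symmetry. eapply enc_inj; eauto.
  - intros HR; eauto.
Qed.

Lemma codes_iff X n R R' : (forall s, (forall i, i < n -> s i ∊ u) -> (R s <-> R' s)) -> codes X n R -> codes X n R'.
Proof.
  intros HR [HX H]; split; auto. intros e. rewrite H.
  split; intros (s & Hs & E & HRs); exists s; split; auto; split; auto; now apply HR.
Qed.

Lemma codes_prod a X n (P : W -> Prop) R : K a -> (forall x, x ∊ a <-> x ∊ u /\ P x) -> codes X n R ->
  codes (prodW a X) (S n) (fun s => P (s 0) /\ R (fun i => s (S i))).
Proof.
  intros Ha HaP [HX H]; split; [now apply (Kop 3); [lia|..]|].
  intros e. rewrite in_prodW. split.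
  - intros (x & t & -> & Hx & Hy). apply H in Hy as (s & Hs & -> & HR). apply HaP in Hx as [Hx HP].
    exists (scons x s). split; [|simpl; auto]. intros [|i] Hi; simpl; auto. apply Hs; lia.
  - intros (s & Hs & -> & HP & HR). exists (s 0), (enc n (fun i => s (S i))). split; auto.
    split; [apply HaP; split; auto; apply Hs; lia|]. apply H. eexists; split; [|eauto].
    intros i Hi. apply Hs; lia.
Qed.

Lemma codes_produ X n R : codes X n R -> codes (prodW u X) (S n) (fun s => R (fun i => s (S i))).
Proof.
  intros H. eapply codes_iff; [|apply (codes_prod u X n (fun _ => True) R)]; auto.
  - intros s _; simpl; tauto.
  - intros x; tauto.
Qed.

Lemma codes_all_env n : exists X, codes X n (fun _ => True).
Proof.
  induction n as [|n [X IH]].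
  - exists (upair empty empty). split; [now apply (Kop 0); [lia|..]|].
    intros e; rewrite in_upair; simpl. split.
    + intros He. exists (fun _ => empty). split; [lia|]. split; tauto.
    + intros (s & _ & -> & _); auto.
  - exists (prodW u X). now apply (codes_produ X n (fun _ => True)).
Qed.

Lemma codes_neg X n R : codes X n R -> inv n R -> exists X', codes X' n (fun s => ~ R s).
Proof.
  intros HX HI. destruct (codes_all_env n) as [E HE]. exists (op0 2 E X).
  split; [apply Kop; [lia|apply HE|apply HX]|]. intros e. cbn [op0]. rewrite in_sep. split.
  - intros [He Hn]. apply HE in He as (s & Hs & -> & _). exists s. split; auto. split; auto.
    intros HR. apply Hn, (codes_enc X n R); auto.
  - intros (s & Hs & -> & HR). split; [apply HE; eauto|]. intros Hin. apply HR.
    apply (codes_enc X n R) in Hin; auto.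
Qed.

Lemma codes_and X X' n R R' : codes X n R -> codes X' n R' -> inv n R' -> exists Z, codes Z n (fun s => R s /\ R' s).
Proof.
  intros HX HX' HI. exists (op0 2 X (op0 2 X X')).
  split; [apply Kop; [lia|apply HX|apply Kop; [lia|apply HX|apply HX']]|].
  intros e. cbn [op0]. rewrite !in_sep. split.
  - intros [He Hn]. assert (He' : e ∊ X') by (apply NNPP; intros K'; tauto).
    apply HX in He as (s & Hs & -> & HR). exists s; repeat split; auto.
    apply (codes_enc X' n R') in He'; auto.
  - intros (s & Hs & -> & HR & HR'). split; [apply HX; eauto|]. intros [_ Hn]. apply Hn. apply HX'; eauto.
Qed.

Lemma codes_ex X n R : codes X (S n) R -> exists X', codes X' n (fun s => exists x, x ∊ u /\ R (scons x s)).
Proof.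
  intros HX. exists (op0 4 X X). split; [apply Kop; [lia|apply HX|apply HX]|].
  intros e. cbn [op0]. unfold ranW. rewrite in_sep. split.
  - intros (_ & x & _ & Hx). apply HX in Hx as (s & Hs & E & HR). simpl in E. apply opair_inj in E as [-> ->].
    exists (fun i => s (S i)). split; [intros i Hi; apply Hs; lia|]. split; auto.
    exists (s 0). split; [apply Hs; lia|]. now rewrite scons_eta.
  - intros (s & Hs & -> & x & Hx & HR).
    assert (Hin : opair x (enc n s) ∊ X).
    { apply HX. exists (scons x s). split; [|simpl; auto]. intros [|i] Hi; simpl; auto. apply Hs; lia. }
    split; [eapply UU_r; eauto|]. exists x; split; auto. eapply UU_l; eauto.
Qed.

Lemma codes_forall X n R : codes X (S n) R -> inv (S n) R ->
  exists X', codes X' n (fun s => forall x, x ∊ u -> R (scons x s)).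
Proof.
  intros HX HI. destruct (codes_neg X (S n) R HX HI) as [X1 H1].
  destruct (codes_ex X1 n _ H1) as [X2 H2].
  destruct (codes_neg X2 n _ H2) as [X3 H3].
  - intros s s' Hs (x & Hx & HR). exists x; split; auto. intros HR'. apply HR. apply (HI (scons x s')); auto.
    intros [|i] Hi; simpl; auto. symmetry; apply Hs; lia.
  - exists X3. eapply codes_iff; [|exact H3]. intros s Hs; split.
    + intros Hn x Hx. apply NNPP; intros HR. apply Hn; eauto.
    + intros Ha (x & Hx & HR). auto.
Qed.

Section Atom.
Variable rho : W -> W -> Prop.
Hypothesis Krho : forall a, K a -> K (selW rho a).
Lemma codes_sel n : exists X, codes X (S (S n)) (fun s => rho (s 0) (s 1)).
Proof.
  destruct (codes_all_env (S (S n))) as [E HE]. exists (selW rho E). split; [apply Krho, HE|].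
  intros e. unfold selW. rewrite in_sep. split.
  - intros (He & x & t & -> & y & e' & -> & Hr). apply HE in He as (s & Hs & E' & _).
    exists s; split; auto. split; auto. simpl in E'. apply opair_inj in E' as [-> E'].
    apply opair_inj in E' as [-> _]. auto.
  - intros (s & Hs & -> & Hr). split; [apply HE; eauto|]. simpl. eauto 8.
Qed.

(** Selection compares entries 0 and 1; inserting an entry after the first moves the second variable
    up by one. Products with u then shift both variables in [codes_atom]. *)
Lemma codes_atom0 j : forall n, S j < n -> exists X, codes X n (fun s => rho (s 0) (s (S j))).
Proof.
  induction j as [|j IH]; intros n Hn.
  - destruct n as [|[|n]]; try lia. apply codes_sel.
  - destruct n as [|[|n]]; try lia. destruct (IH (S n)) as [X HX]; [lia|].
    destruct (codes_all_env (S (S n))) as [E HE]. exists (op0 8 E X).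
    split; [apply Kop; [lia|apply HE|apply HX]|].
    assert (HI : inv (S n) (fun s => rho (s 0) (s (S j)))).
    { intros s s' Hs. rewrite !Hs by lia. auto. }
    intros e. cbn [op0]. unfold insW. rewrite in_sep. split.
    + intros (He & x & t & -> & y & e' & -> & Hr). apply HE in He as (s & Hs & E' & _).
      exists s; split; auto. split; auto. simpl in E'. apply opair_inj in E' as [-> E'].
      apply opair_inj in E' as [-> ->].
      change (opair (s 0) (enc n (fun i => s (S (S i))))) with (enc (S n) (scons (s 0) (fun i => s (S (S i))))) in Hr.
      apply (codes_enc X _ _ _ HX HI) in Hr; auto.
      intros [|i] Hi; simpl; apply Hs; lia.
    + intros (s & Hs & -> & Hr). split; [apply HE; eauto|]. simpl.
      do 2 eexists; split; [reflexivity|]. do 2 eexists; split; [reflexivity|].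
      change (opair (s 0) (enc n (fun i => s (S (S i))))) with (enc (S n) (scons (s 0) (fun i => s (S (S i))))).
      apply (codes_enc X _ _ _ HX HI); auto. intros [|i] Hi; simpl; apply Hs; lia.
Qed.

Lemma codes_atom i : forall j n, i < j -> j < n -> exists X, codes X n (fun s => rho (s i) (s j)).
Proof.
  induction i as [|i IH]; intros [|j] [|n] Hij Hjn; try lia.
  - now apply codes_atom0.
  - destruct (IH j n) as [X HX]; try lia. exists (prodW u X). exact (codes_produ _ _ _ HX).
Qed.
End Atom.

Lemma codes_sat p : forall n, bnd n p -> exists X, codes X n (fun s => satW (fun x => x ∊ u) p s C).
Proof.
  assert (HI : forall p n, bnd n p -> inv n (fun s => satW (fun x => x ∊ u) p s C)).
  { intros q n Hq s s' Hs. apply (proj1 (satW_ext q n _ s s' C C Hq Hs (fun k x _ _ => iff_refl _))). }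
  induction p as [i j|i j|i k|q IH|q IH r IH'|q IH]; cbn [bnd satW]; intros n Hn.
  (* [codes_atom] takes its variables in increasing order, so the converse of membership has an
     operation of its own; the case of equal variables is settled by irreflexivity. *)
  - destruct (Nat.lt_trichotomy i j) as [H|[->|H]].
    + apply (codes_atom inW); try lia. intros a Ha. apply (Kop 5 a a); auto; lia.
    + destruct (codes_all_env n) as [E HE]. destruct (codes_neg E n _ HE) as [X HX]; [intros s s' _; auto|].
      exists X. eapply codes_iff; [|exact HX]. intros s _. simpl. split; [tauto|]. intros Hin; destruct (in_irrefl _ Hin).
    + apply (codes_atom (fun x y => y ∊ x)); try lia. intros a Ha. apply (Kop 6 a a); auto; lia.
  - destruct (Nat.lt_trichotomy i j) as [H|[->|H]].
    + apply (codes_atom eq); try lia. intros a Ha. apply (Kop 7 a a); auto; lia.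
    + destruct (codes_all_env n) as [E HE]. exists E. eapply codes_iff; [|exact HE]. intros; tauto.
    + destruct (codes_atom eq) with (i := j) (j := i) (n := n) as [X HX]; try lia.
      * intros a Ha. apply (Kop 7 a a); auto; lia.
      * exists X. eapply codes_iff; [|exact HX]. intros s _; split; auto.
  - revert n Hn. induction i as [|i IH]; intros [|n] Hn; try lia.
    + destruct (codes_all_env n) as [E HE]. exists (prodW (sep u (C k)) E).
      eapply codes_iff; [|apply (codes_prod _ _ n (C k) (fun _ => True) (KC k)); [|exact HE]].
      * intros s _; simpl; tauto.
      * intros x; apply in_sep.
    + destruct (IH n) as [X HX]; [lia|]. exists (prodW u X). exact (codes_produ _ _ _ HX).
  - destruct (IH n Hn) as [X HX]. eapply codes_neg; [exact HX|]. now apply HI.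
  - destruct Hn as [Hq Hr]. destruct (IH n Hq) as [X HX], (IH' n Hr) as [X' HX'].
    eapply codes_and; [exact HX|exact HX'|]. now apply HI.
  - destruct (IH (S n) Hn) as [X HX]. destruct (codes_forall X n _ HX) as [X' HX']; eauto.
Qed.
End Goedel.

(** * Amenable classes *)

Section Amenable.
Context {N : W -> Prop} {Y : (W -> Prop) -> Prop} {M : Model N Y}.
Notation ud := (udef N Y).
Notation K := (@constructible N).
Notation on := (@oN N).

Definition amenable (A : W -> Prop) : Prop :=
  Y A /\ (forall x, A x -> K x) /\ forall a, K a -> K (sep a A).

Lemma K_enc n : forall s, (forall i, K (s i)) -> K (enc n s).
Proof.
  induction n as [|n IH]; intros s Hs; simpl; [apply (K_empty (Y:=Y))|].
  assert (HP : forall a b, K a -> K b -> K (upair a b))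
    by (intros a b Ha Hb; now apply (constructible_op0 (Y:=Y) 0); [lia|..]).
  apply HP; apply HP; auto.
Qed.

Lemma amenable_comp p s C : (forall i, K (s i)) -> (forall k, amenable (C k)) ->
  amenable (fun x => K x /\ satW K p (scons x s) C).
Proof.
  intros Hs HC. split; [|split].
  - destruct (Minh _ _ M) as [A0 HA0].
    assert (HD : ud (fun s Z => K (s 0) /\ satW K p (fun i => s i) C)).
    { apply ud_and; [apply ud_cls, (Y_constructible (Y:=Y))|].
      apply (ud_satK p (fun _ => C) (fun i => i) 0). intros k. apply ud_cls. apply HC. }
    replace (fun x => K x /\ satW K p (scons x s) C) with
      (fun x => N x /\ (K (scons x s 0) /\ satW K p (fun i => scons x s i) C)).
    + apply (ucomp _ s A0 HD); auto. intros i; apply (constructible_N (Y:=Y)); auto.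
    + apply pred_ext; intros x. simpl. split; [tauto|]. intros [H1 H2]; split; auto. now apply (constructible_N (Y:=Y)).
  - tauto.
  - intros a Ha. destruct (abnd_ex p) as [n0 Hn0].
    (* Room for the element x in slot 0 and n0 parameters from s after it. *)
    assert (Hn : abnd (S n0) p) by (apply (abnd_mono _ n0); auto).
    destruct (fin_on (Y:=Y) (S n0) (scons a s)) as (d0 & Hd0 & Hin); [apply scons_all; auto|].
    destruct (reflect (Y:=Y) p (fun _ => C) (S n0) d0) as (l & Hdl & Hgl & Hrefl); auto.
    { intros k. apply ud_cls. apply HC. }
    pose proof (gl_on _ Hgl) as Hl.
    assert (Hsub : subW (lev d0) (lev l)).
    { apply lev_mono. intros z Hz. eapply (proj1 (proj1 Hl)); eauto. }
    set (u := lev l) in *.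
    assert (Hau : forall x, x ∊ a -> x ∊ u).
    { intros x Hx. apply (gl_tr _ Hgl x a); auto. apply Hsub. apply (Hin 0). lia. }
    assert (Hsu : forall i, i < n0 -> s i ∊ u) by (intros i Hi; apply Hsub; apply (Hin (S i)); lia).
    destruct (codes_sat K) with (u := u) (C := C) (p := p) (n := S n0) as [X HX].
    { intros i b c; apply (constructible_op0 (Y:=Y)). }
    { apply (K_empty (Y:=Y)). }
    { apply Hgl. }
    { intros k. apply HC. apply Hgl. }
    { now apply abnd_bnd. }
    assert (HI : inv (S n0) (fun s => satW (fun x => x ∊ u) p s C)).
    { intros s1 s2 Hs12.
      apply (proj1 (satW_ext p (S n0) _ s1 s2 C C (abnd_bnd _ _ Hn) Hs12 (fun k x _ _ => iff_refl _))). }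
    assert (Hx : forall x, x ∊ u -> (opair x (enc n0 s) ∊ X <-> satW K p (scons x s) C)).
    { intros x Hx. change (opair x (enc n0 s)) with (enc (S n0) (scons x s)).
      assert (Hsx : forall i, i < S n0 -> scons x s i ∊ u) by (intros [|i] Hi; simpl; auto; apply Hsu; lia).
      rewrite (codes_enc K u X (S n0) _ _ HX HI) by auto. apply (Hrefl x); auto. }
    (* The intersection of a with the section of X at the coded parameters, written with two
       differences. *)
    replace (sep a (fun x => K x /\ satW K p (scons x s) C)) with (op0 2 a (op0 2 a (op0 9 X (enc n0 s)))).
    + apply (constructible_op0 (Y:=Y)); [lia|auto|]. apply (constructible_op0 (Y:=Y)); [lia|auto|].
      apply (constructible_op0 (Y:=Y)); [lia|apply HX|]. now apply K_enc.
    + apply ext; intros x. cbn [op0]. unfold secW. rewrite !in_sep. split.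
      * intros [Hxa Hn']. assert (Hx' : opair x (enc n0 s) ∊ X) by (apply NNPP; intros K'; apply Hn'; tauto).
        split; auto. split; [eapply (constructible_tr (Y:=Y)); eauto|]. apply Hx; auto.
      * intros [Hxa [HKx Hp]]. split; auto. intros [_ Hn']. apply Hn'. apply Hx in Hp; auto.
        split; auto. eapply UU_l; eauto.
Qed.

(** From here on the definability lemmas apply over K with amenable classes as parameters, although
    recursion over K is still open. *)
#[global] Instance Univ_amenable : Univ K amenable.
Proof.
  constructor.
  - apply (constructible_tr (Y:=Y)).
  - intros a b Ha Hb. now apply (constructible_op0 (Y:=Y) 0); [lia|..].
  - apply (K_empty (Y:=Y)).
  - intros A x (_ & H & _); auto.
  - intros; now apply amenable_comp.
  - exists (fun x => x ∊ empty). split; [apply Yset, Uempty|]. split.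
    + intros x Hx; destruct (in_empty _ Hx).
    + intros a _. replace (sep a (fun x => x ∊ empty)) with empty; [apply (K_empty (Y:=Y))|].
      apply ext; intros z; rewrite in_sep. split; [intros Hz; destruct (in_empty _ Hz)|tauto].
  - intros A a HA Ha; now apply HA.
Qed.
End Amenable.

(** * The least family of classes *)

Definition recPhi (K : W -> Prop) (p : form) (A : W -> Prop) (x : W) (Z : W -> Prop) : Prop :=
  satW K p (fun _ => x) (scons Z (fun _ => A)).

(** [clo_rec] takes the solution as a premise, which makes this a plain inductive closure; existence
    of solutions is shown in Y by [rec_ex]. [clo_empty] starts the closure, as [clo_ec] asks for a
    class in every parameter slot. *)
Inductive Clo (K : W -> Prop) : (W -> Prop) -> Prop :=
| clo_empty : Clo K (fun _ => False)
| clo_ec p s C : (forall i, K (s i)) -> (forall k, Clo K (C k)) ->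
    Clo K (fun x => K x /\ satW K p (scons x s) C)
| clo_rec p A T S : Clo K A -> Clo K T -> relcls T -> trcls T -> wfcls T ->
    solves K (recPhi K p A) T S -> Clo K S.

Section CloY.
Context {N : W -> Prop} {Y : (W -> Prop) -> Prop} {M : Model N Y}.
Notation ud := (udef N Y).
Variable K : W -> Prop.
Hypothesis HK : Y K.

Lemma KsubN x : K x -> N x.
Proof. intros Hx. eapply Usub; eauto. Qed.

Lemma ud_rec p A i : Y A -> ud (fun s Z => recPhi K p A (s i) Z).
Proof.
  intros HA. apply (ud_sat p (fun _ => K) (fun s Z => scons Z (fun _ => A)) (fun _ => i)).
  - intros s x _. apply KsubN.
  - now apply ud_cls.
  - intros [|k] _; simpl; [apply ud_Z|now apply ud_cls].
Qed.

(** The recursion is run over N with the conjunct K x, which confines the values to K and so turns a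
    solution over N into one over K. *)
Lemma rec_ex p A T : Y A -> Y T -> relcls T -> trcls T -> wfcls T ->
  exists S, Y S /\ solves K (recPhi K p A) T S /\
    solves N (fun x Z => K x /\ recPhi K p A x Z) T S.
Proof.
  intros HA HT H1 H2 H3.
  destruct (etr_udef (fun x Z => K x /\ recPhi K p A x Z) T) as (S & HS & Hs1 & Hs2); auto.
  - apply ud_and; [now apply ud_cls|now apply ud_rec].
  - exists S; split; auto. split; [|split; auto]. split.
    + intros q Hq. destruct (Hs1 q Hq) as (r & x & -> & Hr & Hx). exists r, x. split; auto. split; auto.
      now apply Hs2 in Hq as [? _].
    + intros r x Hr Hx. rewrite Hs2 by (auto using KsubN). tauto.
Qed.

Lemma Clo_Y A : Clo K A -> Y A.
Proof.
  induction 1 as [|p s C Hs HC IH|p A T S HA IHA HT IHT H1 H2 H3 HS].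
  - apply ucompN; [tauto|apply ud_const].
  - destruct (Minh _ _ M) as [A0 HA0].
    assert (HD : ud (fun s Z => K (s 0) /\ satW K p (fun i => s i) C)).
    { apply ud_and; [now apply ud_cls|].
      apply (ud_sat p (fun _ => K) (fun _ _ => C) (fun i => i)).
      - intros ? x _. apply KsubN.
      - now apply ud_cls.
      - intros k _. now apply ud_cls. }
    replace (fun x => K x /\ satW K p (scons x s) C) with
      (fun x => N x /\ (K (scons x s 0) /\ satW K p (fun i => scons x s i) C)).
    + apply (ucomp _ s A0 HD); auto. intros i; apply KsubN; auto.
    + apply pred_ext; intros x. simpl. split; [tauto|]. intros [K1 K2]; split; auto. now apply KsubN.
  - destruct (rec_ex p A T) as (S' & HS' & Hs & _); auto.
    now rewrite (solves_unique _ _ _ _ _ H3 HS Hs).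
Qed.
End CloY.

(* A recursion along a relation that is well-founded in truth can be carried out below a set
   using separation only: partial solutions are unique, so they define the whole solution. *)
Section SetRecursion.
Context {K : W -> Prop} {Y : (W -> Prop) -> Prop} {U : Univ K Y}.
Notation ud := (udef K Y).
Variables (u : W) (p : form) (T A Sg : W -> Prop).
Hypothesis Ku : K u.
Hypothesis utr : forall x y, x ∊ y -> y ∊ u -> x ∊ u.
Hypothesis upr : forall x y, x ∊ u -> y ∊ u -> opair x y ∊ u.
Hypothesis YT : Y T.
Hypothesis YA : Y A.
Hypothesis Ttr : trcls T.
Hypothesis Twf : wfcls T.
Hypothesis Sfld : forall q, Sg q -> exists r x, q = opair r x /\ fld T r.
Hypothesis Hrec : forall r x, r ∊ u -> x ∊ u -> fld T r ->
  (Sg (opair r x) <-> recPhi (fun x => x ∊ u) p A x (below Sg T r)).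

Lemma u_l x y : opair x y ∊ u -> x ∊ u.
Proof. intros H. apply (utr x (upair x x)); [apply in_upair; auto|]. apply (utr _ _) with (2 := H). apply in_upair; auto. Qed.

Lemma u_r x y : opair x y ∊ u -> y ∊ u.
Proof. intros H. apply (utr y (upair x y)); [apply in_upair; auto|]. apply (utr _ _) with (2 := H). apply in_upair; auto. Qed.

Ltac uu := match goal with
  | H : opair ?x ?y ∊ u |- ?x ∊ u => exact (u_l _ _ H)
  | H : opair ?x ?y ∊ u |- ?y ∊ u => exact (u_r _ _ H)
  end.

Definition leT (r' r : W) : Prop := T (opair r' r) \/ r' = r.
Lemma leT_trans a b c : T (opair a b) -> leT b c -> T (opair a c).
Proof. intros H [H'| ->]; auto. eapply Ttr; eauto. Qed.

Lemma fld_leT a b : leT a b -> fld T b -> fld T a.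
Proof. intros [H| ->]; auto. intros _. exists b; auto. Qed.

Definition partial_sol (g r : W) : Prop :=
  (forall q, q ∊ g -> q ∊ u /\ exists r' x, q = opair r' x /\ leT r' r) /\
  forall r', r' ∊ u -> leT r' r -> forall x, x ∊ u ->
    (opair r' x ∊ g <-> recPhi (fun x => x ∊ u) p A x (below (fun q => q ∊ g) T r')).
(** The part in u of the actual solution at or below r. It turns out to be the only partial solution
    up to r, so quantifying over partial solutions in K speaks about Sg without using Sg as a class
    parameter. *)
Definition gset (r : W) : W := sep u (fun q => Sg q /\ exists r' x, q = opair r' x /\ leT r' r).

Lemma recPhi_ext x Z Z' : x ∊ u -> (forall q, q ∊ u -> (Z q <-> Z' q)) ->
  (recPhi (fun x => x ∊ u) p A x Z <-> recPhi (fun x => x ∊ u) p A x Z').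
Proof.
  intros Hx HZ. unfold recPhi. destruct (bnd_ex p) as [n Hn]. apply satW_ext with n; auto.
  intros [|k] y _ Hy; simpl; [|tauto]. apply HZ. destruct Hy as [Hy|(i & _ & ->)]; auto.
Qed.

Lemma partial_sol_gset r : r ∊ u -> fld T r -> partial_sol (gset r) r.
Proof.
  intros Hr Hf. split.
  - intros q Hq. apply in_sep in Hq as (Hq & _ & H). auto.
  - intros r' Hr' Hle x Hx. assert (Hf' : fld T r') by (eapply fld_leT; eauto).
    transitivity (Sg (opair r' x)).
    + unfold gset. rewrite in_sep. split; [tauto|]. intros HS. split; auto. split; eauto.
    + rewrite Hrec by auto. apply recPhi_ext; auto. intros q Hq. unfold below, gset. rewrite in_sep. split.
      * intros [HS (r2 & x2 & -> & HT)]. split; [|eauto]. split; auto. split; auto.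
        exists r2, x2; split; auto. left. eapply leT_trans; eauto.
      * intros [(_ & HS & _) H]; auto.
Qed.

Lemma partial_sol_unique g r : r ∊ u -> fld T r -> partial_sol g r -> g = gset r.
Proof.
  intros Hr Hf [H1 H2].
  assert (H : forall r', r' ∊ u -> leT r' r -> forall x, x ∊ u -> (opair r' x ∊ g <-> Sg (opair r' x))).
  { intros r'; induction r' as [r' IH] using (well_founded_induction Twf); intros Hr' Hle x Hx.
    rewrite H2, Hrec by (auto; eapply fld_leT; eauto). apply recPhi_ext; auto.
    intros q Hq. unfold below. split.
    - intros [Hg (r2 & x2 & -> & HT)]. split; [|eauto]. apply IH; auto; try uu. left. eapply leT_trans; eauto.
    - intros [Hg (r2 & x2 & -> & HT)]. split; [|eauto]. apply IH; auto; try uu. left. eapply leT_trans; eauto. }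
  apply ext; intros q. unfold gset. rewrite in_sep. split.
  - intros Hq. destruct (H1 q Hq) as (Hu & r' & x & -> & Hle). split; auto. split; [|eauto].
    apply H; auto; try uu.
  - intros (Hu & HS & r' & x & -> & Hle). apply H; auto; try uu.
Qed.

Lemma ud_in_u i : ud (fun s Z => s i ∊ u).
Proof. apply (ud_cls (fun x => x ∊ u)). now apply Yset. Qed.

Lemma ud_leT i j : ud (fun s Z => leT (s i) (s j)).
Proof. unfold leT. ud_auto. Qed.

Lemma ud_recu (Zc : (nat -> W) -> W -> Prop) i : ud (fun s Z => Zc (fun i => s (S i)) (s 0)) ->
  ud (fun s Z => recPhi (fun x => x ∊ u) p A (s i) (Zc s)).
Proof.
  intros HZ. apply (ud_sat p (fun _ x => x ∊ u) (fun s _ => scons (Zc s) (fun _ => A)) (fun _ => i)).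
  - intros s x _ Hx. eapply Utr; eauto.
  - apply ud_in_u.
  - intros [|k] _; simpl; auto. now apply ud_cls.
Qed.

Lemma ud_partial_sol i j : ud (fun s Z => partial_sol (s i) (s j)).
Proof.
  unfold partial_sol. apply ud_and.
  - apply ud_ball. apply ud_and; [apply ud_in_u|]. apply ud_expair. apply ud_leT.
  - apply ud_ext with (fun s Z => forall r', K r' -> r' ∊ u -> leT r' (s j) -> forall x, K x -> x ∊ u ->
      (opair r' x ∊ s i <-> recPhi (fun x => x ∊ u) p A x (below (fun q => q ∊ s i) T r'))).
    + assert (Huk : forall x, x ∊ u -> K x) by (intros x Hx; eapply Utr; eauto).
      intros s Z _; split; intros H; auto.
    + apply ud_all. apply ud_imp; [apply ud_in_u|]. apply ud_imp; [apply ud_leT|].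
      apply ud_all. apply ud_imp; [apply ud_in_u|]. apply ud_iff; [ud_auto|].
      apply (ud_recu (fun s => below (fun q => q ∊ s (S (S i))) T (s 1))). unfold below. ud_auto.
Qed.

(** Induction along T. The solution below r is separated from u as the pairs that lie in some
    partial solution in K at an earlier point; one more instance of the clause adds the section at
    r. *)
Lemma gset_K r : r ∊ u -> fld T r -> K (gset r).
Proof.
  induction r as [r IH] using (well_founded_induction Twf); intros Hr Hf.
  assert (HKr : K r) by (eapply Utr; eauto).
  set (h := sep u (fun q => exists r' x, q = opair r' x /\ T (opair r' r) /\
    exists g, K g /\ partial_sol g r' /\ q ∊ g)).
  assert (Hh : K h).
  { apply usep; auto. ud_par r; auto. apply ud_expair. apply ud_and; [ud_auto|].
    apply ud_ex. apply ud_and; [apply ud_partial_sol|ud_auto]. }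
  assert (Hbel : forall q, q ∊ u -> (q ∊ h <-> below Sg T r q)).
  { intros q Hq. unfold h, below. rewrite in_sep. split.
    - intros (_ & r' & x & -> & HT & g & Hg & HP & Hin).
      apply partial_sol_unique in HP; [|uu|exists r; auto]. subst g.
      apply in_sep in Hin as (_ & HS & _). eauto.
    - intros [HS (r' & x & -> & HT)]. assert (Hr' : r' ∊ u) by uu.
      assert (Hf' : fld T r') by (exists r; auto).
      split; auto. exists r', x. split; auto. split; auto. exists (gset r').
      split; auto. split; [now apply partial_sol_gset|]. apply in_sep. split; auto. split; auto.
      exists r', x. split; auto. right; auto. }
  replace (gset r) with (sep u (fun q => q ∊ h \/ exists r' x, q = opair r' x /\ r' = r /\
    recPhi (fun x => x ∊ u) p A x (fun q => q ∊ h))).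
  - apply usep; auto. apply ud_or.
    + now apply (ud_cls (fun q => q ∊ h)), Yset.
    + apply ud_expair. apply ud_and; [now apply (ud_cls (fun q => q = r)), Ysing|].
      apply (ud_recu (fun s q => q ∊ h)). now apply (ud_cls (fun q => q ∊ h)), Yset.
  - apply ext; intros q. unfold gset. rewrite !in_sep. split.
    + intros [Hq [H|(r' & x & -> & -> & H)]]; split; auto.
      * apply Hbel in H as [HS (r' & x & -> & HT)]; auto. split; auto. exists r', x; split; auto. left; auto.
      * split; [|exists r, x; split; auto; right; auto].
        apply Hrec; auto; try uu. eapply recPhi_ext; [..|exact H]; [uu|].
        intros q Hq'. symmetry; auto.
    + intros (Hq & HS & r' & x & -> & [HT| ->]); split; auto.
      * left. apply Hbel; auto. split; eauto.
      * right. exists r, x. split; auto. split; auto. apply Hrec in HS; auto; try uu.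
        eapply recPhi_ext; [..|exact HS]; [uu|auto].
Qed.

Lemma set_recursion a : K a -> subW a u -> K (sep a Sg).
Proof.
  intros Ha Hau.
  (* A definition over K: a pair in a belongs to Sg when its first entry r is in the field of T and
     the pair lies in a partial solution up to r. *)
  replace (sep a Sg) with (sep a (fun q => exists r x, q = opair r x /\
    (exists y, K y /\ (T (opair r y) \/ T (opair y r))) /\ exists g, K g /\ partial_sol g r /\ q ∊ g)).
  - apply usep; auto. apply ud_expair. apply ud_and; [ud_auto|].
    apply ud_ex. apply ud_and; [apply ud_partial_sol|ud_auto].
  - apply ext; intros q. rewrite !in_sep. split.
    + intros (Hq & r & x & -> & (y & _ & Hy) & g & _ & HP & Hin). split; auto. pose proof (Hau _ Hq) as Hqu.
      apply partial_sol_unique in HP; [|uu|exists y; auto]. subst g.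
      apply in_sep in Hin as (_ & HS & _). auto.
    + intros [Hq HS]. split; auto. pose proof (Hau _ Hq) as Hqu. destruct (Sfld q HS) as (r & x & -> & Hf).
      assert (Hr : r ∊ u) by uu.
      exists r, x. split; auto. split.
      * destruct Hf as (y & Hy). exists y; split; auto.
        destruct Hy as [Hy|Hy]; [eapply Fopair_r|eapply Fopair_l]; (eapply Usub; [exact YT|exact Hy]).
      * exists (gset r). split; [now apply gset_K|]. split; [now apply partial_sol_gset|].
        apply in_sep. split; auto. split; auto. exists r, x. split; auto. right; auto.
Qed.
End SetRecursion.

(** * K with [Clo] is a model *)

Section MinModel.
Context {N : W -> Prop} {Y : (W -> Prop) -> Prop} {M : Model N Y}.
Notation ud := (udef N Y).
Notation K := (@constructible N).
Notation on := (@oN N).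
Notation AYN := (@amenable N Y).

Lemma big_level d0 : on d0 -> exists l, d0 ∊ l /\ goodlev (N:=N) l.
Proof.
  intros H0. destruct (good_level (Y:=Y) (fun _ _ => True) 0 d0) as (l & H1 & H2 & _); auto; eauto.
  apply ud_const.
Qed.

Lemma gl_pair l x y : goodlev (N:=N) l -> x ∊ lev l -> y ∊ lev l -> upair x y ∊ lev l.
Proof. intros H Hx Hy. apply (gl_op _ H 0); auto. unfold nops; lia. Qed.

Lemma gl_opair l x y : goodlev (N:=N) l -> x ∊ lev l -> y ∊ lev l -> opair x y ∊ lev l.
Proof. intros H Hx Hy. apply gl_pair; auto; apply gl_pair; auto. Qed.

Lemma sub_level d0 l : goodlev (N:=N) l -> d0 ∊ l -> subW (lev d0) (lev l).
Proof. intros H Hd. apply lev_mono. intros z Hz. eapply (proj1 (proj1 (gl_on _ H))); eauto. Qed.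

Lemma Clo_amenable A : Clo K A -> AYN A.
Proof.
  induction 1 as [|p s C Hs HC IH|p A T S HA IHA HT IHT H1 H2 H3 HS].
  - apply ucompN; [tauto|apply ud_const].
  - now apply amenable_comp.
  - assert (HYS : Y S) by exact (Clo_Y K (Y_constructible (Y:=Y)) _ (clo_rec K p A T S HA HT H1 H2 H3 HS)).
    assert (HYT : Y T) by apply IHT. assert (HYA : Y A) by apply IHA.
    assert (HSK : forall q, S q -> K q).
    { intros q Hq. destruct (proj1 HS q Hq) as (r & x & -> & (y & Hy) & Hx).
      apply (Fopair (Y:=AYN)); auto.
      destruct Hy as [Hy|Hy]; [eapply (Fopair_l (Y:=AYN))|eapply (Fopair_r (Y:=AYN))]; eapply (proj1 (proj2 IHT)), Hy. }
    split; auto. split; auto. intros a Ha.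
    destruct (abnd_ex p) as [n Hn].
    destruct (constructible_lev a Ha) as (d0 & Hd0 & Had).
    (* Class variable 0 is read as S below r, with r ranging over the level, so one level reflects
       the clause at all its points. *)
    destruct (reflect (Y:=Y) p (fun r => scons (below S T r) (fun _ => A)) n d0) as (l & Hdl & Hgl & Hrefl); auto.
    { intros [|k]; simpl; [|now apply ud_cls]. unfold below. ud_auto. }
    apply (set_recursion (K:=K) (Y:=AYN) (lev l) p T A); auto.
    + apply Hgl.
    + apply (gl_tr _ Hgl).
    + intros x y. now apply gl_opair.
    + intros q Hq. destruct (proj1 HS q Hq) as (r & x & -> & Hf & _). eauto.
    + intros r x Hr Hx Hf. rewrite (proj2 HS r x Hf) by (eapply (lev_constructible (Y:=Y)); [apply Hgl|auto]).
      unfold recPhi. symmetry. apply Hrefl; auto.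
    + intros x Hx. apply (gl_tr _ Hgl x a); auto. now apply (sub_level d0).
Qed.

Lemma Clo_set b : K b -> Clo K (fun x => x ∊ b).
Proof.
  intros Hb. replace (fun x => x ∊ b) with (fun x => K x /\ satW K (fIn 0 1) (scons x (fun _ => b)) (fun _ _ => False)).
  - apply clo_ec; auto. intros _; apply clo_empty.
  - apply pred_ext; intros x. simpl. split; [tauto|]. intros H; split; auto. eapply (constructible_tr (Y:=Y)); eauto.
Qed.

Lemma Clo_beta R : Clo K R -> relcls R ->
  (forall A, Clo K A -> (exists x, A x) -> exists m, A m /\ forall y, A y -> ~ R (opair y m)) -> wfcls R.
Proof.
  intros HR Hrel Hmin. pose proof (Clo_amenable R HR) as (HYR & HRK & HRam).
  (* What has to be refuted is a class A of Y without minimal element. A may lie outside [Clo K], so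
     it must be traded for a set in K. *)
  apply (Mbeta _ _ M); auto. intros A HA [x0 Hx0]. apply NNPP; intros Hno.
  assert (H : forall m, A m -> exists y, A y /\ R (opair y m)).
  { intros m Hm. apply NNPP; intros Hn. apply Hno. exists m; split; auto.
    intros y Hy HRy. apply Hn; eauto. }
  assert (HAK : forall m, A m -> K m).
  { intros m Hm. destruct (H m Hm) as (y & _ & HRy). eapply (Fopair_r (Y:=AYN)), HRK; eauto. }
  destruct (constructible_lev x0) as (d0 & Hd0 & Hx0d); auto.
  destruct (good_level (Y:=Y) (fun s t => A (s 0) -> exists y, N y /\ inL (N:=N) t y /\ A y /\ R (opair y (s 0))) 1 d0)
    as (l & Hdl & Hgl & HQ); auto.
  - apply ud_imp; [ud_auto|]. apply ud_ex. apply ud_and; [apply ud_inL|]. ud_auto.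
  - intros s d d' _ _ _ Hs HQ HAs. destruct (HQ HAs) as (y & Hy & HL & HH). exists y; split; auto. split; auto.
    eapply inL_mono; eauto.
  - intros s Hs. destruct (classic (A (s 0))) as [HAs|HAs].
    + destruct (H _ HAs) as (y & Hy & HRy). destruct (constructible_lev y) as (d & Hd & HL); auto.
      exists d; split; auto. intros _. exists y; split; [eapply (constructible_N (Y:=Y)); auto|]. split; auto. apply (inL_lev (Y:=Y)); auto.
    + exists empty; split; [apply (on_empty (Y:=Y))|tauto].
  - pose proof (gl_on _ Hgl) as Hl. set (u := lev l) in *.
    assert (Hx0u : x0 ∊ u) by (apply (sub_level d0); auto).
    assert (Hstep : forall x, x ∊ u -> A x -> exists y, y ∊ u /\ A y /\ R (opair y x)).
    { intros x Hx HAx. destruct (HQ (fun i => if Nat.eqb i 0 then x else empty)) as (y & _ & HL & HAy & HRy).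
      - intros i Hi. destruct (Nat.eqb_spec i 0); [auto|lia].
      - intros i Hi. destruct (Nat.eqb_spec i 0); [lia|auto].
      - auto.
      - exists y; split; auto. apply (inL_lev (Y:=Y)); auto. }
    set (r := sep u R). assert (Hr : K r) by (apply HRam, Hgl).
    assert (Hru : forall x y, x ∊ u -> y ∊ u -> R (opair x y) -> opair x y ∊ r).
    { intros x y Hx Hy HRxy. apply in_sep; split; auto. now apply gl_opair. }
    (* The complement of the well-founded part of r: a set in K that contains x0 and has no minimal
       element, and so takes the place of A. *)
    set (b := op0 2 (UU r) (accW r)).
    assert (Hb : K b).
    { apply (constructible_op0 (Y:=Y)); [lia| |apply (constructible_op0 (Y:=Y) 10 r r); auto; lia].
      apply (constructible_op0 (Y:=Y) 1 _ r); auto; [lia|]. apply (constructible_op0 (Y:=Y) 1 r r); auto; lia. }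
    assert (Hin : forall x, x ∊ b <-> x ∊ UU r /\ ~ Acc (setrel r) x).
    { intros x. unfold b, accW. cbn [op0]. rewrite !in_sep. tauto. }
    destruct (Hmin (fun x => x ∊ b)) as (m & Hm & Hmm).
    { now apply Clo_set. }
    { exists x0. apply Hin. destruct (Hstep x0 Hx0u Hx0) as (y & Hy & HAy & HRy). split.
      - eapply UU_r, Hru; eauto.
      - intros Hacc. apply (Acc_no_ill r x0 Hacc (sep u A)).
        + apply in_sep; auto.
        + intros z Hz. apply in_sep in Hz as [Hz HAz]. destruct (Hstep z Hz HAz) as (w & Hw & HAw & HRw).
          exists w; split; [apply in_sep; auto|]. apply Hru; auto. }
    apply Hin in Hm as [Hm1 Hm2].
    (* Minimality of m in b makes all its r-predecessors accessible, hence m itself. *)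
    apply Hm2. constructor. intros y Hy. apply NNPP; intros Hna.
    apply (Hmm y).
    + apply Hin. split; auto. eapply UU_l; eauto.
    + apply in_sep in Hy as [_ Hy]. auto.
Qed.

#[global] Instance Clo_Model : Model K (Clo K).
Proof.
  pose proof (Y_constructible (Y:=Y)) as HYK.
  constructor.
  - apply (constructible_tr (Y:=Y)).
  - intros a b Ha Hb. now apply (constructible_op0 (Y:=Y) 0); [lia|..].
  - intros a Ha. apply (constructible_op0 (Y:=Y) 1 a a); auto; lia.
  - intros a Ha. destruct (Mpow _ _ M a) as (p & Hp & HP); [now apply (constructible_N (Y:=Y))|].
    (* The subsets of a in N form a set, so those in K are all listed below one stage d, and a good
       level past d contains them. *)
    destruct (collect (fun z t => K z -> inL (N:=N) t z) p) as (d & Hd & HL); auto.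
    + apply ud_imp; [ud_auto|apply ud_inL].
    + intros x e e' _ _ _ Hs HH Hx. eapply inL_mono; eauto.
    + intros x Hx. destruct (classic (K x)) as [Hk|Hk].
      * destruct (constructible_lev x Hk) as (d & Hd & HL). exists d; split; auto. intros _. apply (inL_lev (Y:=Y)); auto.
      * exists empty; split; [apply (on_empty (Y:=Y))|tauto].
    + destruct (big_level d Hd) as (l & Hdl & Hgl). exists (sep (lev l) (fun z => subW z a)). split.
      * apply (usep (N:=K) (Y:=AYN)); [apply Hgl|]. ud_par a; auto. ud_auto.
      * intros z Hz. rewrite in_sep. split; [tauto|]. intros Hza. split; auto.
        apply (sub_level d l); auto. apply (inL_lev (Y:=Y)); auto. apply HL; auto. apply HP; auto. now apply (constructible_N (Y:=Y)).
  - destruct (big_level empty) as (l & Hl & Hgl); [apply (on_empty (Y:=Y))|].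
    assert (HB : B empty ∊ lev l) by (apply in_image; eauto).
    exists (lev l). split; [apply Hgl|]. split.
    + replace empty with (op 2 (B empty) (B empty)); [apply (gl_op _ Hgl); auto; unfold nops; lia|].
      apply ext; intros z. change (op 2) with (op0 2). cbn [op0]. rewrite in_sep. split; [tauto|].
      intros Hz; destruct (in_empty _ Hz).
    + intros x Hx. unfold suc, cup. apply (gl_op _ Hgl 1 _ x); auto; [unfold nops; lia|].
      apply gl_pair; auto. now apply gl_pair.
  - intros A x HA Hx. eapply (proj1 (proj2 (Clo_amenable A HA))); eauto.
  - apply clo_ec.
  - exists (fun _ => False). apply clo_empty.
  - intros F HF Hrel Hfun a Ha. pose proof (Clo_amenable F HF) as (HYF & HFK & HFam).
    destruct (Mrep _ _ M F HYF Hrel Hfun a) as (b & Hb & HE); [now apply (constructible_N (Y:=Y))|].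
    assert (HbK : forall y, y ∊ b -> K y).
    { intros y Hy. apply HE in Hy as (x & _ & Hx). eapply (Fopair_r (Y:=AYN)), HFK; eauto. }
    (* As for the power set: the values form a set of N, hence fit into one level, from which
       amenability of F separates them. *)
    destruct (collect (fun z t => inL (N:=N) t z) b) as (d & Hd & HL); auto.
    + apply ud_inL.
    + intros x e e' _ _ _. apply inL_mono.
    + intros x Hx. destruct (constructible_lev x) as (d & Hd & HL); auto. exists d; split; auto. apply (inL_lev (Y:=Y)); auto.
    + destruct (big_level d Hd) as (l & Hdl & Hgl).
      assert (HF' : AYN F) by now apply Clo_amenable.
      exists (sep (lev l) (fun y => exists x, x ∊ a /\ F (opair x y))). split.
      * apply (usep (N:=K) (Y:=AYN)); [apply Hgl|]. ud_par a; auto. ud_auto.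
      * intros y. rewrite in_sep. split; [tauto|]. intros Hy; split; auto.
        apply (sub_level d l); auto. apply (inL_lev (Y:=Y)); auto. apply HL, HE; auto.
  - apply Clo_beta.
  - intros p A T HA HT H1 H2 H3.
    destruct (rec_ex K HYK p A T) as (S & HS & Hs & _); auto; try now apply (Clo_Y K HYK).
    exists S; split; auto. exact (clo_rec K p A T S HA HT H1 H2 H3 Hs).
Qed.
End MinModel.

(** * Global choice *)

Section GlobalWellOrder.
Context {N : W -> Prop} {Y : (W -> Prop) -> Prop} {M : Model N Y}.
Notation K := (@constructible N).
Notation AYN := (@amenable N Y).

(** For the least ordinal e outside K, some good level contains all elements of e. The ordinals of
    that level are exactly those elements, since e or a larger ordinal would bring e into K by
    transitivity; so e is separated from the level after all. *)
Lemma ord_in_K d : ord d -> N d -> K d.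
Proof.
  intros O HN. apply NNPP; intros Hn.
  destruct (in_minimal (fun d => oN (N:=N) d /\ ~ K d) d) as (e & [He HKe] & Hl); [split; [split|]; auto|].
  assert (HeK : forall x, x ∊ e -> K x).
  { intros x Hx. apply NNPP; intros Hn'. apply (Hl x Hx). split; auto. eapply (oN_in (Y:=Y)); eauto. }
  destruct (collect (fun z t => inL (N:=N) t z) e) as (d' & Hd' & HL).
  - apply He.
  - apply ud_inL.
  - intros x a b _ _ _. apply inL_mono.
  - intros x Hx. destruct (constructible_lev x) as (a & Ha & HL); auto. exists a; split; auto. apply (inL_lev (Y:=Y)); auto.
  - destruct (big_level d' Hd') as (l & Hdl & Hgl). apply HKe.
    replace e with (sep (lev l) ord).
    + apply (usep (N:=K) (Y:=AYN)); [apply Hgl|apply ud_ord].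
    + apply ext; intros z. rewrite in_sep. split.
      * intros [Hz Oz]. assert (Kz : K z) by (eapply (lev_constructible (Y:=Y)); [apply Hgl|auto]).
        destruct (ord_cmp z e Oz) as [?|[?|?]]; auto; [apply He|subst; tauto|].
        exfalso. apply HKe. eapply (constructible_tr (Y:=Y)); eauto.
      * intros Hz. split; [|eapply ord_in; [apply He|auto]].
        apply (sub_level (N:=N) d' l); auto. apply (inL_lev (Y:=Y)); auto.
Qed.

Lemma oN_K d : oN (N:=K) d <-> oN (N:=N) d.
Proof.
  unfold oN. split; intros [O H]; split; auto; [now apply (constructible_N (Y:=Y))|now apply ord_in_K].
Qed.

(** The graph is the one computed in (K, Clo), which is a model itself, so [Y_graphB] puts it into
    [Clo K]. As B refers to no model and K has the ordinals of N, it is also the graph computed in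
    N. *)
Definition wellorder : W -> Prop := fun q => K q /\ exists x d, q = opair x d /\ graphB (N:=K) (opair d x).
Lemma wellorder_pair x d : wellorder (opair x d) <-> oN (N:=N) d /\ x = B d.
Proof.
  unfold wellorder. split.
  - intros (_ & x' & d' & E & H). apply opair_inj in E as [<- <-]. apply graphB_pair in H. now rewrite oN_K in H.
  - intros [H ->]. apply oN_K in H as H'. split.
    + apply (Fopair (Y:=AYN)); [exists d; auto|apply H'].
    + exists (B d), d; split; auto. apply graphB_pair; auto.
Qed.

Lemma wellorder_Clo : Clo K wellorder.
Proof.
  apply ucomp1. pose proof (Y_graphB (N:=K) (Y:=Clo K)). ud_auto.
Qed.
End GlobalWellOrder.

(** * Translation between [V] and [W] *)

Definition NV (M : V) : W -> Prop := fun w => val w ∈ M.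
Definition YV (X : V) : (W -> Prop) -> Prop :=
  fun A => exists a, a ∈ X /\ forall w, A w <-> NV a w.

Section Translate.
Variable D : V -> Prop.
Hypothesis Dtr : forall x y, x ∈ y -> D y -> D x.
Hypothesis Deq : forall x y, x ≡ y -> D x -> D y.

Lemma D_val x : D (val (cls x)) <-> D x.
Proof. split; apply Deq; [|apply eqV_sym]; apply val_cls. Qed.

Lemma NV_cls R x : NV R (cls x) <-> x ∈ R.
Proof. unfold NV. split; apply inV_eqV_l; [|apply eqV_sym]; apply val_cls. Qed.

Lemma is_upair_cls p a b : D p -> D a -> D b ->
  (is_upair D p a b <-> cls p = upair (cls a) (cls b)).
Proof.
  intros Hp Ha Hb. unfold is_upair. split.
  - intros H. apply ext; intros w. rewrite in_upair, val_in_cls. rewrite <- (cls_val w) at 2 3. rewrite !cls_eq.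
    split; intros Hw; apply H; auto.
    + eapply Dtr; eauto.
    + destruct Hw as [Hw|Hw]; eapply Deq; try (apply eqV_sym, Hw); auto.
  - intros E z _. rewrite <- cls_in, E, in_upair, !cls_eq. tauto.
Qed.

Lemma is_opair_cls p a b : D p -> D a -> D b ->
  (is_opair D p a b <-> cls p = opair (cls a) (cls b)).
Proof.
  intros Hp Ha Hb. unfold is_opair, opair. split.
  - intros (s & t & Hs & Ht & H1 & H2 & H3). apply is_upair_cls in H1, H2, H3; auto. congruence.
  - intros E.
    assert (Hin : forall w, w ∊ cls p -> D (val w)) by (intros w Hw; exact (Dtr _ _ (proj1 (val_in_cls _ _) Hw) ltac:(assumption))).
    exists (val (upair (cls a) (cls a))), (val (upair (cls a) (cls b))).
    assert (D (val (upair (cls a) (cls a)))) by (apply Hin; rewrite E; apply in_upair; auto).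
    assert (D (val (upair (cls a) (cls b)))) by (apply Hin; rewrite E; apply in_upair; auto).
    split; auto. split; auto. rewrite !is_upair_cls, !cls_val; auto.
Qed.

Lemma D_opair a b : D (val (opair a b)) -> D (val a) /\ D (val b).
Proof.
  intros H. split.
  - apply (Dtr (val a) (val (upair a a))); [apply in_upair; auto|].
    apply (Dtr _ (val (opair a b))); auto. apply in_upair; auto.
  - apply (Dtr (val b) (val (upair a b))); [apply in_upair; auto|].
    apply (Dtr _ (val (opair a b))); auto. apply in_upair; auto.
Qed.

Lemma rel_cls R x y : (forall p, p ∈ R -> D p) -> D x -> D y ->
  (rel D R x y <-> NV R (opair (cls x) (cls y))).
Proof.
  intros HR Hx Hy. unfold rel. split.
  - intros (p & Hp & Ho & HpR). apply is_opair_cls in Ho; auto. rewrite <- Ho. now apply NV_cls.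
  - intros H. exists (val (opair (cls x) (cls y))). assert (D (val (opair (cls x) (cls y)))) by auto.
    split; auto. split; auto. apply is_opair_cls; auto. now rewrite cls_val.
Qed.

Lemma is_relation_cls R : (forall p, p ∈ R -> D p) -> (is_relation D R <-> relcls (NV R)).
Proof.
  intros HR. unfold is_relation, relcls. split.
  - intros H q Hq. destruct (H (val q)) as (x & y & Hx & Hy & Ho); auto.
    apply is_opair_cls in Ho; auto. rewrite cls_val in Ho. eauto.
  - intros H p Hp Hin. destruct (H (cls p)) as (a & b & E); [now apply NV_cls|].
    assert (Hab : D (val (opair a b))) by (rewrite <- E; now apply D_val).
    apply D_opair in Hab as [Ha Hb]. exists (val a), (val b). split; auto. split; auto.
    apply is_opair_cls; auto. now rewrite !cls_val.
Qed.

Lemma sat_cls p : forall s C sW CW, (forall i, cls (s i) = sW i) ->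
  (forall k x, uses_class k p -> (C k x <-> CW k (cls x))) ->
  (sat D p s C <-> satW (fun w => D (val w)) p sW CW).
Proof.
  induction p; simpl; intros s C sW CW Hs HC.
  - rewrite <- !Hs, cls_in. tauto.
  - rewrite <- !Hs, cls_eq. tauto.
  - rewrite <- Hs. auto.
  - rewrite (IHp s C sW CW); auto. tauto.
  - rewrite (IHp1 s C sW CW), (IHp2 s C sW CW); auto. tauto.
  - split; intros H x Hx.
    + rewrite <- (IHp (scons (val x) s) C); [apply H; auto| |auto].
      intros [|i]; simpl; auto. apply cls_val.
    + rewrite (IHp (scons x s) C (scons (cls x) sW) CW); [apply H; now apply D_val| |auto].
      intros [|i]; simpl; auto.
Qed.

Lemma is_ordinal_cls o : D o -> (is_ordinal D o <-> ord (cls o)).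
Proof.
  intros Ho. unfold is_ordinal, ord.
  assert (Hin : forall w, w ∊ cls o -> D (val w)) by (intros w Hw; exact (Dtr _ _ (proj1 (val_in_cls _ _) Hw) ltac:(assumption))).
  split; intros [H1 H2]; split.
  - intros x y Hx Hy. apply (proj2 (val_in_cls _ _)). pose proof (Hin y Hy) as HDy. apply (proj1 (val_in_cls _ _)) in Hy.
    apply (H1 (val x) (val y)); auto. exact (Dtr _ _ Hx HDy).
  - intros x y Hx Hy. pose proof (Hin x Hx). pose proof (Hin y Hy). apply (proj1 (val_in_cls _ _)) in Hx, Hy.
    destruct (H2 (val x) (val y)) as [?|[?|?]]; auto. right; left. now apply val_inj.
  - intros x y _ _ Hx Hy. rewrite <- cls_in in *. eauto.
  - intros x y _ _ Hx Hy. rewrite <- cls_in, <- cls_eq, <- (cls_in y x) in *. auto.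
Qed.
End Translate.

Lemma wf_min (R : W -> W -> Prop) (A : W -> Prop) x : well_founded R -> A x ->
  exists m, A m /\ forall y, A y -> ~ R y m.
Proof.
  intros HR. induction x as [x IH] using (well_founded_induction HR). intros Hx.
  destruct (classic (exists y, A y /\ R y x)) as [(y & Hy & HRy)|Hn]; [eauto|].
  exists x; split; auto. intros y Hy HRy. apply Hn; eauto.
Qed.

(** R is a set, so the inaccessible points among x and [UU (cls R)] form a set, to which minimality
    over sets applies. *)
Lemma wf_everything R : wf_relation everything everything R -> wfcls (NV R).
Proof.
  intros [H1 H2] x. apply NNPP; intros Hx.
  set (a := sep (cup (upair x x) (UU (cls R))) (fun w => ~ Acc (fun x y => NV R (opair x y)) w)).
  assert (Ha : forall w, w ∊ a <-> (w = x \/ w ∊ UU (cls R)) /\ ~ Acc (fun x y => NV R (opair x y)) w).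
  { intros w. unfold a. rewrite in_sep, in_cup, in_upair. tauto. }
  destruct (H2 (val a)) as (m & _ & Hm & Hmin).
  - exact I.
  - exists (val x). split; [exact I|]. apply Ha; auto.
  - assert (Hm' : cls m ∊ a) by now apply NV_cls.
    apply Ha in Hm' as [_ Hm']. apply Hm'. constructor. intros y Hy. apply NNPP; intros Hn.
    apply (Hmin (val y)).
    + exact I.
    + apply Ha. split; auto. right. eapply UU_l. apply (proj2 (val_in_cls _ _)). exact Hy.
    + rewrite (rel_cls everything); unfold everything; auto. now rewrite cls_val.
Qed.

Lemma everything_wf R : relcls (NV R) -> wfcls (NV R) -> wf_relation everything everything R.
Proof.
  intros H1 H2. split.
  - apply is_relation_cls; unfold everything; auto.
  - intros A _ (x & _ & Hx). destruct (wf_min _ (NV A) (cls x) H2) as (m & Hm & Hmin); [now apply NV_cls|].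
    exists (val m). split; [exact I|]. split; auto. intros y _ Hy. rewrite (rel_cls everything); unfold everything; auto.
    rewrite cls_val. apply Hmin. now apply NV_cls.
Qed.

(** * Classes of a structure as predicates *)

Section FromV.
Variables M X : V.
Hypothesis Mtrans : transitive_set M.
Hypothesis XM : forall A, A ∈ X -> A ⊆ M.
Notation D := (elements M).
Notation DX := (elements X).
Notation N := (NV M).
Notation Y := (YV X).

Lemma Dtr x y : x ∈ y -> D y -> D x.
Proof. apply Mtrans. Qed.

Lemma Deq x y : x ≡ y -> D x -> D y.
Proof. apply inV_eqV_l. Qed.

Lemma XD R : R ∈ X -> forall p, p ∈ R -> D p.
Proof. intros HR p Hp. now apply (XM R). Qed.
Ltac xd := try (apply XD; assumption); auto.
Lemma YV_NV a : a ∈ X -> Y (NV a).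
Proof. intros H; exists a; split; auto. tauto. Qed.

Lemma YV_eq A : Y A -> exists a, a ∈ X /\ A = NV a.
Proof. intros (a & Ha & H). exists a; split; auto. now apply pred_ext. Qed.

Lemma N_in x : D x <-> N (cls x).
Proof. symmetry. apply NV_cls. Qed.

Lemma min_transfer R : R ∈ X ->
  ((forall A, DX A -> (exists x, D x /\ x ∈ A) -> exists m, D m /\ m ∈ A /\ forall y, D y -> y ∈ A -> ~ rel D R y m)
  <-> (forall A, Y A -> (exists x, A x) -> exists m, A m /\ forall y, A y -> ~ NV R (opair y m))).
Proof.
  intros HR. split.
  - intros H A HA [x Hx]. apply YV_eq in HA as (a & Ha & ->).
    destruct (H a Ha) as (m & Hm & Hma & Hmin).
    + exists (val x); split; auto. now apply (XD a).
    + exists (cls m). split; [now apply NV_cls|]. intros y Hy.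
      assert (Hy' : D (val y)) by now apply (XD a).
      specialize (Hmin (val y) Hy' Hy). rewrite (rel_cls D Dtr Deq) in Hmin; xd. now rewrite cls_val in Hmin.
  - intros H A HA (x & Hx & HxA). destruct (H (NV A)) as (m & Hm & Hmin).
    + now apply YV_NV.
    + exists (cls x). now apply NV_cls.
    + assert (Hm' : D (val m)) by now apply (XD A).
      exists (val m). split; auto. split; auto. intros y Hy HyA.
      rewrite (rel_cls D Dtr Deq); xd. rewrite cls_val. apply Hmin. now apply NV_cls.
Qed.

Lemma fld_cls R r : R ∈ X -> D r -> (in_dom D R r <-> fld (NV R) (cls r)).
Proof.
  intros HR Hr. unfold in_dom, fld. split.
  - intros (y & Hy & H). exists (cls y). rewrite !(rel_cls D Dtr Deq) in H; xd.
  - intros (y & H).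
    assert (Hy : D (val y)) by (destruct H as [H|H]; apply (XD R HR), (D_opair D Dtr) in H; tauto).
    exists (val y); split; auto. rewrite !(rel_cls D Dtr Deq); xd. now rewrite !cls_val.
Qed.

Lemma is_transitive_cls T : T ∈ X -> (is_transitive_rel D T <-> relcls (NV T) /\ trcls (NV T)).
Proof.
  intros HT. unfold is_transitive_rel. rewrite (is_relation_cls D Dtr Deq) by xd.
  assert (H : forall x y, NV T (opair x y) -> D (val x) /\ D (val y)).
  { intros x y H. apply (D_opair D Dtr). now apply (XD T). }
  split; intros [H1 H2]; split; auto.
  - intros x y z Hxy Hyz. destruct (H x y Hxy), (H y z Hyz).
    specialize (H2 (val x) (val y) (val z)). rewrite !(rel_cls D Dtr Deq), !cls_val in H2; xd.
  - intros x y z Hx Hy Hz. rewrite !(rel_cls D Dtr Deq); xd. apply H2.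
Qed.

(** The closure in the sense of the model is the intersection of its transitive classes containing
    R; this is the true closure as soon as the latter is one of them. *)
Lemma trans_closure_cls R T x y : R ∈ X -> T ∈ X -> D x -> D y ->
  relcls (NV T) -> (forall a b, NV T (opair a b) <-> clos_trans W (fun a b => NV R (opair a b)) a b) ->
  (trans_closure D DX R x y <-> NV T (opair (cls x) (cls y))).
Proof.
  intros HR HT Hx Hy Hrel HTc. unfold trans_closure. split.
  - intros H. specialize (H T HT). rewrite <- (rel_cls D Dtr Deq); xd. apply H.
    + apply is_transitive_cls; auto. split; auto. intros a b c. rewrite !HTc. apply t_trans.
    + intros u v Hu Hv. rewrite !(rel_cls D Dtr Deq); xd. rewrite HTc. intros Huv. apply t_step. exact Huv.
  - intros H T' HT' Htr Hsub. rewrite HTc in H. rewrite (rel_cls D Dtr Deq); xd.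
    apply is_transitive_cls in Htr as [_ Htr]; auto.
    induction H as [a b H|a b c H1 IH1 H2 IH2]; [|eapply Htr; eauto].
    destruct (D_opair D Dtr a b) as [Ha Hb]; [now apply (XD R)|].
    specialize (Hsub (val a) (val b) Ha Hb).
    rewrite !(rel_cls D Dtr Deq), !cls_val in Hsub; xd.
Qed.

(** Restriction below r in the sense of R is [below] along the transitive closure T, so recursion
    along R in the model is semantic recursion along T. *)
Lemma recursion_cls p A R T S : A ∈ X -> R ∈ X -> T ∈ X -> S ∈ X -> relcls (NV T) ->
  (forall a b, NV T (opair a b) <-> clos_trans W (fun a b => NV R (opair a b)) a b) ->
  (forall r, fld (NV T) r <-> fld (NV R) r) ->
  (solves N (fun x Z => satW N p (fun _ => x) (scons Z (fun _ => NV A))) (NV T) (NV S) <->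
   (forall q, D q -> q ∈ S -> exists r x, D r /\ D x /\ in_dom D R r /\ is_opair D q r x) /\
   (forall r, D r -> in_dom D R r -> forall x, D x ->
      (rel D S r x <-> holds_xYA D p x (restrict_below D DX S R r) (elements A)))).
Proof.
  intros HA HR HT HS Hrel HTc Hfld.
  assert (HrT : forall r, NV T r -> D (val r)) by (intros r; now apply (XD T)).
  assert (Hfd : forall r, fld (NV T) r -> D (val r)).
  { intros r [y [H|H]]; apply (XD T HT), (D_opair D Dtr) in H; tauto. }
  assert (Hbody : forall r x, D r -> D x ->
    (holds_xYA D p x (restrict_below D DX S R r) (elements A) <->
     satW N p (fun _ => cls x) (scons (below (NV S) (NV T) (cls r)) (fun _ => NV A)))).
  { intros r x Hr Hx. unfold holds_xYA. apply (sat_cls D); [exact Deq|auto|].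
    intros [|k] q _; simpl.
    - unfold restrict_below, below. split.
      + intros (Hq & r' & y & Hr' & Hy & Ho & Ht). split; [now apply NV_cls|].
        apply (is_opair_cls D Dtr Deq) in Ho; auto; [|now apply (XD S)].
        exists (cls r'), (cls y). split; auto. now apply (trans_closure_cls R T).
      + intros (Hq & r' & y & Ho & Ht). apply (proj1 (NV_cls _ _)) in Hq. split; auto.
        assert (Hq' : D (val (opair r' y))) by (rewrite <- Ho; apply (D_val D Deq); now apply (XD S)).
        apply (D_opair D Dtr) in Hq' as [Hr' Hy].
        exists (val r'), (val y). split; auto. split; auto. split.
        * apply (is_opair_cls D Dtr Deq); auto; [now apply (XD S)|now rewrite !cls_val].
        * apply (trans_closure_cls R T); auto. now rewrite cls_val.
    - symmetry. apply NV_cls. }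
  split.
  - intros [H1 H2]. split.
    + intros q Hq HqS. destruct (H1 (cls q)) as (r & x & E & Hr & Hx); [now apply NV_cls|].
      exists (val r), (val x). split; auto. split; auto. split.
      * apply fld_cls; auto. rewrite cls_val. now apply Hfld.
      * apply (is_opair_cls D Dtr Deq); auto. now rewrite !cls_val.
    + intros r Hr Hd x Hx. rewrite (rel_cls D Dtr Deq), Hbody; xd. apply H2.
      * apply Hfld. now apply fld_cls.
      * now apply (proj1 (N_in _)).
  - intros [H1 H2]. split.
    + intros q Hq. destruct (H1 (val q)) as (r & x & Hr & Hx & Hd & Ho); auto.
      { now apply (XD S). }
      exists (cls r), (cls x). apply (is_opair_cls D Dtr Deq) in Ho; auto; [|now apply (XD S)].
      rewrite cls_val in Ho. split; auto. split; [apply Hfld; now apply fld_cls|now apply (proj1 (N_in _))].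
    + intros r x Hr Hx. specialize (Hfd r Hr).
      rewrite <- (cls_val r), <- (cls_val x). rewrite <- (rel_cls D Dtr Deq), <- Hbody; xd.
      apply H2; auto. apply fld_cls; auto. rewrite cls_val. now apply Hfld.
Qed.
End FromV.

(** * Transitive closures as classes *)

Section ClosureClass.
Context {N : W -> Prop} {Y : (W -> Prop) -> Prop} {M : Model N Y}.
(* For well-founded [R], descending from [y] inside a set [a] in which every point is above [x]
   or above another point of [a] must reach [x], so the closure is first-order. *)
Lemma trans_closure_class R : Y R -> wfcls R ->
  exists T, Y T /\ relcls T /\
    forall a b, T (opair a b) <-> clos_trans W (fun a b => R (opair a b)) a b.
Proof.
  intros HR Hwf.
  exists (fun q => N q /\ exists x y, q = opair x y /\ exists a, N a /\ y ∊ a /\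
    forall z, z ∊ a -> R (opair x z) \/ exists z', z' ∊ a /\ R (opair z' z)).
  split; [apply ucomp1; ud_auto|]. split; [intros q (_ & x & y & -> & _); eauto|].
  assert (HN : forall x y, R (opair x y) -> N x /\ N y).
  { intros x y H. apply (Usub (Y:=Y)) in H; auto. split; [eapply Fopair_l|eapply Fopair_r]; eauto. }
  intros x y. split.
  - intros (_ & x' & y' & E & a & _ & Hy & H). apply opair_inj in E as [<- <-].
    revert Hy. induction y as [y IH] using (well_founded_induction Hwf). intros Hy.
    destruct (H y Hy) as [Hxy|(z & Hz & HRz)]; [now apply t_step|].
    apply t_trans with z; [auto|now apply t_step].
  - intros H. apply clos_trans_tn1 in H.
    assert (Hx : N x) by (induction H; [apply HN in H as []|]; auto).
    assert (Hy : N y) by (destruct H as [y H|y z H _]; apply HN in H as []; auto).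
    split; [now apply (Fopair (Y:=Y))|]. exists x, y. split; auto. clear Hy.
    (* The points of a chain from x to y, without its start x, form the required set; each further
       step adjoins its end point. *)
    induction H as [y H|y z H H' IH].
    + exists (upair y y). destruct (HN _ _ H). split; [now apply Upair|].
      split; [apply in_upair; auto|]. intros w Hw. apply in_upair in Hw. assert (w = y) by tauto. subst; auto.
    + destruct IH as (a & Ha & Hya & Hd). destruct (HN _ _ H).
      exists (cup a (upair z z)). split; [apply (Ncup (Y:=Y)); auto; now apply Upair|].
      split; [apply in_cup; right; apply in_upair; auto|]. intros w Hw. apply in_cup in Hw as [Hw|Hw].
      * destruct (Hd w Hw) as [?|(z' & Hz' & ?)]; auto. right. exists z'; split; auto. apply in_cup; auto.
      * apply in_upair in Hw. assert (w = z) by tauto. subst. right. exists y; split; auto. apply in_cup; auto.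
Qed.

Lemma ud_form p C : (forall k, Y (C k)) -> udef N Y (fun s Z => satW N p s C).
Proof.
  intros HC. exists (cren S p), C. split; auto. intros s Z _. rewrite satW_cren. simpl. tauto.
Qed.
End ClosureClass.

(** The first and the last step of an R-chain put its end points into the field of R. *)
Lemma fld_trans (R T : W -> Prop) :
  (forall a b, T (opair a b) <-> clos_trans W (fun a b => R (opair a b)) a b) ->
  forall r, fld T r <-> fld R r.
Proof.
  intros H r. unfold fld. split.
  - intros [y [K|K]]; apply H in K.
    + apply clos_trans_t1n in K. destruct K as [z K|z w K _]; eauto.
    + apply clos_trans_tn1 in K. destruct K as [z K|z w K _]; eauto.
  - intros [y [K|K]]; exists y; [left|right]; apply H, t_step, K.
Qed.

(** * Beta-models of GB + ETR and semantic models *)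

Lemma beta_Model M X : beta_model_GB_ETR M X -> Model (NV M) (YV X).
Proof.
  intros [(Htr & HXM & Hbeta) [((HExt & HFound & HPair & HUn & HPow & HInf & HSep & HRepl) & HCE & HCR & HEC) HETR]].
  pose proof (Dtr M Htr) as dtr. pose proof (Deq M) as deq.
  assert (Hin : forall w x, w ∊ cls x -> elements M x -> elements M (val w)).
  { intros w x Hw Hx. exact (dtr _ _ (proj1 (val_in_cls _ _) Hw) Hx). }
  assert (Hemp : forall e, elements M e -> (forall z, elements M z -> ~ z ∈ e) -> cls e = empty).
  { intros e He H. apply ext; intros z. split; intros Hz; [|destruct (in_empty _ Hz)].
    destruct (H (val z)); eauto. exact (proj1 (val_in_cls _ _) Hz). }
  assert (Hsat : forall p s P (C : nat -> W -> Prop) x, (forall k w, uses_class k p -> (C k w <-> NV (P k) w)) ->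
    (sat (elements M) p (scons x (fun i => val (s i))) (fun k => elements (P k)) <->
     satW (NV M) p (scons (cls x) s) C)).
  { intros p s P C x HC. apply (sat_cls (elements M) deq).
    - intros [|i]; simpl; auto. apply cls_val.
    - intros k w Hk. rewrite HC by auto. symmetry. apply NV_cls. }
  assert (Hcomp : forall p s C, (forall i, NV M (s i)) -> (forall k, uses_class k p -> YV X (C k)) ->
    YV X (fun x => NV M x /\ satW (NV M) p (scons x s) C)).
  { intros p s C Hs HC.
    (* Codes are chosen for all k at once; only those of class variables occurring in p are
       meaningful. *)
    pose (P := fun k => epsilon (inhabits V0) (fun a => a ∈ X /\ forall w, C k w <-> NV a w)).
    assert (HP : forall k, uses_class k p -> P k ∈ X /\ forall w, C k w <-> NV (P k) w).
    { intros k Hk. exact (epsilon_spec (inhabits V0) (fun a => a ∈ X /\ forall w, C k w <-> NV a w) (HC k Hk)). }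
    destruct (HEC p (fun i => val (s i)) P) as (A & HA & HAx); auto.
    { intros k Hk. apply (HP k Hk). }
    exists A; split; auto. intros w.
    assert (Hw : satW (NV M) p (scons w s) C <-> sat (elements M) p (scons (val w) (fun i => val (s i))) (fun k => elements (P k))).
    { rewrite (Hsat p s P C (val w)); [|intros k v Hk; now apply (HP k Hk)]. now rewrite cls_val. }
    rewrite Hw. split.
    - intros [HN H]. now apply (HAx (val w) HN).
    - intros H. assert (HN : NV M w) by (now apply (HXM A HA)). split; auto. now apply (HAx (val w) HN). }
  destruct HInf as (w & Hw & (e & He & Hew & He0) & Hsuc).
  (* The formula x = x has no class variables, so this instance of comprehension yields a first
     class. *)
  assert (Hinh : YV X (fun x => NV M x /\ satW (NV M) (fEq 0 0) (scons x (fun _ => cls w)) (fun _ _ => False))).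
  { apply Hcomp; [intros _; now apply (proj1 (N_in M w))|simpl; tauto]. }
  constructor.
  - intros x y Hx Hy. exact (dtr _ _ Hx Hy).
  - intros a b Ha Hb. destruct (HPair (val a) (val b) Ha Hb) as (p & Hp & Hu).
    apply (is_upair_cls (elements M) dtr deq) in Hu; auto. rewrite !cls_val in Hu. rewrite <- Hu. now apply (proj1 (N_in M p)).
  - intros a Ha. destruct (HUn (val a) Ha) as (u & Hu & HE).
    replace (bigU a) with (cls u); [now apply (proj1 (N_in M u))|].
    apply ext; intros z. rewrite in_bigU, val_in_cls. split.
    + intros Hz. apply HE in Hz as (y & Hy & Hzy & Hya); [|exact (dtr _ _ Hz Hu)].
      exists (cls y). split; [exact (proj2 (val_in_cls _ _) Hzy)|]. now apply NV_cls.
    + intros (y & Hzy & Hya). assert (Hy : elements M (val y)) by exact (dtr _ _ Hya Ha).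
      apply HE; [exact (dtr _ _ Hzy Hy)|]. exists (val y). auto.
  - intros a Ha. destruct (HPow (val a) Ha) as (p & Hp & HE). exists (cls p).
    split; [now apply (proj1 (N_in M p))|]. intros z Hz. rewrite val_in_cls, (HE (val z) Hz). split.
    + intros H v Hv. apply H; auto. exact (dtr _ _ Hv Hz).
    + intros H v Hv Hvz. apply (proj1 (NV_cls (val a) v)). apply H. apply (proj2 (NV_cls (val z) v)). auto.
  - exists (cls w). split; [now apply (proj1 (N_in M w))|]. split.
    + rewrite <- (Hemp e He He0). now apply cls_in.
    + intros x Hx. assert (HDx : elements M (val x)) by eauto.
      destruct (Hsuc (val x) HDx (proj1 (val_in_cls _ _) Hx)) as (y & Hy & Hyw & HE).
      replace (suc x) with (cls y); [now apply cls_in|]. apply ext; intros z. rewrite in_suc, val_in_cls. split.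
      * intros Hz. apply HE in Hz as [Hz|Hz]; auto; [right; now apply val_inj|exact (dtr _ _ Hz Hy)].
      * intros Hz. apply HE.
        -- destruct Hz as [Hz| ->]; auto. exact (dtr _ _ Hz HDx).
        -- destruct Hz as [Hz| ->]; auto. right; apply eqV_refl.
  - intros A x (a & Ha & HA) Hx. apply HA in Hx. now apply (HXM a Ha).
  - intros p s C Hs HC. apply Hcomp; auto.
  - eexists; exact Hinh.
  - intros F HF Hrel Hfun a Ha. apply YV_eq in HF as (f & Hf & ->).
    pose proof (XD M X HXM f Hf) as HfD.
    destruct (HCR f Hf) with (val a) as (b & Hb & HE); auto.
    + split; [now apply (is_relation_cls (elements M) dtr deq)|].
      intros x y y' Hx Hy Hy'. rewrite !(rel_cls (elements M) dtr deq); auto. intros H1 H2.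
      apply cls_eq. eauto.
    + exists (cls b). split; [now apply (proj1 (N_in M b))|]. intros y. rewrite val_in_cls. split.
      * intros Hy. assert (Hy' : elements M (val y)) by exact (dtr _ _ Hy Hb).
        apply HE in Hy as (x & Hx & Hxa & Hr); auto. rewrite (rel_cls (elements M) dtr deq), cls_val in Hr; auto.
        exists (cls x). split; auto. now apply NV_cls.
      * intros (x & Hx & Hr). assert (Hx' : elements M (val x)) by exact (dtr _ _ Hx Ha).
        destruct (D_opair (elements M) dtr x y) as [_ Hy]; [now apply HfD|].
        apply HE; auto. exists (val x). split; auto. split; auto. rewrite (rel_cls (elements M) dtr deq), !cls_val; auto.
  - intros R HR Hrel Hmin. apply YV_eq in HR as (r & Hr & ->).
    apply wf_everything. apply Hbeta; auto. split.
    + apply (is_relation_cls (elements M) dtr deq); auto. exact (XD M X HXM r Hr).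
    + now apply (min_transfer M X Htr HXM r Hr).
  - intros p A T HA HT Hrel Htrc Hwf. apply YV_eq in HA as (a & Ha & ->). apply YV_eq in HT as (t & Ht & ->).
    destruct (HETR p a t Ha Ht) as (S & HS & HSol).
    + split.
      * apply (is_relation_cls (elements M) dtr deq); auto. exact (XD M X HXM t Ht).
      * apply (min_transfer M X Htr HXM t Ht). intros A _ [x Hx]. apply (wf_min (fun x y => NV t (opair x y)) A x); auto.
    + exists (NV S). split; [now apply YV_NV|].
      (* A transitive relation is its own closure, so t plays both R and T. *)
      apply (recursion_cls M X Htr HXM p a t t S); auto; [|tauto].
      intros x y. split; [intros H; apply t_step; exact H|]. induction 1 as [x y H|x y z _ IH1 _ IH2]; auto. eapply Htrc; eauto.
Qed.

Lemma Model_beta M X : transitive_set M -> (forall A, A ∈ X -> A ⊆ M) ->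
  Model (NV M) (YV X) -> beta_model_GB_ETR M X.
Proof.
  intros Htr HXM HM.
  pose proof (Dtr M Htr) as dtr. pose proof (Deq M) as deq.
  assert (Nin : forall x, elements M x -> NV M (cls x)) by (intros x; apply (N_in M x)).
  assert (Hcls : forall x a, x ∈ a <-> cls x ∊ cls a) by (intros; symmetry; apply cls_in).
  destruct (Minh _ _ HM) as [A0 HA0].
  assert (HE0 : YV X (fun _ => False)) by (apply ucompN; [tauto|apply ud_const]).
  split; [|split].
  - split; auto. split; auto. intros R HR [Hrel Hmin].
    pose proof (XD M X HXM R HR) as HRD. apply (is_relation_cls (elements M) dtr deq) in Hrel; auto.
    apply everything_wf; auto. apply (Mbeta _ _ HM); auto; [now apply YV_NV|].
    now apply (min_transfer M X Htr HXM R HR).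
  - split; [|split; [|split]].
    + repeat split.
      * intros x y Hx Hy H. apply eqV_ext. intros z. split; intros Hz; (apply H; [|auto]).
        -- exact (dtr _ _ Hz Hx).
        -- exact (dtr _ _ Hz Hy).
      * intros x Hx (y & Hy & Hyx). destruct (in_minimal (fun w => w ∊ cls x) (cls y)) as (m & Hm & Hmin).
        { now apply (proj1 (Hcls _ _)). }
        exists (val m). pose proof (proj1 (val_in_cls _ _) Hm) as Hm'.
        split; [exact (dtr _ _ Hm' Hx)|]. split; auto.
        intros z Hz Hzx Hzm. apply (Hmin (cls z)); [|now apply (proj1 (Hcls _ _))]. now apply (proj2 (NV_cls (val m) z)).
      * intros a b Ha Hb. exists (val (upair (cls a) (cls b))).
        assert (HN : NV M (upair (cls a) (cls b))) by (apply (Mpair _ _ HM); auto).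
        split; auto. apply (is_upair_cls (elements M) dtr deq); auto. now rewrite cls_val.
      * intros a Ha. exists (val (bigU (cls a))). split; [now apply (Mun _ _ HM), Nin|].
        intros z Hz. rewrite <- (NV_cls (val (bigU (cls a))) z). change (cls z ∊ bigU (cls a) <-> exists y, elements M y /\ z ∈ y /\ y ∈ a).
        rewrite in_bigU. split.
        -- intros (y & Hy & Hya). apply (proj1 (val_in_cls _ _)) in Hya. exists (val y).
           split; [exact (dtr _ _ Hya Ha)|]. split; auto. now apply (proj1 (NV_cls (val y) z)).
        -- intros (y & _ & Hzy & Hya). exists (cls y). now rewrite !cls_in.
      * intros a Ha. destruct (Mpow _ _ HM (cls a)) as (p & Hp & HE); auto. exists (val p). split; auto.
        intros z Hz. rewrite <- (NV_cls (val p) z). change (cls z ∊ p <-> forall w, elements M w -> w ∈ z -> w ∈ a).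
        rewrite HE by auto. split.
        -- intros H w _ Hw. rewrite Hcls in *. auto.
        -- intros H w Hw. pose proof (proj1 (val_in_cls _ _) Hw) as Hw'. apply (proj2 (val_in_cls _ _)).
           apply H; auto. exact (dtr _ _ Hw' Hz).
      * destruct (Minf _ _ HM) as (w & Hw & He & Hs). exists (val w). split; auto. split.
        -- exists (val empty). split; [exact (dtr _ _ He Hw)|]. split; auto.
           intros z _ Hz. apply (in_empty (cls z)). now apply (proj2 (NV_cls (val empty) z)).
        -- intros x Hx Hxw. assert (Hs' : suc (cls x) ∊ w) by (apply Hs; now apply (proj2 (NV_cls (val w) x))).
           exists (val (suc (cls x))). split; [exact (dtr _ _ Hs' Hw)|]. split; auto.
           intros z Hz. rewrite <- (NV_cls (val (suc (cls x))) z). change (cls z ∊ suc (cls x) <-> z ∈ x \/ z ≡ x).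
           now rewrite in_suc, cls_in, cls_eq.
      * intros p s C Hp Hs a Ha.
        set (P := fun w => NV M w /\ satW (NV M) p (scons w (fun i => cls (s i))) (fun _ _ => False)).
        assert (HP : YV X P) by (apply (Mcomp _ _ HM); auto).
        exists (val (sep (cls a) P)). split; [apply (Usep (N:=NV M) (Y:=YV X)); auto|].
        intros x Hx. rewrite <- (NV_cls (val (sep (cls a) P)) x). change (cls x ∊ sep (cls a) P <-> x ∈ a /\ sat (elements M) p (scons x s) C).
        rewrite in_sep, cls_in. unfold P.
        rewrite (sat_cls (elements M) deq p (scons x s) C (scons (cls x) (fun i => cls (s i))) (fun _ _ => False)).
        -- pose proof (Nin x Hx). tauto.
        -- intros [|i]; reflexivity.
        -- intros k y Hk. destruct (Hp k Hk).
      * intros p s C Hp Hs a Ha Hfun.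
        set (F := fun x y => NV M x /\ NV M y /\ satW (NV M) p (scons x (scons y (fun i => cls (s i)))) (fun _ _ => False)).
        assert (HF : forall x y, elements M x -> elements M y -> (F (cls x) (cls y) <-> sat (elements M) p (scons x (scons y s)) C)).
        { intros x y Hx Hy. unfold F.
          rewrite (sat_cls (elements M) deq p (scons x (scons y s)) C (scons (cls x) (scons (cls y) (fun i => cls (s i)))) (fun _ _ => False)).
          - pose proof (Nin x Hx). pose proof (Nin y Hy). tauto.
          - intros [|[|i]]; reflexivity.
          - intros k z Hk. destruct (Hp k Hk). }
        destruct (rep_udef (N:=NV M) (Y:=YV X) F (cls a)) as (b & Hb & HE); auto.
        -- intros x y _ (_ & H & _); auto.
        -- intros x y y' Hx H1 H2. pose proof H1 as (Hx' & Hy & _). pose proof H2 as (_ & Hy' & _).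
           apply val_inj. apply (Hfun (val x) (val y) (val y')); auto.
           ++ exact (proj1 (val_in_cls _ _) Hx).
           ++ apply HF; auto. now rewrite !cls_val.
           ++ apply HF; auto. now rewrite !cls_val.
        -- unfold F. apply ud_and; [apply ud_N|]. apply ud_and; [apply ud_N|].
           eapply ud_ext; [|apply (ud_tail 2 (fun i => cls (s i)) _ (ud_form (Y:=YV X) p (fun _ _ => False) (fun _ => HE0)))].
           ++ intros s' Z _. cbv beta.
              match goal with |- satW _ _ ?a _ <-> satW _ _ ?b _ => replace a with b; [tauto|] end.
              apply functional_extensionality; intros [|[|i]]; simpl; auto. now rewrite Nat.sub_0_r.
           ++ intros i. apply Nin, Hs.
        -- exists (val b). split; auto. intros y Hy. rewrite <- (NV_cls (val b) y).
           change (cls y ∊ b <-> exists x, elements M x /\ x ∈ a /\ sat (elements M) p (scons x (scons y s)) C).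
           rewrite HE. split.
           ++ intros (x & Hx & HFx). pose proof (proj1 (val_in_cls _ _) Hx) as Hx'.
              assert (HDx : elements M (val x)) by exact (dtr _ _ Hx' Ha).
              exists (val x). split; auto. split; auto. apply HF; auto. now rewrite cls_val.
           ++ intros (x & Hx & Hxa & Hsat). exists (cls x). split; [now apply (proj1 (Hcls _ _))|]. now apply HF.
    + intros A B HA HB H. apply eqV_ext. intros z. split; intros Hz; (apply H; [|auto]).
      * now apply (HXM A HA).
      * now apply (HXM B HB).
    + intros F HF [Hrel Hfun] a Ha. pose proof (XD M X HXM F HF) as HFD.
      apply (is_relation_cls (elements M) dtr deq) in Hrel; auto.
      destruct (Mrep _ _ HM (NV F)) with (cls a) as (b & Hb & HE); auto.
      * now apply YV_NV.
      * intros x y y' H1 H2. destruct (D_opair (elements M) dtr x y) as [Hx Hy]; [now apply HFD|].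
        destruct (D_opair (elements M) dtr x y') as [_ Hy']; [now apply HFD|].
        apply val_inj. apply (Hfun (val x) (val y) (val y')); auto; rewrite (rel_cls (elements M) dtr deq), !cls_val; auto.
      * exists (val b). split; auto. intros y Hy. rewrite <- (NV_cls (val b) y).
        change (cls y ∊ b <-> exists x, elements M x /\ x ∈ a /\ rel (elements M) F x y). rewrite HE. split.
        -- intros (x & Hx & HFx). pose proof (proj1 (val_in_cls _ _) Hx) as Hx'.
           assert (HDx : elements M (val x)) by exact (dtr _ _ Hx' Ha).
           exists (val x). split; auto. split; auto. rewrite (rel_cls (elements M) dtr deq), cls_val; auto.
        -- intros (x & Hx & Hxa & Hr). exists (cls x). split; [now apply (proj1 (Hcls _ _))|].
           now rewrite <- (rel_cls (elements M) dtr deq).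
    + intros p s P Hs HP.
      (* Class variables that do not occur in p may denote nothing in X, whereas [Mcomp] wants a
         class in every slot; they are read as empty. *)
      set (C := fun k w => uses_class k p /\ NV (P k) w).
      assert (HC : forall k, YV X (C k)).
      { intros k. destruct (classic (uses_class k p)) as [Hk|Hk].
        - replace (C k) with (NV (P k)); [apply YV_NV, HP, Hk|]. apply pred_ext; intros w; unfold C; tauto.
        - replace (C k) with (fun _ : W => False); auto. apply pred_ext; intros w; unfold C; tauto. }
      destruct (Mcomp _ _ HM p (fun i => cls (s i)) C) as (A & HA & HAx); auto.
      exists A. split; auto. intros x Hx. rewrite <- (NV_cls A x), <- HAx.
      rewrite (sat_cls (elements M) deq p (scons x s) (fun k => elements (P k)) (scons (cls x) (fun i => cls (s i))) C).
      * pose proof (Nin x Hx). tauto.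
      * intros [|i]; reflexivity.
      * intros k y Hk. unfold C. rewrite NV_cls. unfold elements. tauto.
  - intros p A R HA HR [Hrel Hmin]. pose proof (XD M X HXM R HR) as HRD.
    apply (is_relation_cls (elements M) dtr deq) in Hrel; auto.
    assert (Hwf : wfcls (NV R)).
    { apply (Mbeta _ _ HM); auto; [now apply YV_NV|]. now apply (min_transfer M X Htr HXM R HR). }
    (* R need not be transitive; its closure is a class with the same field and is still
       well-founded, so [Metr] applies to it. *)
    destruct (trans_closure_class (N:=NV M) (Y:=YV X) (NV R)) as (T & HT & HTrel & HTc); auto; [now apply YV_NV|].
    assert (HTfld := fld_trans _ _ HTc).
    assert (HTwf : wfcls T).
    { assert (Hc := wf_clos_trans W (fun a b => NV R (opair a b)) Hwf).
      intros x. induction x as [x IH] using (well_founded_induction Hc). constructor. intros y Hy.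
      apply IH. now apply HTc. }
    assert (HTtr : trcls T) by (intros x y z; rewrite !HTc; apply t_trans).
    apply YV_eq in HT as (t & Ht & ->).
    destruct (Metr _ _ HM p (NV A) (NV t)) as (S0 & HS & HSol); auto; try now apply YV_NV.
    apply YV_eq in HS as (S & HS & ->).
    exists S. split; auto. now apply (recursion_cls M X Htr HXM p A R t S).
Qed.

(** * The minimum beta-model *)

Lemma in_val w x : val w ∈ val x <-> w ∊ x.
Proof. reflexivity. Qed.

Theorem theorem4 :
  (exists M X : V, beta_model_GB_ETR M X) ->
  exists M X : V,
    beta_model_GB_ETR M X /\
    (forall N Y : V, beta_model_GB_ETR N Y -> M ⊆ N /\ X ⊆ Y) /\
    GlobalChoice (elements M) (elements X).
Proof.
  intros (M1 & X1 & H1).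
  (* The height is an ordinal of the ambient universe, so a least one exists by ∈-induction
     there. *)
  pose (ht := fun M : V => sep (cls M) ord).
  destruct (in_minimal (fun o => exists M X, beta_model_GB_ETR M X /\ o = ht M) (ht M1)) as (o & (M & X & HMX & Ho) & Hmin).
  { eauto. }
  assert (Hht : forall M X, beta_model_GB_ETR M X -> ord (ht M) /\ forall d, d ∊ ht M <-> oN (N:=NV M) d).
  { intros M' X' HM'. assert (Hd : forall d, d ∊ ht M' <-> oN (N:=NV M') d).
    { intros d. unfold ht, oN. rewrite in_sep, val_in_cls. unfold NV. tauto. }
    split; auto. apply ord_set.
    - intros x y Hx Hy. apply Hd in Hy as [Oy Hy]. apply Hd. split; [eapply ord_in; eauto|].
      exact (proj1 (proj1 HM') _ _ Hx Hy).
    - intros x Hx. now apply Hd in Hx as [? _]. }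
  pose proof (beta_Model M X HMX) as HM.
  set (K := constructible (N:=NV M)).
  (* At equal height K is the constructible class of M' too; at greater height o is an ordinal of M'
     and K is its set [lev o]. Smaller height is excluded by the choice of M. *)
  assert (HKcl : forall M' X', beta_model_GB_ETR M' X' -> YV X' K).
  { intros M' X' HM'. pose proof (beta_Model M' X' HM') as HMo.
    destruct (Hht M X HMX) as [O1 D1]. destruct (Hht M' X' HM') as [O2 D2]. rewrite <- Ho in O1, D1.
    assert (Hc : o = ht M' \/ o ∊ ht M').
    { destruct (ord_cmp o (ht M') O1 O2) as [?|[?|Hlt]]; auto. exfalso. apply (Hmin _ Hlt); eauto. }
    destruct Hc as [Hc|Hc].
    - replace K with (constructible (N:=NV M')); [apply (Y_constructible (Y:=YV X'))|].
      apply pred_ext; intros x. unfold K, constructible. split; intros (d & Hd & ->); exists d; split; auto.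
      + apply D1. rewrite Hc. now apply D2.
      + apply D2. rewrite <- Hc. now apply D1.
    - apply D2 in Hc. replace K with (fun x => x ∊ lev o).
      + apply Yset. now apply (N_lev (Y:=YV X')).
      + apply pred_ext; intros x. unfold lev, K, constructible. rewrite in_image.
        split; intros (d & Hd & ->); exists d; split; auto; now apply D1. }
  pose (k := val (sep (cls M) K)).
  assert (HkK : NV k = K).
  { apply pred_ext; intros x. unfold NV, k. rewrite in_val, in_sep, val_in_cls. split; [tauto|].
    intros Hx; split; auto. exact (constructible_N (N:=NV M) (Y:=YV X) x Hx). }
  (* The predicates in [Clo K] are coded by subsets of k, so that the family of classes becomes a
     set. *)
  pose (c := val (sep (powW (cls k)) (fun a => Clo K (fun x => x ∊ a)))).
  assert (Hc : forall a, a ∈ c <-> a ⊆ k /\ Clo K (NV a)).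
  { intros a. rewrite <- (NV_cls c a). unfold NV, c. rewrite in_val, in_sep, in_powW.
    replace (fun x => x ∊ cls a) with (NV a) by (apply pred_ext; intros x; symmetry; apply val_in_cls).
    assert (Hs : subW (cls a) (cls k) <-> a ⊆ k); [|unfold NV; tauto].
    unfold subW, subV. split; intros H z Hz.
    - rewrite <- cls_in in *. auto.
    - rewrite val_in_cls in *. auto. }
  assert (Hck : YV c = Clo K).
  { apply functional_extensionality; intros A. apply propositional_extensionality. split.
    - intros HA. apply YV_eq in HA as (a & Ha & ->). now apply Hc.
    - intros HA. pose proof (Clo_amenable A HA) as (_ & HAK & _).
      exists (val (sep (cls k) A)).
      assert (HE : forall w, A w <-> NV (val (sep (cls k) A)) w).
      { intros w. unfold NV. rewrite in_val, in_sep, val_in_cls. change (val w ∈ k) with (NV k w). rewrite HkK.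
        split; [|tauto]. intros Hw; split; [exact (HAK w Hw)|exact Hw]. }
      split; auto. apply Hc. split.
      + intros z Hz. rewrite <- (NV_cls _ z) in Hz. apply HE in Hz. apply HAK in Hz. fold K in Hz.
        rewrite <- HkK in Hz. now apply (proj1 (NV_cls k z)).
      + now rewrite <- (pred_ext _ _ HE). }
  assert (HModel : Model (NV k) (YV c)).
  { rewrite HkK, Hck. exact (Clo_Model (M:=HM)). }
  assert (Hktr : transitive_set k).
  { intros x y Hx Hy. rewrite <- (NV_cls k) in *. eapply (Mtr _ _ HModel); [|exact Hy]. now apply cls_in. }
  assert (Hck' : forall A, A ∈ c -> A ⊆ k) by (intros A HA; now apply Hc).
  exists k, c. split; [now apply Model_beta|]. split.
  - intros N Y HNY. pose proof (beta_Model N Y HNY) as HMo. pose proof (HKcl N Y HNY) as HK.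
    assert (Hkn : k ⊆ N).
    { intros z Hz. rewrite <- (NV_cls k) in Hz. rewrite HkK in Hz.
      apply (proj1 (NV_cls N z)). now apply (Msub _ _ HMo K). }
    split; auto. intros a Ha. apply Hc in Ha as [Hak Ha].
    apply (Clo_Y (N:=NV N) (Y:=YV Y) K HK) in Ha as (b & Hb & HE).
    apply inV_eqV_l with b; auto. apply eqV_ext. intros z. rewrite <- (NV_cls b z), <- (NV_cls a z). symmetry. apply HE.
  - pose proof (Dtr k Hktr) as dtr. pose proof (Deq k) as deq.
    assert (Hw : YV c (wellorder (N:=NV M))) by (rewrite Hck; exact (wellorder_Clo (Y:=YV X))).
    assert (HwE := fun x d => wellorder_pair (N:=NV M) (Y:=YV X) x d).
    assert (HwK : forall x, wellorder (N:=NV M) x -> K x) by (intros x [? _]; auto).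
    assert (Hwrel : relcls (wellorder (N:=NV M))) by (intros q (_ & x & d & -> & _); eauto).
    apply YV_eq in Hw as (F & HF & EF). rewrite EF in *.
    pose proof (XD k c Hck' F HF) as HFD.
    assert (Helt : forall x, elements k x <-> K (cls x)).
    { intros x. rewrite <- HkK. symmetry. apply NV_cls. }
    assert (Hrel : forall x d, elements k x -> elements k d -> (rel (elements k) F x d <-> oN (N:=NV M) (cls d) /\ cls x = B (cls d))).
    { intros x d Hx Hd. rewrite (rel_cls (elements k) dtr deq); auto. }
    exists F. split; auto. split; [|split; [|split; [|split]]].
    (* F sends a value to its index, so it is single-valued because B is injective on ordinals. *)
    + split; [now apply (is_relation_cls (elements k) dtr deq)|].
      intros x d d' Hx Hd Hd'. rewrite !Hrel; auto. intros [Hd1 E1] [Hd2 E2].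
      apply cls_eq. apply B_inj; [apply Hd1|apply Hd2|congruence].
    + intros x Hx. pose proof (proj1 (Helt x) Hx) as (d & Hd & E).
      assert (Hdk : elements k (val d)).
      { apply Helt. rewrite cls_val. apply (ord_in_K (Y:=YV X)); apply Hd. }
      exists (val d). split; auto. apply Hrel; auto. rewrite cls_val; auto.
    + intros x d Hx Hd. rewrite Hrel; auto. intros [Hd1 _]. apply (is_ordinal_cls (elements k) dtr); auto. apply Hd1.
    + intros x x' d Hx Hx' Hd. rewrite !Hrel; auto. intros [_ E1] [_ E2]. apply cls_eq. congruence.
    + intros d Hd Hod. apply (is_ordinal_cls (elements k) dtr) in Hod; auto.
      assert (Hdo : oN (N:=NV M) (cls d)).
      { split; auto. apply (constructible_N (Y:=YV X)). now apply Helt. }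
      assert (Hk : elements k (val (B (cls d)))) by (apply Helt; rewrite cls_val; exists (cls d); auto).
      (* Every ordinal of the model is the index of some value, so F is onto the ordinals. *)
      exists (val (B (cls d))). split; auto. apply Hrel; auto. now rewrite cls_val.
Qed.
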